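(* Let $A\in\mathbb{C}^{N\times N}$ be an invertible matrix, let $v\neq 0$ be a vector in $\mathbb{C}^N$, and let $b\in\mathbb{C}^N$. Suppose that the affine map $\phi(z)=Az+b$ on $\mathbb{C}^N$ has a fixed point, and that $v$ belongs to a subspace $M\subset\mathbb{C}^N$ that reduces $A$ and such that $\|(A|_M)^{-1}\|<1$. Then the operator $C_\phi\circ D_v$ acting on $H(\mathbb{C}^N)$ is strongly mixing in the Gaussian sense.
   Context: $H(\mathbb{C}^N)$ is the Fréchet space of entire functions on $\mathbb{C}^N$ with the topology of uniform convergence on compact sets. $C_\phi f=f\circ\phi$, and $D_vf(z)=\lim_{s\to0}\frac{f(z+sv)-f(z)}{s}=\nabla f(z)\cdot v$ is the derivative in the direction $v$, so $(C_\phi\circ D_v)f(z)=(D_vf)(Az+b)$. A subspace $M$ reduces $A$ if both $M$ and its orthogonal complement $M^\perp$ (for the standard inner product) are invariant under $A$. $\|(A|_M)^{-1}\|$ is the operator norm of the inverse of $A|_M:M\to M$ with respect to the Euclidean norm. Let $T$ be a continuous linear operator on a separable Fréchet space $X$. A Borel probability measure on $X$ is Gaussian if it is the distribution of an almost surely convergent random series $\sum_{n=0}^\infty g_nx_n$, where $(x_n)\subset X$ and $(g_n)$ is a sequence of independent standard complex Gaussian variables. $T$ is strongly mixing in the Gaussian sense if there exists a $T$-invariant Gaussian Borel probability measure $\mu$ on $X$ with full support (every nonempty open set has positive measure) such that $\lim_{n\to\infty}\mu(A'\cap T^{-n}(B'))=\mu(A')\mu(B')$ for all measurable sets $A',B'\subset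 X$. *)

(* Defs.v *)
From HB Require Import structures.
From mathcomp Require Import all_boot all_order all_algebra.
From mathcomp Require Import all_classical all_reals all_analysis.
From mathcomp.real_closed Require Import complex.
From mathcomp Require Import ring.

Set Implicit Arguments.
Unset Strict Implicit.
Unset Printing Implicit Defensive.

Import Order.TTheory GRing.Theory Num.Theory.
Import numFieldNormedType.Exports.

Local Open Scope classical_set_scope.
Local Open Scope ring_scope.

HB.instance Definition _ (R : realType) := NormedModule.copy R[i] (R[i])^o.

Section entire_functions.
Variables (R : realType) (N : nat).
Local Notation C := R[i].

Definition entire : set ('cV[C]_N -> C) :=
  [set f | forall z, differentiable f z].

Definition entire_pred : {pred 'cV[C]_N -> C} := mem entire.

Lemma entire_submod_closed : submod_closed entire_pred.
Proof.
split=> [|a f g]; rewrite !inE /entire /=.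
  by move=> z; exact: differentiable_cst.
move=> hf hg z; apply: differentiableD; last exact: hg.
by apply: differentiableZ; exact: hf.
Qed.

HB.instance Definition _ :=
  GRing.isSubmodClosed.Build C ('cV[C]_N -> C) entire_pred entire_submod_closed.

Record entireType := Entire {
  entire_fun :> 'cV[C]_N -> C ;
  entire_funP : entire_fun \in entire_pred }.

HB.instance Definition _ := [isSub for entire_fun].
HB.instance Definition _ := [Choice of entireType by <:].
HB.instance Definition _ := [SubChoice_isSubLmodule of entireType by <:].

Definition entire_incl (f : entireType) : {family compact, 'cV[C]_N -> C} := f.

HB.instance Definition _ := isPointed.Build entireType 0.
HB.instance Definition _ :=
  Uniform.copy entireType (initial_topology entire_incl).

Implicit Types (f g : entireType) (K : set 'cV[C]_N).

Definition entire_ball K (e : C) f : set entireType :=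
  [set g | forall z, K z -> `|f z - g z| < e].

Lemma entire_cvgP (F : set_system entireType) f : Filter F ->
  F --> f <->
  forall K e, compact K -> 0 < e -> F (entire_ball K e f).
Proof.
move=> FF; split=> [Ff K e cK e0|h].
  apply: Ff.
  have := @initial_continuous _ _ entire_incl f.
  apply; apply: (@fam_nbhs _ _ compact K [set xy | `|xy.1 - xy.2| < e]) => //.
  by rewrite -entourage_ballE; exists e => // -[x y] /=; rewrite -ball_normE.
move=> A [B [[W oW <-] Wf WA]]; apply: filterS WA _.
have : {family compact, entire_incl @ F --> entire_incl f}.
  apply/fam_cvgP => K cK P /uniform_nbhs [E [entE EP]].
  have [e e0 eE] := entE.
  have := h _ _ cK e0; apply: filterS => g fg.
  apply: EP => z Kz; apply: eE; exact: fg.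
by move=> /(_ W); apply; exact: open_nbhs_nbhs.
Qed.

Lemma entire_nbhsP f (A : set entireType) : nbhs f A <->
  exists K e, [/\ compact K, 0 < e & entire_ball K e f `<=` A].
Proof.
split=> [fA|[K [e [cK e0 KA]]]]; last first.
  by apply: filterS KA _; apply: (entire_cvgP f _).1 => //; exact: nbhs_filter.
pose D := [set Ke : set 'cV[C]_N * C | compact Ke.1 /\ 0 < Ke.2].
pose G := filter_from D (fun Ke => entire_ball Ke.1 Ke.2 f).
have FG : Filter G.
  apply: filter_from_filter.
    by exists (set0, 1); split => //=; exact: compact0.
  move=> [K e] [L d] [/= cK e0] [/= cL d0].
  have ed : (e >=< d)%O by apply: real_comparable; exact: gtr0_real.
  exists (K `|` L, Num.min e d).
    by split => /=; [exact: compactU|rewrite comparable_lt_min// e0 d0].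
  move=> g /= fg; split=> z Kz.
    by have /= := fg z (or_introl Kz); rewrite comparable_lt_min// => /andP[].
  by have /= := fg z (or_intror Kz); rewrite comparable_lt_min// => /andP[].
have : G --> f.
  by apply/entire_cvgP => K e cK e0; exists (K, e).
by move=> /(_ _ fA) [[K e] [/= cK e0] KA]; exists K, e.
Qed.

Lemma entire_fun_continuous f : continuous f.
Proof.
move=> z; apply: differentiable_continuous.
by have := entire_funP f; rewrite inE; apply.
Qed.

Lemma entire_fun_bounded K f : compact K ->
  exists2 M : C, 0 < M & forall z, K z -> `|f z| < M.
Proof.
move=> /compact_near_coveringP/(_ _ (+oo : set_system C) (fun M z => `|f z| < M)).
move=> /(_ _ _)[] => [z Kz|M [Mr MP]]; last first.
  have M1r : (M + 1 \is Num.real)%R by rewrite realD.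
  exists (`|M| + 1); first by rewrite ltr_wpDl.
  apply: MP; rewrite (le_lt_trans (real_ler_norm Mr))// ltrDl//.
have /cvgrPdist_lt/(_ 1 ltr01) fz := @entire_fun_continuous f z.
exists ([set y | `|f z - f y| < 1], [set M | `|f z| + 1 < M]).
  split => /=; first exact: fz.
  by exists (`|f z| + 1); split => //; rewrite realD// normr_real.
move=> [y M] /= [fzy]; apply: le_lt_trans.
rewrite -[f y](subrK (f z)) addrC; apply: le_trans (ler_normD _ _) _.
by rewrite lerD2l distrC ltW.
Qed.

Lemma entire_add_continuous :
  continuous (fun x : entireType * entireType => x.1 + x.2).
Proof.
move=> [f g]; apply/entire_cvgP => K e cK e0 /=.
have e20 : 0 < e / 2 by rewrite divr_gt0.
exists (entire_ball K (e / 2) f, entire_ball K (e / 2) g).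
  by split => /=; apply/entire_nbhsP; exists K, (e / 2); split.
move=> [f' g'] /= [ff gg] z Kz /=.
rewrite opprD addrACA [e]splitr (le_lt_trans (ler_normD _ _))// ltrD//.
  exact: ff.
exact: gg.
Qed.

Lemma entire_scale_continuous :
  continuous (fun x : C^o * entireType => x.1 *: x.2).
Proof.
move=> [a f]; apply/entire_cvgP => K e cK e0 /=.
have [M M0 fM] := entire_fun_bounded f cK.
have a1 : 0 < `|a| + 1 by rewrite ltr_wpDl.
pose d := e / 2 / (`|a| + 1).
have d0 : 0 < d by rewrite !divr_gt0.
exists ([set b | `|a - b| < 1] `&` [set b | `|a - b| < e / 2 / M],
        entire_ball K d f).
  split => /=; last by apply/entire_nbhsP; exists K, d; split.
  by apply: filterI; apply: (@nbhsx_ballx _ C^o) => //; rewrite !divr_gt0.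
move=> [b g] /= [[b1 bM] fg] z Kz /=.
have -> : a *: f z - b *: g z = (a - b) * f z + b * (f z - g z).
  by rewrite mulrBl mulrBr addrA subrK.
rewrite [e]splitr (le_lt_trans (ler_normD _ _))// !normrM ltrD//.
  have [->|/= fz0] := eqVneq (f z) 0; first by rewrite normr0 mulr0 divr_gt0.
  rewrite (lt_trans (y := (e / 2 / M) * `|f z|))// ?ltr_pM2r ?normr_gt0//.
  by rewrite mulrAC ltr_pdivrMr// ltr_pM2l ?divr_gt0// fM.
rewrite (le_lt_trans (y := (`|a| + 1) * `|f z - g z|))//.
  rewrite ler_wpM2r//; rewrite -[b](subrK a) addrC (le_trans (ler_normD _ _))//.
  by rewrite lerD2l distrC ltW.
by rewrite mulrC -ltr_pdivlMr//; exact: fg.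
Qed.

Lemma entire_locally_convex : exists2 B : set_system entireType,
  (forall b, b \in B -> convex_set b) & basis B.
Proof.
exists [set U | open U /\ convex_set U].
  by move=> b; rewrite inE => -[].
split=> [b []//|f A /entire_nbhsP[K [e [cK e0 KA]]]].
pose U := [set g : entireType | exists r : C, [/\ 0 <= r, r < e &
  forall z, K z -> `|f z - g z| <= r]].
exists U; last first.
  by move=> g [r [r0 re fg]]; apply: KA => z Kz; rewrite (le_lt_trans (fg _ Kz)).
split; last by exists 0; split => // z _; rewrite subrr normr0.
split.
  rewrite openE => g [r [r0 re fg]].
  apply/entire_nbhsP; exists K, ((e - r) / 2).
  split => //; first by rewrite divr_gt0// subr_gt0.
  move=> h gh; exists (r + (e - r) / 2); split.
  - by rewrite addr_ge0// divr_ge0// subr_ge0 ltW.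
  - rewrite -ltrBrDl ltr_pdivrMr// mulr_natr mulr2n ltrDl subr_gt0//.
  - move=> z Kz; rewrite -(subrKA (g z)) (le_trans (ler_normD _ _))// lerD//.
      exact: fg.
    by rewrite ltW//; exact: gh.
apply/convex_setW => g h; rewrite !inE => -[r [r0 re fg]] [s [s0 se fh]] l l0 l1.
pose t : C := l%:num; have t0 : 0 < t := l0.
have t'0 : 0 < 1 - t by rewrite subr_gt0.
rewrite inE; exists (t * r + (1 - t) * s); split.
- by rewrite addr_ge0// mulr_ge0// ltW.
- rewrite -[ltRHS]mul1r -[X in X * e](subrK t) addrC [ltRHS]mulrDl.
  by rewrite ltrD// ltr_pM2l.
- move=> z Kz.
  have -> : f z - (conv l g h : entireType) z =
      t * (f z - g z) + (1 - t) * (f z - h z).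
    rewrite (_ : (conv l g h : entireType) z = t * g z + (1 - t) * h z)//.
    by ring.
  rewrite (le_trans (ler_normD _ _))// !normrM gtr0_norm// (gtr0_norm t'0).
  by rewrite lerD// ler_pM2l//; [exact: fg|exact: fh].
Qed.

HB.instance Definition _ :=
  PreTopologicalNmodule_isTopologicalNmodule.Build entireType
    entire_add_continuous.
HB.instance Definition _ :=
  TopologicalNmodule_isTopologicalLmodule.Build C entireType
    entire_scale_continuous.
HB.instance Definition _ :=
  Uniform_isTvs.Build C entireType entire_locally_convex.

End entire_functions.

(* The Borel measurable space of a tvs. It is an alias because measurable types
   must be pointed, which [tvsType] is not; the chosen point is 0. *)
Definition borel (K : numDomainType) (X : tvsType K) : Type := X.

HB.instance Definition _ (K : numDomainType) (X : tvsType K) :=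
  Choice.copy (borel X) X.
HB.instance Definition _ (K : numDomainType) (X : tvsType K) :=
  isPointed.Build (borel X) (0 : X).
HB.instance Definition _ (K : numDomainType) (X : tvsType K) :=
  @isMeasurable.Build (sigma_display (@open X)) (borel X) <<s @open X >>
    (@sigma_algebra0 _ setT (@open X)) (@sigma_algebraC (borel X) (@open X))
    (@sigma_algebra_bigcup _ setT (@open X)).

Section gaussian_measures.
Variable R : realType.
Local Notation C := R[i].
Local Open Scope ereal_scope.

(* Normalized by E|Z|^2 = 1: the real and imaginary parts are independent
   centered real Gaussians of variance 1/2. [normal_prob] takes the standard
   deviation. *)
Definition standard_complex_gaussian d (Omega : measurableType d)
    (P : probability Omega R) (Z : {RV P >-> borel C}) : Prop :=
  forall U V : set R, measurable U -> measurable V ->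
    P ((fun w => complex.Re (Z w)) @^-1` U `&`
       (fun w => complex.Im (Z w)) @^-1` V) =
    normal_prob 0 (Num.sqrt 2^-1)%R U * normal_prob 0 (Num.sqrt 2^-1)%R V.

Definition independent_seq d (Omega : measurableType d)
    d' (T : measurableType d') (P : probability Omega R)
    (Z : nat -> {RV P >-> T}) : Prop :=
  forall (s : seq nat) (B : nat -> set T), uniq s ->
    (forall n, measurable (B n)) ->
    P (\bigcap_(n in [set` s]) Z n @^-1` B n) =
    \prod_(n <- s) P (Z n @^-1` B n).

(* [S] is a measurable version of the sum, which is only defined almost surely. *)
Definition gaussian_measure (X : tvsType C) (mu : probability (borel X) R) :=
  exists d (Omega : measurableType d) (P : probability Omega R)
    (g : nat -> {RV P >-> borel C}) (x : nat -> X) (S : {RV P >-> borel X}),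
  [/\ forall n, standard_complex_gaussian (g n),
      independent_seq g,
      {ae P, forall w, (\sum_(0 <= k < n) (g k w : C) *: x k)%R @[n --> \oo]
                       --> (S w : X)}
    & forall B : set X, measurable (B : set (borel X)) ->
        mu B = distribution P S B ].

Definition strongly_mixing_gaussian (X : tvsType C) (T : X -> X) : Prop :=
  exists mu : probability (borel X) R,
  [/\ gaussian_measure mu,
      forall B : set (borel X), measurable B -> mu (T @^-1` B) = mu B,
      forall U : set X, open U -> U !=set0 -> 0 < mu U
    & forall A B : set (borel X), measurable A -> measurable B ->
        mu (A `&` iter n T @^-1` B) @[n --> \oo] --> mu A * mu B ].

End gaussian_measures.

Section linear_algebra.
Variables (R : realType) (N : nat).
Local Notation C := R[i].
Implicit Types (M : {vspace 'cV[C]_N}) (A : 'M[C]_N) (u w : 'cV[C]_N).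

Definition inner u w : C := \sum_i u i 0 * (w i 0)^*.

Definition enorm u : R := Num.sqrt (complex.Re (inner u u)).

Definition orthogonal_complement M : set 'cV[C]_N :=
  [set w | forall u, u \in M -> inner w u = 0].

Definition reduces M A : Prop :=
  (forall u, u \in M -> A *m u \in M) /\
  (forall w, orthogonal_complement M w -> orthogonal_complement M (A *m w)).

(* The compression of A to M, which is the restriction A|_M : M -> M as soon as
   M is invariant under A. It is bijective if moreover A is invertible, and
   then [(restriction A M)^-1%VF] is its inverse. *)
Definition restriction A M : 'End(subvs_of M) :=
  linfun (vsproj M \o (mulmx A \o vsval)).

Definition operator_norm M (f : 'End(subvs_of M)) : \bar R :=
  ereal_sup [set (enorm (vsval (f u)))%:E | u in [set u | enorm (vsval u) <= 1]].

Definition affine A (b z : 'cV[C]_N) : 'cV[C]_N := A *m z + b.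

End linear_algebra.

(* Main.v *)
(* Let p be a fixed point of phi and T = C_phi o D_v. Integration along v gives
   a right inverse R of T on polynomials, normalized by R q = 0 on the affine
   hyperplane p + v^perp. As A^-1 contracts M by some c < 1 and preserves
   M^perp, the bound of R^k q on a ball picks up a factor O(c^i) at the i-th
   integration, so R^k q decays faster than any geometric sequence. Starting
   from the polynomials q_j in the coordinates of v^perp, which T kills, the
   chains R^k q_j span all polynomials because T is nilpotent on them. Rescaled,
   they form a family x_jk with T x_j0 = 0 and T x_j(k+1) = x_jk, so T acts as a
   backward shift on the Gaussian series S = sum g_jk x_jk: replacing g_jk by
   g_j(k+1) turns S into T S. Hence the law of S is T-invariant, it is mixing
   because the shift of an independent family is, and it has full support
   because the x_jk span a dense subspace.

   The probability space is that of coin tossing: the digits of even and of odd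
   rank of a sequence are two independent such sequences, so iterating this
   splitting yields the independent g_jk, and the map keeping the digits of odd
   rank is the shift. *)

Require Import Defs.
From HB Require Import structures.
From mathcomp Require Import all_boot all_order all_algebra.
From mathcomp Require Import all_classical all_reals all_analysis.
From mathcomp.real_closed Require Import complex.
From mathcomp Require Import measurable_realfun.
From mathcomp Require Import ring lra zify.

Set Implicit Arguments.
Unset Strict Implicit.
Unset Printing Implicit Defensive.

Import Order.TTheory GRing.Theory Num.Theory.
Import numFieldNormedType.Exports.

Local Open Scope classical_set_scope.
Local Open Scope ring_scope.

(** * Modulus and topology of the complex numbers *)

(** The delicate point is the decay of the chains. [A^-1] may expand [M^perp], by a factor [a] say,
    so that [k] integrations evaluate the starting polynomial at distance of order [a ^ k]. Its
    degree [d] is fixed along the chain, so this costs at most [a ^ (d k)], a geometric factor,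
    while the shrinking integration paths contribute [c ^ (k (k - 1) / 2)]. Hence the sizes in [M]
    and in [M^perp] are tracked separately. The constants are linked. The chains decay like
    [8 ^ -(j + k)], the coefficients may grow like [2 ^ (j + k)], and the products leave the weights
    [4 ^ -(j + k)]. These are also the inverse squares of the allowed growth: with a tail bound of
    order [1 / r ^ 2] for Gaussians, one convergent series controls both the random sum and the
    probability of too fast a growth. Off a null set the rest is deterministic: the sums converge
    locally uniformly and are determined, up to a small error, by finitely many coefficients. The
    complex analysis is one-dimensional; several variables enter by restriction to complex lines. *)

Section complex_modulus.
Variable R : realType.
Local Notation C := R[i].
Implicit Types (z w : C) (x y : R).

(** The norm of [R[i]] takes its values in [R[i]]; a modulus with values in [R] opens the estimates
    to [lra] and [nra]. *)
Definition cmod z : R := ComplexField.Normc.normc z.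
Definition ofR x : C := (x%:C)%C.

Lemma normE z : `|z| = ofR (cmod z).
Proof. by []. Qed.

Lemma ofRD x y : ofR (x + y) = ofR x + ofR y.
Proof. exact: (rmorphD (real_complex R)). Qed.
Lemma ofRB x y : ofR (x - y) = ofR x - ofR y.
Proof. exact: (rmorphB (real_complex R)). Qed.
Lemma ofRM x y : ofR (x * y) = ofR x * ofR y.
Proof. exact: (rmorphM (real_complex R)). Qed.
Lemma ofR0 : ofR 0 = 0. Proof. by []. Qed.
Lemma ofR1 : ofR 1 = 1. Proof. by []. Qed.

Lemma ofR_le x y : (ofR x <= ofR y) = (x <= y).
Proof. exact: lecR. Qed.
Lemma ofR_lt x y : (ofR x < ofR y) = (x < y).
Proof. exact: ltcR. Qed.
Lemma ofR_inj : injective ofR.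
Proof. by move=> x y []. Qed.

Lemma gtc0P z : 0 < z -> exists2 x, 0 < x & z = ofR x.
Proof.
move=> z0; exists (complex.Re z).
  by move: z0; rewrite ltcE => /andP[].
by rewrite /ofR RRe_real// gtr0_real.
Qed.

Lemma cmod_ge0 z : 0 <= cmod z.
Proof. by rewrite -ofR_le -normE ofR0. Qed.
Lemma cmodM z w : cmod (z * w) = cmod z * cmod w.
Proof. by apply: ofR_inj; rewrite ofRM -!normE normrM. Qed.
Lemma cmodN z : cmod (- z) = cmod z.
Proof. by apply: ofR_inj; rewrite -!normE normrN. Qed.
Lemma cmodB z w : cmod (z - w) = cmod (w - z).
Proof. by rewrite -cmodN opprB. Qed.
Lemma cmodD z w : cmod (z + w) <= cmod z + cmod w.
Proof. by rewrite -ofR_le ofRD -!normE ler_normD. Qed.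
Lemma cmod_subD z w : cmod (z - w) <= cmod z + cmod w.
Proof. by rewrite -(cmodN w) cmodD. Qed.
Lemma cmod0 : cmod 0 = 0.
Proof. by apply: ofR_inj; rewrite -normE normr0. Qed.
Lemma cmod1 : cmod 1 = 1.
Proof. by apply: ofR_inj; rewrite -normE normr1. Qed.
Lemma cmod_eq0 z : (cmod z == 0) = (z == 0).
Proof. by rewrite -(inj_eq ofR_inj) -normE ofR0 normr_eq0. Qed.
Lemma cmod_gt0 z : (0 < cmod z) = (z != 0).
Proof. by rewrite lt_def cmod_eq0 cmod_ge0 andbT. Qed.
Lemma cmodX z n : cmod (z ^+ n) = cmod z ^+ n.
Proof. by elim: n => [|n IH]; rewrite ?expr0 ?cmod1// !exprS cmodM IH. Qed.
Lemma cmodV z : cmod z^-1 = (cmod z)^-1.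
Proof. exact: ComplexField.Normc.normcV. Qed.
Lemma cmod_ofR x : cmod (ofR x) = `|x|.
Proof. by rewrite /cmod /ofR /= expr0n addr0 sqrtr_sqr. Qed.
Lemma cmodi : cmod 'i%C = 1.
Proof. by rewrite /cmod /= expr0n expr1n add0r sqrtr1. Qed.
Lemma ler_cmodB z w : cmod z - cmod w <= cmod (z - w).
Proof. by rewrite lerBlDr -{1}(subrK w z) cmodD. Qed.

Lemma cmod_sum I (r : seq I) (P : pred I) (F : I -> C) :
  cmod (\sum_(i <- r | P i) F i) <= \sum_(i <- r | P i) cmod (F i).
Proof.
elim/big_rec2: _ => [|i y x _ h]; first by rewrite cmod0.
by apply: le_trans (cmodD _ _) _; rewrite lerD2l.
Qed.

Lemma Re_le_cmod z : `|complex.Re z| <= cmod z.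
Proof. by rewrite -ofR_le -normE; exact: normc_ge_Re. Qed.
Lemma Im_le_cmod z : `|complex.Im z| <= cmod z.
Proof.
have := Re_le_cmod (z * 'i%C).
by rewrite cmodM cmodi mulr1 ReiNIm normrN.
Qed.
Lemma cmod_le_ReIm z : cmod z <= `|complex.Re z| + `|complex.Im z|.
Proof.
rewrite {1}[z]complexE; apply: le_trans (cmodD _ _) _.
by rewrite -!/(ofR _) cmodM cmodi mul1r !cmod_ofR.
Qed.

Lemma ReB z w : complex.Re (z - w) = complex.Re z - complex.Re w.
Proof. by case: z; case: w. Qed.
Lemma ImB z w : complex.Im (z - w) = complex.Im z - complex.Im w.
Proof. by case: z; case: w. Qed.
Lemma ReMofR z x : complex.Re (z * ofR x) = complex.Re z * x.
Proof. by case: z => a b /=; ring. Qed.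
Lemma eq0_small z : (forall e, 0 < e -> cmod z <= e) -> z = 0.
Proof.
move=> h; apply/eqP; rewrite -cmod_eq0 eq_le cmod_ge0 andbT.
by apply/ler_addgt0Pr => e e0; rewrite add0r; exact: h.
Qed.

Section topology.
Variable T : topologicalType.
Implicit Types f : T -> C.

Lemma cmod_cvgP (F : set_system T) (FF : Filter F) f l :
  f @ F --> l <-> forall e, 0 < e -> \forall t \near F, cmod (f t - l) < e.
Proof.
split=> [/cvgrPdist_lt h e e0|h].
  have /h : 0 < ofR e by rewrite -ofR0 ofR_lt.
  by apply: filterS => t; rewrite normE ofR_lt cmodB.
apply/cvgrPdist_lt => _ /gtc0P[e e0 ->].
by apply: filterS (h e e0) => t; rewrite normE ofR_lt cmodB.
Qed.

Lemma Re_cvg (F : set_system T) (FF : Filter F) f l :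
  f @ F --> l -> (complex.Re (f t)) @[t --> F] --> complex.Re l.
Proof.
move=> /cmod_cvgP h; apply/cvgrPdist_lt => e /h; apply: filterS => t.
by apply: le_lt_trans; rewrite distrC -ReB Re_le_cmod.
Qed.

Lemma Im_cvg (F : set_system T) (FF : Filter F) f l :
  f @ F --> l -> (complex.Im (f t)) @[t --> F] --> complex.Im l.
Proof.
move=> /cmod_cvgP h; apply/cvgrPdist_lt => e /h; apply: filterS => t.
by apply: le_lt_trans; rewrite distrC -ImB Im_le_cmod.
Qed.

Lemma ReIm_cvg (F : set_system T) (FF : Filter F) f l :
  (complex.Re (f t)) @[t --> F] --> complex.Re l ->
  (complex.Im (f t)) @[t --> F] --> complex.Im l -> f @ F --> l.
Proof.
move=> /cvgrPdist_lt hr /cvgrPdist_lt hi; apply/cmod_cvgP => e e0.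
have e2 : 0 < e / 2 by lra.
near=> t.
have rt : `|complex.Re l - complex.Re (f t)| < e / 2 by near: t; exact: hr.
have it : `|complex.Im l - complex.Im (f t)| < e / 2 by near: t; exact: hi.
apply: le_lt_trans (cmod_le_ReIm _) _; rewrite ReB ImB distrC [X in _ + X]distrC.
lra.
Unshelve. all: by end_near. Qed.

End topology.

Lemma nbhs_cmodP z (P : set C) :
  nbhs z P <-> exists2 d, 0 < d & forall w, cmod (w - z) < d -> P w.
Proof.
split=> [/nbhs_ballP[_ /= /gtc0P[d d0 ->]] h|[d d0 h]].
  exists d => // w wz; apply: h.
  by rewrite -ball_normE/= normE ofR_lt cmodB.
apply/nbhs_ballP; exists (ofR d) => /=; first by rewrite -ofR0 ofR_lt.
by move=> w; rewrite -ball_normE/= normE ofR_lt cmodB => /h.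
Qed.

Lemma ofR_continuous : continuous ofR.
Proof.
move=> x; apply/cmod_cvgP => e e0.
have := @cvg_id _ (nbhs x); move/cvgrPdist_lt => /(_ _ e0).
by apply: filterS => y; rewrite -ofRB cmod_ofR distrC.
Qed.

End complex_modulus.

(** * Derivatives and primitives of complex functions *)

Section real_primitive.
Variable R : realType.
Local Notation mu := (@lebesgue_measure R).
Implicit Types (u : R -> R) (a t x : R).

Lemma integrable_itv_continuous u a b :
  continuous u -> mu.-integrable `[a, b] (EFin \o u).
Proof.
move=> cu; apply: continuous_compact_integrable; first exact: segment_compact.
exact: continuous_subspaceT.
Qed.

(* Only one of the two intervals is nonempty: this is the oriented integral from
   0 to t. *)
Definition primR u t : R :=
  \int[mu]_(s in `[0, t]) u s - \int[mu]_(s in `[t, 0]) u s.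

(** With a base point to the left of both 0 and [t], the oriented integral becomes an integral with
    fixed lower end minus a constant, which is the form the fundamental theorem of calculus applies
    to. *)
Lemma primRE u a t : continuous u -> a <= t -> a <= 0 ->
  primR u t = \int[mu]_(s in `[a, t]) u s - \int[mu]_(s in `[a, 0]) u s.
Proof.
move=> cu at_ a0; rewrite /primR.
have itvB x y : a <= x -> x <= y -> \int[mu]_(s in `[a, y]) u s -
    \int[mu]_(s in `[a, x]) u s = \int[mu]_(s in `[x, y]) u s.
  move=> ax xy; rewrite Rintegral_itvB ?bnd_simp//; last first.
    exact: integrable_itv_continuous.
  rewrite Rintegral_itv_obnd_cbnd//.
  apply: integrableS (integrable_itv_continuous x y cu) => //.
  by apply: subset_itv; rewrite bnd_simp.
have zero x y : y <= x -> \int[mu]_(s in `[x, y]) u s = 0.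
  rewrite le_eqVlt => /predU1P[->|yx]; first by rewrite set_itv1 Rintegral_set1.
  by rewrite set_itv_ge ?Rintegral_set0// bnd_simp -ltNge.
have [t0|/ltW t0] := leP 0 t.
  by rewrite (itvB _ _ a0 t0) (zero _ _ t0) subr0.
by rewrite (zero _ _ t0) sub0r -(itvB _ _ at_ t0) opprB.
Qed.

Lemma primR_derive u t : continuous u -> is_derive t 1 (primR u) (u t).
Proof.
move=> cu; pose a := - `|t| - 1.
have at_ : a < t by rewrite /a ltrBlDr ltrNl; have := ler_norm (- t); rewrite normrN; lra.
have a0 : a < 0 by rewrite /a; have := normr_ge0 t; lra.
have ui : mu.-integrable `[a, t + 1] (EFin \o u) by exact: integrable_itv_continuous.
have tt : t < t + 1 by rewrite ltrDl.
have [D1 D2] := continuous_FTC1_closed tt ui at_ (cu t).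
pose F x : R^o := \int[mu]_(s in `[a, x]) u s.
have DF : is_derive t (1 : R) F (u t) by split; [exact: D1|rewrite -derive1E; exact: D2].
have : is_derive t (1 : R) (fun x => F x - F 0) (u t).
  by rewrite -[u t]subr0; exact: is_deriveB.
apply: near_eq_is_derive; near=> x; apply/esym.
rewrite (@primRE u a)//; last exact: ltW.
by apply: ltW; near: x; exact: lt_nbhsr.
Unshelve. all: by end_near. Qed.

End real_primitive.

Section complex_derivatives.
Variable R : realType.
Local Notation C := R[i].
Implicit Types (U u : R -> C) (t s x y : R) (g h : C -> C) (p w : C).

(* Caratheodory's form of derivability, in which the rules of calculus are
   algebraic identities. *)
Definition cder U t (l : C) := exists phi : R -> C,
  [/\ forall s, U s - U t = phi s * ofR (s - t),
      {for t, continuous phi} & phi t = l].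

Definition cdif g p (l : C) := exists phi : C -> C,
  [/\ forall w, g w - g p = phi w * (w - p),
      {for p, continuous phi} & phi p = l].

Lemma cder_continuous U t l : cder U t l -> {for t, continuous U}.
Proof.
move=> [phi [h cphi _]].
rewrite (_ : U = (fun s => U t + phi s * ofR (s - t))); last first.
  by apply/funext => s; rewrite -h addrC subrK.
apply: (@continuousD _ R[i]); first exact: cst_continuous.
apply: continuousM; first exact: cphi.
apply: (@continuous_comp _ _ _ (fun s => s - t) (@ofR R)); last exact: ofR_continuous.
by apply: (@continuousB _ R^o); [exact: cvg_id|exact: cst_continuous].
Qed.

Lemma cdif_continuous g p l : cdif g p l -> {for p, continuous g}.
Proof.
move=> [phi [h cphi _]].
rewrite (_ : g = (fun w : C => g p + phi w * (w - p))); last first.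
  by apply/funext => s; rewrite -h addrC subrK.
apply: (@continuousD _ R[i]); first exact: cst_continuous.
apply: continuousM; first exact: cphi.
by apply: (@continuousB _ R[i]); [exact: cvg_id|exact: cst_continuous].
Qed.

Lemma cderD U V t l m : cder U t l -> cder V t m ->
  cder (fun s => U s + V s) t (l + m).
Proof.
move=> [phi [h1 c1 <-]] [psi [h2 c2 <-]]; exists (fun s => phi s + psi s).
split; last by [].
  by move=> s; rewrite mulrDl -h1 -h2; ring.
by apply: (@continuousD _ R[i]); [exact: c1|exact: c2].
Qed.

Lemma cderZ (c : C) U t l : cder U t l -> cder (fun s => c * U s) t (c * l).
Proof.
move=> [phi [h1 c1 <-]]; exists (fun s => c * phi s); split; last by [].
  by move=> s; rewrite -mulrA -h1; ring.
by apply: continuousM; [exact: cst_continuous|exact: c1].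
Qed.

Lemma cderB U V t l m : cder U t l -> cder V t m ->
  cder (fun s => U s - V s) t (l - m).
Proof.
move=> hU /(cderZ (-1)) hV; rewrite -[- m]mulN1r.
rewrite (_ : (fun s => _) = (fun s => U s + -1 * V s)); first exact: cderD.
by apply/funext => s; rewrite mulN1r.
Qed.

Lemma cder_comp g U t l m : cder U t l -> cdif g (U t) m ->
  cder (fun s => g (U s)) t (m * l).
Proof.
move=> dU; have cU := cder_continuous dU.
case: dU => [phi [h1 c1 <-]] [psi [h2 c2 <-]].
exists (fun s => psi (U s) * phi s); split; last by [].
  by move=> s; rewrite h2 h1 mulrA.
apply: continuousM; last exact: c1.
by apply: (@continuous_comp _ _ _ U psi); [exact: cU|exact: c2].
Qed.

Lemma cder_is_derive_Re U t l : cder U t l ->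
  is_derive t (1 : R) (fun s => complex.Re (U s) : R^o) (complex.Re l).
Proof.
move=> [phi [h1 c1 <-]]; apply/is_derive1_caratheodory.
exists (fun s => complex.Re (phi s)); split; last by [].
  by move=> s; rewrite -ReB h1 ReMofR.
exact: Re_cvg.
Qed.

Lemma cder_ReIm U t l :
  is_derive t (1 : R) (fun s => complex.Re (U s) : R^o) (complex.Re l) ->
  is_derive t (1 : R) (fun s => complex.Im (U s) : R^o) (complex.Im l) ->
  cder U t l.
Proof.
move=> /is_derive1_caratheodory[f [f1 f2 f3]] /is_derive1_caratheodory[g [g1 g2 g3]].
exists (fun s => (f s +i* g s)%C); split.
- move=> s; move: (f1 s) (g1 s).
  case: (U s) => a b; case: (U t) => c d /= e1 e2.
  rewrite /ofR; apply/eqP; rewrite eq_complex /= e1 e2 !mulr0 subr0 add0r.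
  by rewrite !eqxx.
- by apply: ReIm_cvg.
- by rewrite f3 g3; case: l {f3 g3}.
Qed.

Lemma cder_bound U u (x y M : R) :
  (forall t, Num.min x y <= t <= Num.max x y -> cder U t (u t) /\ cmod (u t) <= M) ->
  cmod (U y - U x) <= M * `|y - x|.
Proof.
wlog xy : x y / x <= y => [wl|].
  have /orP[xy|yx] := le_total x y; first exact: wl.
  by move=> h; rewrite cmodB distrC; apply: wl => // t; rewrite minC maxC; exact: h.
rewrite min_l// max_r// => h.
have [D0|D0] := eqVneq (U y - U x) 0.
  rewrite D0 cmod0 mulr_ge0//; have [] := h x _; first by rewrite lexx.
  by move=> _; apply: le_trans; exact: cmod_ge0.
have m0 : 0 < cmod (U y - U x) by rewrite cmod_gt0.
(* [lam] is the rotation that sends the increment of [U] to the positive real axis: the real mean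
   value theorem for the real part of [lam * U] then loses nothing. *)
pose lam := ((U y - U x)^*)%C / ofR (cmod (U y - U x)).
have lam1 : cmod lam = 1.
  rewrite cmodM cmodV cmod_ofR ger0_norm ?cmod_ge0//.
  rewrite (_ : cmod (_^*)%C = cmod (U y - U x)) ?divff ?gt_eqF//.
  by apply: ofR_inj; rewrite -!normE normcJ.
have lamE : lam * (U y - U x) = ofR (cmod (U y - U x)).
  rewrite /lam mulrAC [_^*%C * _]mulrC -sqr_normc normE expr2 mulfK//.
  by rewrite (inj_eq (@ofR_inj R) _ 0) gt_eqF.
pose f s : R^o := complex.Re (lam * U s).
have df t : x <= t <= y -> is_derive t (1 : R) f (complex.Re (lam * u t)).
  by move=> /h[hu _]; apply: cder_is_derive_Re; exact: cderZ.
case: (@MVT_segment _ f (fun t => complex.Re (lam * u t)) x y xy) => [t tI||c cI fE].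
- by apply: df; rewrite !(itvP tI).
- apply: derivable_within_continuous => t tI.
  by have [] := df t; rewrite ?(itvP tI).
have -> : cmod (U y - U x) = f y - f x.
  by rewrite /f -ReB -mulrBr lamE.
rewrite fE ger0_norm ?subr_ge0// ler_wpM2r ?subr_ge0//.
have [] := h c; first by rewrite !(itvP cI).
move=> _; apply: le_trans; apply: le_trans (ler_norm _) _.
by apply: le_trans (Re_le_cmod _) _; rewrite cmodM lam1 mul1r.
Qed.

Definition prim u t : C :=
  (primR (fun s => complex.Re (u s)) t +i* primR (fun s => complex.Im (u s)) t)%C.

Lemma prim_cder u t : continuous u -> cder (prim u) t (u t).
Proof.
move=> cu; apply: cder_ReIm => /=.
- by apply: (@primR_derive R (fun s => complex.Re (u s))) => s; apply: Re_cvg; exact: cu.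
- by apply: (@primR_derive R (fun s => complex.Im (u s))) => s; apply: Im_cvg; exact: cu.
Qed.

Lemma continuous_small g p : {for p, continuous g} -> forall e, 0 < e ->
  exists2 d, 0 < d & forall w, cmod (w - p) < d -> cmod (g w - g p) < e.
Proof.
move=> cg e e0; apply/nbhs_cmodP.
exact: (cmod_cvgP (nbhs_filter p) g (g p)).1 cg e e0.
Qed.

Lemma cdif_small g p l : cdif g p l -> forall e, 0 < e ->
  exists2 d, 0 < d & forall w, cmod (w - p) < d ->
    cmod (g w - g p - l * (w - p)) <= e * cmod (w - p).
Proof.
move=> [phi [h1 /cmod_cvgP c1 <-]] e /c1 /nbhs_cmodP[d d0 h]; exists d => // w /h wd.
by rewrite h1 -mulrBl cmodM ler_wpM2r ?cmod_ge0// ltW.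
Qed.

Lemma small_cdif g p l : (forall e, 0 < e ->
  exists2 d, 0 < d & forall w, cmod (w - p) < d ->
    cmod (g w - g p - l * (w - p)) <= e * cmod (w - p)) -> cdif g p l.
Proof.
move=> h; exists (fun w => if w == p then l else (g w - g p) / (w - p)); split.
- move=> w; have [->|wp] := eqVneq w p; first by rewrite !subrr mulr0.
  by rewrite divfK// subr_eq0.
- apply/(cmod_cvgP (nbhs_filter p)) => e e0; rewrite eqxx; apply/nbhs_cmodP.
  have e20 : 0 < e / 2 by lra.
  have [d d0 hd] := h _ e20; exists d => // w /hd.
  have [->|wp] := eqVneq w p; first by move=> _; rewrite subrr cmod0.
  have wp0 : w - p != 0 by rewrite subr_eq0.
  rewrite -{1}(divfK wp0 (g w - g p)) -mulrBl cmodM ler_pM2r ?cmod_gt0// => /le_lt_trans; apply.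
  lra.
- by rewrite eqxx.
Qed.

Lemma cdif_cst (c : C) p : cdif (fun=> c) p 0.
Proof.
exists (fun=> 0); split; [|exact: cst_continuous|by []].
by move=> w; rewrite subrr mul0r.
Qed.

Lemma cdif_id p : cdif id p 1.
Proof.
exists (fun=> 1); split; [|exact: cst_continuous|by []].
by move=> w; rewrite mul1r.
Qed.

Lemma cdifD g h p l m : cdif g p l -> cdif h p m ->
  cdif (fun w => g w + h w) p (l + m).
Proof.
move=> [phi [h1 c1 <-]] [psi [h2 c2 <-]]; exists (fun w => phi w + psi w).
split; last by [].
  by move=> w; rewrite mulrDl -h1 -h2; ring.
by apply: (@continuousD _ R[i]); [exact: c1|exact: c2].
Qed.

Lemma cdifM g h p l m : cdif g p l -> cdif h p m ->
  cdif (fun w => g w * h w) p (l * h p + g p * m).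
Proof.
move=> dg; have cg := cdif_continuous dg.
case: dg => [phi [h1 c1 <-]] [psi [h2 c2 <-]].
exists (fun w => phi w * h p + g w * psi w); split; last by [].
  by move=> w; rewrite mulrDl mulrAC -h1 -mulrA -h2; ring.
apply: (@continuousD _ R[i]).
  by apply: continuousM; [exact: c1|exact: cst_continuous].
by apply: continuousM; [exact: cg|exact: c2].
Qed.

Lemma cdifZ (c : C) g p l : cdif g p l -> cdif (fun w => c * g w) p (c * l).
Proof.
by move=> dg; have := cdifM (cdif_cst c p) dg; rewrite mul0r add0r.
Qed.

Lemma cdifB g h p l m : cdif g p l -> cdif h p m ->
  cdif (fun w => g w - h w) p (l - m).
Proof.
move=> dg /(cdifZ (-1)) dh; rewrite -[- m]mulN1r.
rewrite (_ : (fun w => _) = (fun w => g w + -1 * h w)); first exact: cdifD.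
by apply/funext => w; rewrite mulN1r.
Qed.

Lemma cdifV g p l : g p != 0 -> cdif g p l ->
  cdif (fun w => (g w)^-1) p (- l / g p ^+ 2).
Proof.
move=> g0 dg; have cg := cdif_continuous dg; case: dg => [phi [h1 c1 <-]].
pose psi w := - phi w / (g w * g p).
(* The factorization must hold at every [w], including the zeros of [g], where the inverse is 0 by
   convention. Near [p] there are no such zeros and only [psi] matters for continuity. *)
exists (fun w => if g w == 0 then ((g w)^-1 - (g p)^-1) / (w - p) else psi w); split.
- move=> w; case: ifPn => [/eqP gw|gw].
    by rewrite divfK// subr_eq0; apply: contraNneq g0 => <-; rewrite gw.
  have -> : psi w * (w - p) = - (phi w * (w - p)) / (g w * g p).
    by rewrite /psi; field; rewrite gw g0.
  by rewrite -h1; field; rewrite gw g0.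
- have cpsi : {for p, continuous psi}.
    apply: continuousM; first exact: (@continuousN _ R[i]).
    apply: continuousV; first by rewrite mulf_neq0.
    by apply: continuousM; [exact: cg|exact: cst_continuous].
  rewrite /prop_for /continuous_at (negbTE g0); apply: cvg_trans cpsi.
  apply: (@near_eq_cvg _ _ _ (nbhs_filter p)); have gp0 : 0 < cmod (g p) by rewrite cmod_gt0.
  near=> w; have : cmod (g w - g p) < cmod (g p).
    by near: w; exact: (cmod_cvgP (nbhs_filter p) g (g p)).1 cg _ gp0.
  rewrite cmodB => gw; rewrite ifN//; apply: contraTneq gw => ->.
  by rewrite subr0 ltxx.
- by rewrite (negbTE g0) /psi expr2.
Unshelve. all: by end_near. Qed.

Lemma near_cdif g h p l : (\near p, g p = h p) -> cdif g p l -> cdif h p l.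
Proof.
move=> /nbhs_cmodP[d d0 gh] /cdif_small dg; apply: small_cdif => e /dg[d' d'0 h'].
exists (Num.min d d'); first by rewrite lt_min d0.
move=> w; rewrite lt_min => /andP[wd wd'].
by rewrite -!gh ?subrr ?cmod0//; exact: h'.
Qed.

End complex_derivatives.

(** * The Cauchy-Goursat theorem on rectangles *)

Section goursat.
Variable R : realType.
Local Notation C := R[i].
Implicit Types (h q : C -> C) (x y a b : R).

Definition pt x y : C := (x +i* y)%C.

Lemma ptE x y : pt x y = ofR x + 'i%C * ofR y.
Proof. by rewrite {1}[pt x y]complexE. Qed.

Lemma ptB x y x' y' : pt x y - pt x' y' = pt (x - x') (y - y').
Proof. by []. Qed.

Lemma ptK (z : C) : pt (complex.Re z) (complex.Im z) = z.
Proof. by case: z. Qed.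

Lemma cder_ofR t : cder (@ofR R) t 1.
Proof.
exists (fun=> 1); split; [by move=> s; rewrite mul1r ofRB|exact: cst_continuous|by []].
Qed.

Lemma cder_ptl y t : cder (pt^~ y) t 1.
Proof.
exists (fun=> 1); split; [|exact: cst_continuous|by []].
by move=> s; rewrite mul1r ptB subrr.
Qed.

Lemma cder_ptr x t : cder (pt x) t 'i%C.
Proof.
exists (fun=> 'i%C); split; [|exact: cst_continuous|by []].
by move=> s; rewrite ptB subrr ptE ofR0 add0r.
Qed.

(** The ends come in either order because the sides of the rectangles below are oriented and may be
    reversed. *)
Definition between a b t := Num.min a b <= t <= Num.max a b.

Lemma betweenP a b t : between a b t -> (a <= t <= b) \/ (b <= t <= a).
Proof.
rewrite /between; have /orP[ab|ab] := le_total a b.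
  by rewrite min_l// max_r//; left.
by rewrite min_r// max_l//; right.
Qed.

Lemma between_le a b t : a <= t <= b -> between a b t.
Proof. by move=> /andP[h1 h2]; rewrite /between ge_min le_max h1 h2 orbT. Qed.

Lemma between_ge a b t : b <= t <= a -> between a b t.
Proof. by move=> /andP[h1 h2]; rewrite /between ge_min le_max h1 h2 orbT. Qed.

Lemma between_dist a b t t' : between a b t -> between a b t' -> `|t - t'| <= `|b - a|.
Proof.
move=> h h'; rewrite !ler_norml; have := ler_norm (b - a); have := ler_norm (a - b).
rewrite (distrC a) => h1 h2.
by move: (betweenP h) (betweenP h') => [/andP[? ?]|/andP[? ?]] [/andP[? ?]|/andP[? ?]];
  apply/andP; split; lra.
Qed.

Lemma cder_between_bound U (u : R -> C) x y (M : R) :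
  (forall t, between x y t -> cder U t (u t)) ->
  (forall t, between x y t -> cmod (u t) <= M) ->
  cmod (U y - U x) <= M * `|y - x|.
Proof. by move=> h1 h2; apply: cder_bound => t ht; split; [exact: h1|exact: h2]. Qed.

Section contour.
Variables (h : C -> C) (ch : continuous h).

Definition primx y x := prim (fun t => h (pt t y)) x.
Definition primy x y := prim (fun t => h (pt x t)) y.

Lemma primx_cder y t : cder (primx y) t (h (pt t y)).
Proof.
apply: (@prim_cder R (fun t => h (pt t y))) => s.
apply: (@continuous_comp _ _ _ (pt^~ y) h); last exact: ch.
exact: cder_continuous (cder_ptl y s).
Qed.

Lemma primy_cder x t : cder (primy x) t (h (pt x t)).
Proof.
apply: (@prim_cder R (fun t => h (pt x t))) => s.
apply: (@continuous_comp _ _ _ (pt x) h); last exact: ch.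
exact: cder_continuous (cder_ptr x s).
Qed.

(** The integral of [h] along the boundary of the rectangle, written with primitives along the four
    sides, so that subdivisions of the rectangle become ring identities. *)
Definition rect x1 x2 y1 y2 : C :=
  (primx y1 x2 - primx y1 x1) + 'i%C * (primy x2 y2 - primy x2 y1)
  - (primx y2 x2 - primx y2 x1) - 'i%C * (primy x1 y2 - primy x1 y1).

(** The integrals of [q'] over the four sides telescope through its primitive [q], so only [h - q']
    contributes, times the perimeter. *)
Lemma rect_bound q q' (M : R) x1 x2 y1 y2 :
  (forall w, cdif q w (q' w)) ->
  (forall x y, between x1 x2 x -> between y1 y2 y ->
     cmod (h (pt x y) - q' (pt x y)) <= M) ->
  cmod (rect x1 x2 y1 y2) <= M * (2 * (`|x2 - x1| + `|y2 - y1|)).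
Proof.
move=> dq hM.
pose V y x := primx y x - q (pt x y).
pose W x y := 'i%C * primy x y - q (pt x y).
have rE : rect x1 x2 y1 y2 = (V y1 x2 - V y1 x1) + (W x2 y2 - W x2 y1)
    - (V y2 x2 - V y2 x1) - (W x1 y2 - W x1 y1).
  rewrite /rect /V /W; move: (primx y1 x1) (primx y1 x2) (primx y2 x1) (primx y2 x2)
    (primy x1 y1) (primy x1 y2) (primy x2 y1) (primy x2 y2) => *; ring.
have yl : between y1 y2 y1 by rewrite /between ge_min le_max lexx.
have yr : between y1 y2 y2 by rewrite /between ge_min le_max lexx !orbT.
have xl : between x1 x2 x1 by rewrite /between ge_min le_max lexx.
have xr : between x1 x2 x2 by rewrite /between ge_min le_max lexx !orbT.
have bV y : between y1 y2 y -> cmod (V y x2 - V y x1) <= M * `|x2 - x1|.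
  move=> hy; apply: (@cder_between_bound _ (fun t => h (pt t y) - q' (pt t y))) => t ht.
    apply: cderB; first exact: primx_cder.
    by rewrite -[q' _]mulr1; apply: cder_comp (dq _); exact: cder_ptl.
  exact: hM.
have bW x : between x1 x2 x -> cmod (W x y2 - W x y1) <= M * `|y2 - y1|.
  move=> hx; apply: (@cder_between_bound _
      (fun t => 'i%C * h (pt x t) - q' (pt x t) * 'i%C)) => t ht.
    apply: cderB; first by apply: cderZ; exact: primy_cder.
    by apply: cder_comp (dq _); exact: cder_ptr.
  by rewrite mulrC -mulrBl cmodM cmodi mulr1; exact: hM.
rewrite rE; apply: le_trans (cmod_subD _ _) _.
apply: le_trans (lerD (le_trans (cmod_subD _ _) (lerD (cmodD _ _) (lexx _))) (lexx _)) _.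
have := bV _ yl; have := bV _ yr; have := bW _ xl; have := bW _ xr.
lra.
Qed.

Lemma rect_bound0 (M : R) x1 x2 y1 y2 :
  (forall x y, between x1 x2 x -> between y1 y2 y -> cmod (h (pt x y)) <= M) ->
  cmod (rect x1 x2 y1 y2) <= M * (2 * (`|x2 - x1| + `|y2 - y1|)).
Proof.
move=> hM; apply: (@rect_bound (fun=> 0) (fun=> 0)).
  move=> w; exists (fun=> 0); split; [|exact: cst_continuous|by []].
  by move=> s; rewrite subrr mul0r.
by move=> x y hx hy; rewrite subr0; exact: hM.
Qed.

Lemma rect_splitx x1 x2 x3 y1 y2 :
  rect x1 x3 y1 y2 = rect x1 x2 y1 y2 + rect x2 x3 y1 y2.
Proof.
rewrite /rect; move: (primx y1 x1) (primx y1 x2) (primx y1 x3) (primx y2 x1)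
  (primx y2 x2) (primx y2 x3) (primy x1 y2 - primy x1 y1)
  (primy x2 y2 - primy x2 y1) (primy x3 y2 - primy x3 y1) => *; ring.
Qed.

Lemma rect_splity x1 x2 y1 y2 y3 :
  rect x1 x2 y1 y3 = rect x1 x2 y1 y2 + rect x1 x2 y2 y3.
Proof.
rewrite /rect; move: (primy x1 y1) (primy x1 y2) (primy x1 y3) (primy x2 y1)
  (primy x2 y2) (primy x2 y3) (primx y1 x2 - primx y1 x1)
  (primx y2 x2 - primx y2 x1) (primx y3 x2 - primx y3 x1) => *; ring.
Qed.

Lemma rect_split4 x1 x2 x3 y1 y2 y3 : rect x1 x3 y1 y3 =
  rect x1 x2 y1 y2 + rect x2 x3 y1 y2 + rect x1 x2 y2 y3 + rect x2 x3 y2 y3.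
Proof.
rewrite (rect_splitx x1 x2 x3) (rect_splity x1 x2 y1 y2 y3).
rewrite (rect_splity x2 x3 y1 y2 y3); move: (rect x1 x2 y1 y2) (rect x1 x2 y2 y3)
  (rect x2 x3 y1 y2) (rect x2 x3 y2 y3) => *; ring.
Qed.

Lemma four_max (r r1 r2 r3 r4 : C) : r = r1 + r2 + r3 + r4 ->
  [\/ cmod r <= 4 * cmod r1, cmod r <= 4 * cmod r2, cmod r <= 4 * cmod r3 |
      cmod r <= 4 * cmod r4].
Proof.
move=> ->; have : cmod (r1 + r2 + r3 + r4) <= cmod r1 + cmod r2 + cmod r3 + cmod r4.
  apply: le_trans (cmodD _ _) _; rewrite lerD2r.
  by apply: le_trans (cmodD _ _) _; rewrite lerD2r cmodD.
move: (cmod r1) (cmod r2) (cmod r3) (cmod r4) (cmod (_ + r4)) => a1 a2 a3 a4 a le4.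
have [c1|c1] := leP a (4 * a1); first exact: Or41.
have [c2|c2] := leP a (4 * a2); first exact: Or42.
have [c3|c3] := leP a (4 * a3); first exact: Or43.
by apply: Or44; lra.
Qed.

Lemma nested_point (t : nat -> R) :
  (forall n, t n <= t n.+1 /\ t n.+1 + 2^-1 ^+ n.+1 <= t n + 2^-1 ^+ n) ->
  exists t0, forall n, t n <= t0 <= t n + 2^-1 ^+ n.
Proof.
move=> ht; have p n : 0 < 2^-1 ^+ n :> R by rewrite exprn_gt0// invr_gt0.
have mono m n : (m <= n)%N -> t m <= t n /\ t n + 2^-1 ^+ n <= t m + 2^-1 ^+ m.
  elim: n => [|n IH]; first by rewrite leqn0 => /eqP ->.
  rewrite leq_eqVlt => /predU1P[->//|]; rewrite ltnS => /IH[h1 h2].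
  have [h3 h4] := ht n; split; lra.
have ub m n : t m <= t n + 2^-1 ^+ n.
  by have [/mono[]|/ltnW/mono[]] := leqP m n; have := p m; have := p n; lra.
have hs : has_sup (range t).
  split; first by exists (t 0%N); exists 0%N.
  by exists (t 0%N + 2^-1 ^+ 0) => _ [n _ <-].
exists (sup (range t)) => n; apply/andP; split.
  by apply: ub_le_sup; [exact: hs.2|exists n].
by apply: ge_sup; [exact: hs.1|move=> _ [m _ <-]; exact: ub].
Qed.

Lemma goursat x1 x2 y1 y2 :
  (forall x y, between x1 x2 x -> between y1 y2 y -> exists l, cdif h (pt x y) l) ->
  rect x1 x2 y1 y2 = 0.
Proof.
move=> dh; pose a := x2 - x1; pose b := y2 - y1.
(* The bisection takes place in the parameter square, which treats reversed and degenerate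
   rectangles like the others. *)
pose X t := x1 + a * t; pose Y t := y1 + b * t.
pose e n : R := 2^-1 ^+ n.
have eS n : e n = e n.+1 + e n.+1 by rewrite /e exprS; lra.
have e_gt0 n : 0 < e n by rewrite exprn_gt0// invr_gt0.
pose rho n t u := rect (X t) (X (t + e n)) (Y u) (Y (u + e n)).
have step n (tu : R * R) : exists tu' : R * R,
    [/\ tu'.1 = tu.1 \/ tu'.1 = tu.1 + e n.+1, tu'.2 = tu.2 \/ tu'.2 = tu.2 + e n.+1 &
    cmod (rho n tu.1 tu.2) <= 4 * cmod (rho n.+1 tu'.1 tu'.2)].
  case: tu => t u /=; set s := e n.+1.
  have : rho n t u = rho n.+1 t u + rho n.+1 (t + s) u
      + rho n.+1 t (u + s) + rho n.+1 (t + s) (u + s).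
    have ht : t + e n = t + s + s by rewrite (eS n) addrA.
    have hu : u + e n = u + s + s by rewrite (eS n) addrA.
    rewrite /rho ht hu; move: rect_split4; move: rect => r; exact.
  move=> /four_max[c|c|c|c].
  - by exists (t, u); split; [left|left|exact: c].
  - by exists (t + s, u); split; [right|left|exact: c].
  - by exists (t, u + s); split; [left|right|exact: c].
  - by exists (t + s, u + s); split; [right|right|exact: c].
have /(_ _)/cid-/all_sig[F hF] := fun p : nat * (R * R) => step p.1 p.2.
pose tu := fix tu n := if n is m.+1 then F (m, tu m) else (0, 0).
have tuP n : [/\ (tu n.+1).1 = (tu n).1 \/ (tu n.+1).1 = (tu n).1 + e n.+1,
    (tu n.+1).2 = (tu n).2 \/ (tu n.+1).2 = (tu n).2 + e n.+1 &
    cmod (rho n (tu n).1 (tu n).2) <= 4 * cmod (rho n.+1 (tu n.+1).1 (tu n.+1).2)].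
  exact: (hF (n, tu n)).
have [t0 ht0] : exists t0, forall n, (tu n).1 <= t0 <= (tu n).1 + e n.
  apply: nested_point => n; rewrite -!/(e _) (eS n); have := e_gt0 n.+1.
  by have [[->|->] _ _] := tuP n => ?; split; lra.
have [u0 hu0] : exists u0, forall n, (tu n).2 <= u0 <= (tu n).2 + e n.
  apply: nested_point => n; rewrite -!/(e _) (eS n); have := e_gt0 n.+1.
  by have [_ [->|->] _] := tuP n => ?; split; lra.
have rho4 n : cmod (rho 0%N 0 0) <= 4 ^+ n * cmod (rho n (tu n).1 (tu n).2).
  elim: n => [|n IH]; first by rewrite mul1r.
  have [_ _ h4] := tuP n; apply: le_trans IH _.
  by rewrite exprSr -mulrA ler_wpM2l// exprn_ge0.
have btw (x a' t s t' : R) : t <= t' <= t + s -> between (x + a' * t) (x + a' * (t + s)) (x + a' * t').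
  move=> /andP[h1 h2]; have [a0|a0] := leP 0 a'.
    by apply: between_le; rewrite !lerD2l !ler_wpM2l.
  by apply: between_ge; rewrite !lerD2l !ler_wnM2l// ltW.
have X0 : X 0 = x1 by rewrite /X mulr0 addr0.
have X1 : X 1 = x2 by rewrite /X mulr1 addrC subrK.
have Y0 : Y 0 = y1 by rewrite /Y mulr0 addr0.
have Y1 : Y 1 = y2 by rewrite /Y mulr1 addrC subrK.
have [l dl] : exists l, cdif h (pt (X t0) (Y u0)) l.
  apply: dh.
    by rewrite -X0 -X1 -[1]add0r; apply: btw; exact: (ht0 0%N).
  by rewrite -Y0 -Y1 -[1]add0r; apply: btw; exact: (hu0 0%N).
set p := pt (X t0) (Y u0) in dl.
suff : rho 0%N 0 0 = 0 by rewrite /rho add0r /e expr0 X0 X1 Y0 Y1.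
apply: eq0_small => eps eps0.
pose D := `|a| + `|b|; have D0 : 0 <= D by rewrite addr_ge0.
(* The estimate ends with [eta * (2 * D ^+ 2)]; the added 1 avoids a zero denominator for a
   degenerate rectangle. *)
have eta0 : 0 < eps / (2 * D ^+ 2 + 1).
  by rewrite divr_gt0// ltr_wpDl// mulr_ge0// sqr_ge0.
have [d d0 hd] := cdif_small dl eta0; set eta := eps / _ in eta0 hd.
have [n hn] : exists n, D * e n < d.
  have : (fun n => D * e n) @ \oo --> D * 0.
    by apply: cvgMl_tmp; apply: cvg_expr; rewrite ger0_norm// invf_lt1// ltr1n.
  rewrite mulr0 => /cvgrPdist_lt/(_ _ d0)[n _ /(_ n (leqnn n))].
  by rewrite /= sub0r normrN ger0_norm ?mulr_ge0// ?(ltW (e_gt0 _))//; exists n.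
apply: le_trans (rho4 n) _.
(* [q] is a primitive of the first-order expansion [q'] of [h] at [p]. On the [n]-th rectangle
   [h - q'] is at most [eta * (D * e n)] and the perimeter is of order [e n]; their product
   compensates the factor [4 ^+ n] of the bisection. *)
pose q w := h p * w + l * (w - p) ^+ 2 / 2.
pose q' w := h p + l * (w - p).
have dq w : cdif q w (q' w).
  have dwp : cdif (fun w => w - p) w 1.
    by rewrite -[1]subr0; apply: cdifB; [exact: cdif_id|exact: cdif_cst].
  have -> : q' w = h p * 1 + l / 2 * (1 * (w - p) + (w - p) * 1).
    by rewrite /q'; field.
  rewrite (_ : q = fun w => h p * w + l / 2 * ((w - p) * (w - p))); last first.
    by apply/funext => w'; rewrite /q; field.
  by apply: cdifD; apply: cdifZ; [exact: cdif_id|exact: cdifM].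
have en0 := e_gt0 n.
have hrho : cmod (rho n (tu n).1 (tu n).2) <= eta * (D * e n) * (2 * (`|a| * e n + `|b| * e n)).
  have XX : X ((tu n).1 + e n) - X (tu n).1 = a * e n by rewrite /X; ring.
  have YY : Y ((tu n).2 + e n) - Y (tu n).2 = b * e n by rewrite /Y; ring.
  have ha : `|a| * e n = `|X ((tu n).1 + e n) - X (tu n).1| by rewrite XX normrM (gtr0_norm en0).
  have hb : `|b| * e n = `|Y ((tu n).2 + e n) - Y (tu n).2| by rewrite YY normrM (gtr0_norm en0).
  rewrite ha hb; apply: (rect_bound dq) => x y hx hy.
  have wp : cmod (pt x y - p) <= D * e n.
    rewrite ptB; apply: le_trans (cmod_le_ReIm _) _ => /=.
    rewrite /D mulrDl ha hb; apply: lerD.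
      by apply: between_dist => //; apply: btw.
    by apply: between_dist => //; apply: btw.
  rewrite /q' opprD addrA; apply: le_trans (hd _ (le_lt_trans wp hn)) _.
  by rewrite ler_wpM2l// ltW.
apply: le_trans (ler_wpM2l _ hrho) _; first exact: exprn_ge0.
have -> : 4 ^+ n * (eta * (D * e n) * (2 * (`|a| * e n + `|b| * e n))) =
    (4 ^+ n * e n ^+ 2) * (eta * (2 * D ^+ 2)) by rewrite /D; ring.
have -> : 4 ^+ n * e n ^+ 2 = 1 :> R.
  by rewrite /e -exprM mulnC exprM -exprMn (_ : 4 * 2^-1 ^+ 2 = 1) ?expr1n//; field.
rewrite mul1r /eta -mulrA ler_piMr ?(ltW eps0)// mulrC ler_pdivrMr ?mul1r.
  by rewrite lerDl.
by rewrite ltr_wpDl// mulr_ge0// sqr_ge0.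
Qed.

End contour.
End goursat.

Section goursat_exceptional.
Variable R : realType.
Local Notation C := R[i].
Variables (h : C -> C) (ch : continuous h) (s : C).
Hypothesis dh : forall w, w != s -> exists l, cdif h w l.

Lemma between_corner (p d e : R) t : d != 0 -> 0 < e -> e <= 1 ->
  between (p + e * d) (p + d) t -> t != p.
Proof.
move=> d0 e0 e1 /betweenP ht; apply/eqP => tp; move: ht; rewrite tp.
have : 0 < e * d \/ e * d < 0.
  by case: (ltrgtP d 0) d0 => // dd _; [right; rewrite nmulr_llt0|left; rewrite mulr_gt0].
by move=> []? []/andP[]; rewrite ?gerDl ?lerDl => *; nra.
Qed.

(* At the exceptional point s the function is merely continuous: a rectangle with
   a corner at s is cut down to an arbitrarily small one. *)
Lemma goursat_corner x y : rect h (complex.Re s) x (complex.Im s) y = 0.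
Proof.
set p := complex.Re s; set q := complex.Im s.
have sE : s = pt p q by rewrite ptK.
have [->|xp] := eqVneq x p.
  by rewrite /rect !subrr add0r subr0 subrr.
have [->|yq] := eqVneq y q.
  by rewrite /rect !subrr mulr0 addr0 subrr subr0.
have dx0 : x - p != 0 by rewrite subr_eq0.
have dy0 : y - q != 0 by rewrite subr_eq0.
have neq a b : (a != p) || (b != q) -> pt a b != s.
  by rewrite sE; apply: contraTneq => -[-> ->]; rewrite !eqxx.
have [d d0 hd] : exists2 d : R, 0 < d & forall w : C, cmod (w - s) < d -> cmod (h w - h s) < 1.
  exact: (@continuous_small _ h s (@ch s) 1 ltr01).
pose D := `|x - p| + `|y - q|; have D0 : 0 <= D by rewrite addr_ge0.
pose M := cmod (h s) + 1.
have M0 : 0 <= M by rewrite addr_ge0// cmod_ge0.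
have small e : 0 < e -> e <= 1 -> e * D < d ->
    cmod (rect h p x q y) <= e * (M * (2 * D)).
  move=> e0 e1 eD; pose x' := p + e * (x - p); pose y' := q + e * (y - q).
  have -> : rect h p x q y = rect h p x' q y'.
    rewrite (rect_split4 _ p x' x q y' y).
    rewrite [X in _ + X + _ + _](_ : _ = 0) ?[X in _ + X + _](_ : _ = 0)
      ?[X in _ + X](_ : _ = 0) ?addr0//.
    - apply: goursat => // a b ha hb; apply: dh; apply: neq.
      have -> : a != p by apply: (between_corner dx0 e0 e1); rewrite [p + (x - p)]addrC subrK.
      by [].
    - apply: goursat => // a b ha hb; apply: dh; apply: neq; apply/orP; right.
      by apply: (between_corner dy0 e0 e1); rewrite [q + (y - q)]addrC subrK.
    - apply: goursat => // a b ha hb; apply: dh; apply: neq.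
      have -> : a != p by apply: (between_corner dx0 e0 e1); rewrite [p + (x - p)]addrC subrK.
      by [].
  have -> : e * (M * (2 * D)) = M * (2 * (`|x' - p| + `|y' - q|)).
    rewrite /x' /y' ![_ + _ * _]addrC !addrK !normrM (gtr0_norm e0) /D; ring.
  apply: rect_bound0 => // a b ha hb.
  rewrite /M -lerBlDl; apply: le_trans (ler_cmodB _ _) _; apply/ltW/hd.
  rewrite sE ptB; apply: le_lt_trans (cmod_le_ReIm _) _ => /=.
  apply: le_lt_trans eD; rewrite /D mulrDr; apply: lerD.
    have -> : e * `|x - p| = `|x' - p|.
      by rewrite /x' [p + _]addrC addrK normrM (gtr0_norm e0).
    by apply: between_dist => //; rewrite /between ge_min le_max lexx.
  have -> : e * `|y - q| = `|y' - q|.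
    by rewrite /y' [q + _]addrC addrK normrM (gtr0_norm e0).
  by apply: between_dist => //; rewrite /between ge_min le_max lexx.
apply: eq0_small => eps eps0.
pose e := Num.min 1 (Num.min (d / (D + 1)) (eps / (M * (2 * D) + 1))).
have MD0 : 0 <= M * (2 * D) by rewrite !mulr_ge0.
have e0 : 0 < e by rewrite !lt_min ltr01 !divr_gt0// ltr_wpDl.
have e1 : e <= 1 by rewrite ge_min lexx.
have ed : e <= d / (D + 1) by rewrite !ge_min lexx orbT.
have ee : e <= eps / (M * (2 * D) + 1) by rewrite !ge_min lexx !orbT.
apply: le_trans (small e e0 e1 _) _.
  by move: ed; rewrite ler_pdivlMr ?ltr_wpDl// mulrDr mulr1 => ?; lra.
by move: ee; rewrite ler_pdivlMr ?ltr_wpDl// mulrDr mulr1 => ?; lra.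
Qed.

(** Every rectangle is a signed sum of four rectangles with a corner at [s]. *)
Lemma goursat_exceptional x1 x2 y1 y2 : rect h x1 x2 y1 y2 = 0.
Proof.
pose F x y := rect h (complex.Re s) x (complex.Im s) y.
have -> : rect h x1 x2 y1 y2 = F x2 y2 - F x1 y2 - F x2 y1 + F x1 y1.
  rewrite /F (rect_splitx h (complex.Re s) x1 x2).
  rewrite (rect_splitx h (complex.Re s) x1 x2 _ y1).
  rewrite (rect_splity h x1 x2 (complex.Im s) y1 y2).
  move: (rect h x1 x2 y1 y2) (rect h x1 x2 _ y1) (rect h _ x1 _ y1) (rect h _ x1 _ y2).
  by move=> *; ring.
by rewrite /F !goursat_corner !subrr add0r.
Qed.

(** The integral of [h] from 0 to [w] along a horizontal segment followed by a vertical one. *)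
Definition antider (w : C) : C := (primx h 0 (complex.Re w) - primx h 0 0) +
  'i%C * (primy h (complex.Re w) (complex.Im w) - primy h (complex.Re w) 0).

Lemma antider_cdif w : cdif antider w (h w).
Proof.
apply: small_cdif => e e0; have e20 : 0 < e / 2 by lra.
have [d d0 hd] : exists2 d : R, 0 < d & forall w' : C, cmod (w' - w) < d -> cmod (h w' - h w) < e / 2.
  exact: (@continuous_small _ h w (@ch w) _ e20).
exists d => // w' ww'.
rewrite -(ptK w) -(ptK w') in ww' hd *.
move: ww' hd; set x := complex.Re w; set y := complex.Im w.
set x' := complex.Re w'; set y' := complex.Im w' => ww' hd.
set l := h (pt x y) in hd *.
have xx' : `|x' - x| <= cmod (pt x' y' - pt x y) by rewrite ptB; exact: (Re_le_cmod (pt _ _)).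
have yy' : `|y' - y| <= cmod (pt x' y' - pt x y) by rewrite ptB; exact: (Im_le_cmod (pt _ _)).
pose V t := primx h y t - l * ofR t.
pose W t := 'i%C * primy h x' t - l * 'i%C * ofR t.
have -> : antider (pt x' y') - antider (pt x y) - l * (pt x' y' - pt x y)
   = (V x' - V x) + (W y' - W y).
  (* The vanishing integral over this rectangle moves the horizontal path from height 0 to height
     [y], so that the increment of [antider] only involves values of [h] near [w]. *)
  have := goursat_exceptional x x' 0 y; rewrite /rect /antider /= => e1.
  have := congr1 (fun u => u + (primx h y x' - primx h y x)) e1.
  rewrite /V /W !ptE -/x -/y -/x' -/y'; move: (primx h 0 x') (primx h 0 x) (primx h 0 0)
    (primy h x' 0) (primy h x' y) (primy h x' y') (primy h x 0) (primy h x y)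
    (primx h y x') (primx h y x) => a1 a2 a3 a4 a5 a6 a7 a8 a9 a10 H.
  have -> : a9 - l * ofR x' - (a10 - l * ofR x) = (0 + (a9 - a10)) - l * ofR x' + l * ofR x by ring.
  by rewrite -H; ring.
have bV : cmod (V x' - V x) <= e / 2 * `|x' - x|.
  apply: (@cder_between_bound _ _ (fun t => h (pt t y) - l * 1)) => t ht.
    apply: cderB; first exact: primx_cder.
    by apply: cderZ; exact: cder_ofR.
  rewrite mulr1; apply/ltW/hd; apply: le_lt_trans ww'; apply: le_trans _ xx'.
  rewrite ptB subrr; apply: le_trans (cmod_le_ReIm _) _ => /=; rewrite normr0 addr0.
  by apply: between_dist => //; rewrite /between ge_min le_max lexx.
have bW : cmod (W y' - W y) <= e / 2 * `|y' - y|.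
  apply: (@cder_between_bound _ _ (fun t => 'i%C * h (pt x' t) - l * 'i%C * 1)) => t ht.
    apply: cderB; first by apply: cderZ; exact: primy_cder.
    by apply: cderZ; exact: cder_ofR.
  rewrite mulr1 mulrC -mulrBl cmodM cmodi mulr1; apply/ltW/hd; apply: le_lt_trans ww'.
  rewrite !ptB /cmod /= ler_wsqrtr// lerD2l -[_ ^+ 2]real_normK ?num_real//.
  rewrite -[leRHS]real_normK ?num_real// lerXn2r ?nnegrE//.
  by apply: between_dist => //; rewrite /between ge_min le_max lexx.
apply: le_trans (cmodD _ _) _; apply: le_trans (lerD bV bW) _.
by rewrite [e in leRHS]splitr mulrDl; apply: lerD; rewrite ler_wpM2l// ltW.
Qed.

End goursat_exceptional.

(** * The Cauchy formula and Taylor expansions *)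

Section cauchy.
Variable R : realType.
Local Notation C := R[i].
Implicit Types (u v : R -> C) (g : C -> C) (t M : R) (k n : nat).

Lemma contM u v : continuous u -> continuous v -> continuous (fun t => u t * v t).
Proof. by move=> cu cv t; apply: continuousM; [exact: cu|exact: cv]. Qed.

Lemma contZ (c : C) u : continuous u -> continuous (fun t => c * u t).
Proof. by move=> cu; apply: contM; [move=> t; exact: cst_continuous|exact: cu]. Qed.

Lemma contD u v : continuous u -> continuous v -> continuous (fun t => u t + v t).
Proof. by move=> cu cv t; apply: (@continuousD _ R[i]); [exact: cu|exact: cv]. Qed.

Lemma contB u v : continuous u -> continuous v -> continuous (fun t => u t - v t).
Proof. by move=> cu cv t; apply: (@continuousB _ R[i]); [exact: cu|exact: cv]. Qed.

(* With the parametrization [circ] of the unit circle by [0, 1], the contour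
   integral of g(z) dz / (2 i pi z) is [mean (g \o circ)]. *)
Definition mean u : C := prim u 1 - prim u 0.

Lemma mean_eq u U : continuous u -> (forall t, cder U t (u t)) -> mean u = U 1 - U 0.
Proof.
move=> cu dU; apply/eqP; rewrite -subr_eq0; apply/eqP/eq0_small => e e0.
rewrite /mean [X in cmod X](_ : _ = (prim u 1 - U 1) - (prim u 0 - U 0)); last first.
  by move: (prim u 1) (prim u 0) (U 1) (U 0) => *; ring.
apply: le_trans (ltW e0); rewrite -[leRHS](mul0r `|1 - 0|).
apply: (@cder_between_bound _ (fun t => prim u t - U t) (fun t => u t - u t)) => t _.
  by apply: cderB; [exact: prim_cder|exact: dU].
by rewrite subrr cmod0.
Qed.

Lemma meanD u v : continuous u -> continuous v ->
  mean (fun t => u t + v t) = mean u + mean v.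
Proof.
move=> cu cv; rewrite (@mean_eq _ (fun t => prim u t + prim v t)).
- rewrite /mean; move: (prim u 1) (prim u 0) (prim v 1) (prim v 0) => *; ring.
- exact: contD.
- by move=> t; apply: cderD; exact: prim_cder.
Qed.

Lemma meanZ (c : C) u : continuous u -> mean (fun t => c * u t) = c * mean u.
Proof.
move=> cu; rewrite (@mean_eq _ (fun t => c * prim u t)).
- by rewrite /mean -mulrBr.
- exact: contZ.
- by move=> t; apply: cderZ; exact: prim_cder.
Qed.

Lemma meanB u v : continuous u -> continuous v ->
  mean (fun t => u t - v t) = mean u - mean v.
Proof.
move=> cu cv; rewrite (@mean_eq _ (fun t => prim u t - prim v t)).
- rewrite /mean; move: (prim u 1) (prim u 0) (prim v 1) (prim v 0) => *; ring.
- exact: contB.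
- by move=> t; apply: cderB; exact: prim_cder.
Qed.

Lemma mean_cst (c : C) : mean (fun=> c) = c.
Proof.
rewrite (@mean_eq _ (fun t => c * ofR t)).
- by rewrite ofR1 ofR0 mulr1 mulr0 subr0.
- by move=> t; exact: cst_continuous.
- by move=> t; rewrite -[X in cder _ _ X](mulr1 c); apply: cderZ; exact: cder_ofR.
Qed.

Lemma mean_bound u M : continuous u -> (forall t, cmod (u t) <= M) -> cmod (mean u) <= M.
Proof.
move=> cu hM; rewrite -[M]mulr1 -[1]normr1 -[X in `|X|]subr0.
by apply: (@cder_between_bound _ _ u) => t _; [exact: prim_cder|exact: hM].
Qed.

Definition circ t : C := pt (cos (2 * pi * t)) (sin (2 * pi * t)).
Definition twopii : C := 'i%C * ofR (2 * pi).

Lemma circ_cder t : cder circ t (twopii * circ t).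
Proof.
have h1 : is_derive t (1 : R) (fun s : R => 2 * pi * s : R) (2 * pi : R).
  apply/is_derive1_caratheodory; exists (fun=> 2 * pi).
  by split; [move=> z; ring|exact: cst_continuous|].
apply: cder_ReIm.
  rewrite (_ : complex.Re (twopii * circ t) = - sin (2 * pi * t) * (2 * pi)); last first.
    by rewrite /twopii /circ /pt /=; ring.
  exact: is_derive1_comp.
rewrite (_ : complex.Im (twopii * circ t) = cos (2 * pi * t) * (2 * pi)); last first.
  by rewrite /twopii /circ /pt /=; ring.
exact: is_derive1_comp.
Qed.

Lemma circ_continuous : continuous circ.
Proof. by move=> t; exact: cder_continuous (circ_cder t). Qed.

Lemma cmod_circ t : cmod (circ t) = 1.
Proof. by rewrite /cmod /circ/= cos2Dsin2 sqrtr1. Qed.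

Lemma circ_neq0 t : circ t != 0.
Proof. by rewrite -cmod_eq0 cmod_circ oner_eq0. Qed.

Lemma circ0 : circ 0 = 1.
Proof. by rewrite /circ mulr0 cos0 sin0. Qed.

Lemma circ1 : circ 1 = 1.
Proof. by rewrite /circ mulr1 mulrC mulr_natr cos2pi sin2pi. Qed.

Lemma twopii_neq0 : twopii != 0.
Proof.
rewrite -cmod_eq0 cmodM cmodi mul1r cmod_ofR normr_eq0.
by rewrite mulf_neq0// gt_eqF// pi_gt0.
Qed.

Definition circV k t : C := (circ t)^-1 ^+ k.

Lemma circV_continuous k : continuous (circV k).
Proof.
elim: k => [|k IH].
  have -> : circV 0 = fun=> 1 by apply/funext => s; rewrite /circV expr0.
  by move=> t; exact: cst_continuous.
have -> : circV k.+1 = (fun t => (circ t)^-1) \* circV k.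
  by apply/funext => s; rewrite /circV exprS.
move=> t; apply: continuousM; last exact: IH.
by apply: continuousV; [exact: circ_neq0|exact: circ_continuous].
Qed.

Lemma cmod_circV k t : cmod (circV k t) = 1.
Proof. by rewrite /circV cmodX cmodV cmod_circ invr1 expr1n. Qed.

Lemma cdif_powV (p : C) k : p != 0 ->
  cdif (fun w => w^-1 ^+ k) p (- k%:R * p^-1 ^+ k.+1).
Proof.
move=> p0; have dV : cdif (fun w => w^-1) p (- p^-1 ^+ 2).
  have -> : - p^-1 ^+ 2 = - 1 / p ^+ 2 by rewrite exprVn mulN1r.
  by apply: (@cdifV _ id) => //; exact: cdif_id.
elim: k => [|k IH].
  rewrite oppr0 mul0r (_ : (fun _ => _) = fun=> 1); first exact: cdif_cst.
  by apply/funext.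
rewrite (_ : (fun _ => _) = fun w => w^-1 * w^-1 ^+ k); last first.
  by apply/funext => s; rewrite exprS.
have -> : - k.+1%:R * p^-1 ^+ k.+2 =
    (- p^-1 ^+ 2) * p^-1 ^+ k + p^-1 * (- k%:R * p^-1 ^+ k.+1).
  by rewrite !exprS expr0 -natr1; ring.
exact: cdifM.
Qed.

Lemma circV_cder k t : cder (circV k) t (- (k%:R * twopii) * circV k t).
Proof.
have -> : - (k%:R * twopii) * circV k t =
    - k%:R * (circ t)^-1 ^+ k.+1 * (twopii * circ t).
  by rewrite /circV exprS; field; exact: circ_neq0.
exact: cder_comp (circ_cder t) (cdif_powV _ (circ_neq0 t)).
Qed.

Lemma mean_circV k : mean (circV k.+1) = 0.
Proof.
pose c : C := - (k.+1%:R * twopii).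
have c0 : c != 0 by rewrite oppr_eq0 mulf_neq0 ?twopii_neq0// pnatr_eq0.
apply: (mulfI c0); rewrite mulr0 -meanZ; last exact: circV_continuous.
rewrite (@mean_eq _ (circV k.+1)).
- by rewrite /circV circ0 circ1 subrr.
- by apply: contZ; exact: circV_continuous.
- exact: circV_cder.
Qed.

(** The [k]-th Taylor coefficient of [g] at 0 when [g] is holomorphic. The unit circle suffices,
    other radii being reached by rescaling the argument of [g]. *)
Definition cauchy_coef g k : C := mean (fun t => g (circ t) * circV k t).

Definition holo g := forall p, exists l, cdif g p l.

Lemma holo_circ_continuous g k : holo g -> continuous (fun t => g (circ t) * circV k t).
Proof.
move=> hg t; apply: continuousM; last exact: circV_continuous.
have [l dl] := hg (circ t).
apply: (@continuous_comp _ _ _ circ g); last exact: cdif_continuous dl.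
exact: circ_continuous.
Qed.

(** Integration by parts on the circle: [g z / z ^ (k + 1)] takes the same value at both ends of the
    parametrization, so its derivative has mean 0. *)
Lemma cauchy_coef_deriv g g' k : (forall p, cdif g p (g' p)) -> holo g' ->
  k.+1%:R * cauchy_coef g k.+1 = cauchy_coef g' k.
Proof.
move=> dg hg'; have hg : holo g by move=> p; exists (g' p).
apply/eqP; rewrite -subr_eq0; apply/eqP; apply: (mulfI twopii_neq0); rewrite mulr0.
rewrite /cauchy_coef.
have c1 := @holo_circ_continuous g k.+1 hg; have c2 := @holo_circ_continuous g' k hg'.
have c3 := contB (@contZ k.+1%:R _ c1) c2.
rewrite -(meanZ _ c1) -meanB; [|exact: contZ|exact: c2].
rewrite -meanZ; last exact: c3.
apply: oppr_inj; rewrite oppr0 -[- mean _]mulN1r -meanZ; last exact: contZ.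
rewrite (@mean_eq _ (fun t => g (circ t) * (circ t)^-1 ^+ k.+1)).
- by rewrite circ0 circ1 subrr.
- by apply: contZ; apply: contZ.
- move=> t; pose p := circ t.
  have := cder_comp (circ_cder t) (cdifM (dg p) (cdif_powV k.+1 (circ_neq0 t))).
  congr cder; rewrite /circV -/p !exprS; field; exact: circ_neq0.
Qed.

Section cauchy_formula.
Variables (s : C) (s1 : cmod s < 1).

(** The Cauchy kernel [1 / (z - s)], multiplied by [z] because [mean] integrates against
    [dz / z]. *)
Definition ckern t : C := circ t / (circ t - s).

Lemma circ_sub_neq0 t : circ t - s != 0.
Proof. by rewrite subr_eq0; apply: contraTneq s1 => <-; rewrite cmod_circ ltxx. Qed.

Lemma ckern_continuous : continuous ckern.
Proof.
move=> t; apply: continuousM; first exact: circ_continuous.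
apply: continuousV; first exact: circ_sub_neq0.
by apply: (@continuousB _ R[i]); [exact: circ_continuous|exact: cst_continuous].
Qed.

Lemma cmod_ckern t : cmod (ckern t) <= (1 - cmod s)^-1.
Proof.
rewrite cmodM cmodV cmod_circ mul1r lef_pV2 ?posrE ?cmod_gt0 ?circ_sub_neq0 ?subr_gt0//.
by rewrite -(cmod_circ t) ler_cmodB.
Qed.

(** The finite geometric expansion of the kernel [z / (z - s)] in powers of [s / z]. Stated for any
    continuous [u], it yields both the normalization of the kernel and the Taylor formula. *)
Lemma mean_ckern_expand u n : continuous u ->
  mean (fun t => u t * ckern t) = \sum_(k < n) mean (fun t => u t * circV k t) * s ^+ k
    + s ^+ n * mean (fun t => u t * circV n t * ckern t).
Proof.
move=> cu; elim: n => [|n IH].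
  by rewrite big_ord0 add0r expr0 mul1r; congr mean; apply/funext => t; rewrite /circV expr0 mulr1.
rewrite IH big_ord_recr/= -addrA; congr (_ + _).
have cv k : continuous (fun t => u t * circV k t).
  by apply: contM; [exact: cu|exact: circV_continuous].
have ck k : continuous (fun t => u t * circV k t * ckern t).
  by apply: contM; [exact: cv|exact: ckern_continuous].
rewrite (_ : (fun t => _ * circV n t * _) =
    fun t => u t * circV n t + s * (u t * circV n.+1 t * ckern t)).
  rewrite meanD; [|exact: cv|].
    by rewrite meanZ; [rewrite exprSr; ring|exact: ck].
  by apply: contZ; exact: ck.
apply/funext => t; rewrite /ckern /circV exprS; field.
by rewrite circ_neq0 circ_sub_neq0.
Qed.

Lemma mean_remainder u n M : continuous u -> (forall t, cmod (u t) <= M) ->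
  cmod (s ^+ n * mean (fun t => u t * circV n t * ckern t)) <= M * (cmod s ^+ n / (1 - cmod s)).
Proof.
move=> cu hM; rewrite cmodM cmodX mulrCA ler_wpM2l ?exprn_ge0 ?cmod_ge0//.
apply: mean_bound => [|t].
  apply: contM; last exact: ckern_continuous.
  by apply: contM; [exact: cu|exact: circV_continuous].
rewrite cmodM (cmodM (u t)) cmod_circV mulr1.
by apply: ler_pM; [exact: cmod_ge0|exact: cmod_ge0|exact: hM|exact: cmod_ckern].
Qed.

(** In the expansion for [u = 1] only the term of index 0 survives, by [mean_circV], and the
    remainder tends to 0. *)
Lemma mean_ckern : mean ckern = 1.
Proof.
apply/eqP; rewrite -subr_eq0; apply/eqP/eq0_small => e e0.
have [n hn] : exists n, cmod s ^+ n.+1 / (1 - cmod s) <= e.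
  have : (fun n => cmod s ^+ n) @ \oo --> (0 : R).
    by apply: cvg_expr; rewrite ger0_norm ?cmod_ge0.
  have ed : 0 < e * (1 - cmod s) by rewrite mulr_gt0// subr_gt0.
  move=> /cvgrPdist_lt/(_ _ ed)[n _ /(_ n.+1 (leqnSn n))].
  rewrite /= sub0r normrN ger0_norm ?exprn_ge0 ?cmod_ge0// => /ltW h; exists n.
  by rewrite ler_pdivrMr// subr_gt0.
apply: le_trans hn; rewrite -[leRHS]mul1r.
have c1 : continuous (fun _ : R => 1 : C) by move=> t; exact: cst_continuous.
have m1 (t : R) : cmod (1 : C) <= 1 by rewrite cmod1.
suff -> : mean ckern - 1 = s ^+ n.+1 * mean (fun t => 1 * circV n.+1 t * ckern t).
  exact: (@mean_remainder (fun=> 1) n.+1 1 c1 m1).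
have -> : mean ckern = mean (fun t => 1 * ckern t).
  by congr mean; apply/funext => t; rewrite mul1r.
rewrite (@mean_ckern_expand (fun=> 1) n.+1 c1).
rewrite big_ord_recl big1 => [|i _].
  rewrite expr0 mulr1 addr0 (_ : (fun t => _ * circV _ t) = fun=> 1).
    by rewrite mean_cst addrC addKr.
  by apply/funext => t; rewrite /circV expr0 mulr1.
rewrite (_ : (fun t => _ * circV _ t) = circV i.+1) ?mean_circV ?mul0r//.
by apply/funext => t; rewrite mul1r.
Qed.

(* The difference quotient of g at s, continuous at s and holomorphic elsewhere,
   has a primitive by [antider_cdif]. *)
Lemma cauchy_formula g : holo g -> mean (fun t => g (circ t) * ckern t) = g s.
Proof.
move=> hg; have [l dl] := hg s.
have cg p : {for p, continuous g} by have [m /cdif_continuous] := hg p.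
have [h [hE ch hs]] := dl.
have hE' w : w != s -> h w = (g w - g s) / (w - s).
  by move=> ws; rewrite hE mulfK// subr_eq0.
have dq w : w != s -> exists m, cdif (fun w => (g w - g s) / (w - s)) w m.
  move=> ws; have [m dm] := hg w; have wsn : w - s != 0 by rewrite subr_eq0.
  eexists; apply: cdifM; first by apply: cdifB; [exact: dm|exact: cdif_cst].
  by apply: cdifV => //; apply: cdifB; [exact: cdif_id|exact: cdif_cst].
have dh w : w != s -> exists m, cdif h w m.
  move=> ws; have [m dm] := dq _ ws; exists m; apply: near_cdif dm.
  have wsn : 0 < cmod (w - s) by rewrite cmod_gt0 subr_eq0.
  apply/nbhs_cmodP; exists (cmod (w - s)) => // w'; rewrite cmodB => ww'.
  by rewrite hE'//; apply: contraTneq ww' => ->; rewrite ltxx.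
have chT : continuous h.
  move=> w; have [->|/dh[m /cdif_continuous]] := eqVneq w s; [exact: ch|exact].
have cgc : continuous (fun t => g (circ t)).
  by move=> t; apply: (@continuous_comp _ _ _ circ g); [exact: circ_continuous|exact: cg].
have cgk : continuous (fun t => g (circ t) * ckern t).
  by apply: contM; [exact: cgc|exact: ckern_continuous].
have csk : continuous (fun t => g s * ckern t).
  by apply: contZ; exact: ckern_continuous.
apply/eqP; rewrite -subr_eq0 -[X in _ - X]mulr1 -mean_ckern; apply/eqP.
rewrite -meanZ; last exact: ckern_continuous.
rewrite -meanB//; apply: (mulfI twopii_neq0); rewrite mulr0 -meanZ; last first.
  exact: contB.
rewrite (@mean_eq _ (fun t => antider h (circ t))).
- by rewrite circ0 circ1 subrr.
- by apply: contZ; exact: contB.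
- move=> t; have := cder_comp (circ_cder t) (antider_cdif chT dh (circ t)).
  congr cder; rewrite hE' /ckern; last by rewrite -subr_eq0 circ_sub_neq0.
  by field; rewrite circ_sub_neq0.
Qed.

Theorem taylor_bound g n M : holo g -> (forall t, cmod (g (circ t)) <= M) ->
  cmod (g s - \sum_(k < n) cauchy_coef g k * s ^+ k) <= M * (cmod s ^+ n / (1 - cmod s)).
Proof.
move=> hg hM.
have cgc : continuous (fun t => g (circ t)).
  move=> t; have [m dm] := hg (circ t).
  by apply: (@continuous_comp _ _ _ circ g); [exact: circ_continuous|exact: cdif_continuous dm].
have := mean_remainder n cgc hM; congr (_ <= _); congr cmod.
by rewrite -{1}(cauchy_formula hg) (mean_ckern_expand n cgc) addrC addKr.
Qed.

End cauchy_formula.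

End cauchy.

(** * Entire functions and their topology *)

Section complex_sequences.
Variable R : realType.
Local Notation C := R[i].

Lemma cauchy_complex (a : nat -> C) :
  (forall e, 0 < e -> exists n0, forall n m, (n0 <= n)%N -> (n0 <= m)%N -> cmod (a n - a m) < e) ->
  exists l : C, forall e, 0 < e -> exists n0, forall n, (n0 <= n)%N -> cmod (a n - l) < e.
Proof.
move=> ca.
have realc (b : nat -> R) : (forall n m, `|b n - b m| <= cmod (a n - a m)) -> cvgn b.
  move=> hb; apply/cauchy_cvgP; apply: cauchy_exP => e e0.
  have [n0 h] := ca e e0; exists (b n0); exists n0 => //= n nn0.
  by rewrite /ball /=; apply: le_lt_trans (hb _ _) _; apply: h => /=.
have cr : cvgn (fun n => complex.Re (a n)).
  by apply: realc => n m; rewrite -ReB Re_le_cmod.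
have ci : cvgn (fun n => complex.Im (a n)).
  by apply: realc => n m; rewrite -ImB Im_le_cmod.
exists (pt (limn (fun n => complex.Re (a n))) (limn (fun n => complex.Im (a n)))).
move=> e e0.
have /cmod_cvgP/(_ e e0)[n0 _ h] : a n @[n --> \oo] --> 
    pt (limn (fun n => complex.Re (a n))) (limn (fun n => complex.Im (a n))).
  exact: ReIm_cvg.
by exists n0 => n /h.
Qed.

End complex_sequences.

Section vector_norm.
Variables (R : realType) (N : nat).
Local Notation C := R[i].
Local Notation V := 'cV[C]_N.
Implicit Types (z w h : V) (s : C) (r e : R).

Definition vnorm z : R := complex.Re `|z|.

Lemma vnormE z : `|z| = ofR (vnorm z).
Proof. by rewrite /vnorm /ofR RRe_real// normr_real. Qed.

Lemma vnorm_ge0 z : 0 <= vnorm z.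
Proof. by rewrite -ofR_le ofR0 -vnormE normr_ge0. Qed.
Lemma vnormD z w : vnorm (z + w) <= vnorm z + vnorm w.
Proof. by rewrite -ofR_le ofRD -!vnormE ler_normD. Qed.
Lemma vnormN z : vnorm (- z) = vnorm z.
Proof. by apply: ofR_inj; rewrite -!vnormE normrN. Qed.
Lemma vnormB z w : vnorm (z - w) = vnorm (w - z).
Proof. by rewrite -vnormN opprB. Qed.
Lemma vnormZ s z : vnorm (s *: z) = cmod s * vnorm z.
Proof. by apply: ofR_inj; rewrite ofRM -normE -!vnormE normrZ. Qed.
Lemma vnorm0 : vnorm 0 = 0.
Proof. by apply: ofR_inj; rewrite -vnormE normr0. Qed.
Lemma vnorm_eq0 z : (vnorm z == 0) = (z == 0).
Proof. by rewrite -(inj_eq (@ofR_inj R)) -vnormE ofR0 normr_eq0. Qed.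
Lemma vnorm_gt0 z : (0 < vnorm z) = (z != 0).
Proof. by rewrite lt_def vnorm_eq0 vnorm_ge0 andbT. Qed.

Lemma nbhs_vnormP z (P : set V) :
  nbhs z P <-> exists2 d, 0 < d & forall w, vnorm (w - z) < d -> P w.
Proof.
split=> [/nbhs_ballP[_ /= /gtc0P[d d0 ->]] h|[d d0 h]].
  exists d => // w wz; apply: h.
  by rewrite -ball_normE/= vnormE ofR_lt vnormB.
apply/nbhs_ballP; exists (ofR d) => /=; first by rewrite -ofR0 ofR_lt.
by move=> w; rewrite -ball_normE/= vnormE ofR_lt vnormB => /h.
Qed.

Lemma cmod_vnorm z i : cmod (z i 0) <= vnorm z.
Proof.
apply/ler_addgt0Pr => e e0; apply: ltW.
have : ball (0 : V) (ofR (vnorm z + e)) z.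
  by rewrite -ball_normE /= sub0r normrN vnormE ofR_lt ltrDl.
move=> [_ /(_ i 0)]; rewrite -ball_normE /= mxE sub0r normrN normE ofR_lt.
exact.
Qed.

Lemma vnorm_le z M : 0 <= M -> (forall i, cmod (z i 0) <= M) -> vnorm z <= M.
Proof.
move=> M0 h; apply/ler_addgt0Pr => e e0; apply: ltW.
have : ball (0 : V) (ofR (M + e)) z.
  split; first by rewrite -ofR0 ofR_lt ltr_wpDl.
  move=> i j; rewrite -ball_normE /= mxE sub0r normrN normE ofR_lt ord1.
  by apply: le_lt_trans (h i) _; rewrite ltrDl.
by rewrite -ball_normE /= sub0r normrN vnormE ofR_lt.
Qed.

Lemma vnorm_sum z : vnorm z <= \sum_i cmod (z i 0).
Proof.
apply: vnorm_le => [|i]; first by apply: sumr_ge0 => i _; exact: cmod_ge0.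
rewrite (bigD1 i)//= lerDl; apply: sumr_ge0 => j _; exact: cmod_ge0.
Qed.

(** A box in the real coordinates is compact as an image of a product of segments; it serves as a
    compact set enclosing a ball. *)
Definition polybox r : set V :=
  [set z | forall i, `|complex.Re (z i 0)| <= r /\ `|complex.Im (z i 0)| <= r].

Lemma compact_polybox r : compact (polybox r).
Proof.
pose D := [set pt xy.1 xy.2 | xy in `[- r, r] `*` `[- r, r]].
have cD : compact D.
  apply: continuous_compact.
    apply: continuous_subspaceT => -[x y]; apply: ReIm_cvg => /=.
      exact: cvg_fst.
    exact: cvg_snd.
  by apply: compact_setX; exact: segment_compact.
have := rV_compact (fun _ : 'I_N => cD).
set B := [set _ | _] => cB.
rewrite (_ : polybox r = [set v^T | v in B]); last first.
  apply/seteqP; split=> [z hz|_ [v hv <-] i].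
    exists z^T; last by rewrite trmxK.
    move=> i; have [hr hi] := hz i; rewrite mxE.
    exists (complex.Re (z i 0), complex.Im (z i 0)); last by rewrite ptK.
    by split; rewrite /= in_itv /= -ler_norml.
  have [[x y] [/=]] := hv i; rewrite !in_itv /= -!ler_norml => hx hy e.
  by rewrite !mxE -e.
apply: continuous_compact cB; apply: continuous_subspaceT => v P /= [Q hQ PQ].
by exists (fun i j => Q j i) => [i j|w hw]; [have := hQ j i; rewrite mxE|apply: PQ => i j; rewrite mxE].
Qed.

Lemma vnorm_polybox z r : vnorm z <= r -> polybox r z.
Proof.
by move=> zr i; split; apply: le_trans (le_trans (cmod_vnorm z i) zr);
  [exact: Re_le_cmod|exact: Im_le_cmod].
Qed.

Lemma coord_entire i : entire (fun z : V => z i 0).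
Proof. by move=> z; exact: differentiable_coord. Qed.

Definition mkEntire (f : V -> C) (hf : entire f) : entireType R N :=
  Entire (etrans (erefl _) (mem_set hf)).

Lemma entire_bounded (K : set V) (f : V -> C) : entire f -> compact K ->
  exists2 M : R, 0 < M & forall z, K z -> cmod (f z) < M.
Proof.
move=> hf cK; have [_ /gtc0P[M M0 ->] h] := entire_fun_bounded (mkEntire hf) cK.
by exists M => // z /h; rewrite normE ofR_lt.
Qed.

Lemma entire_ball_bounded r (f : V -> C) : entire f ->
  exists2 M : R, 0 < M & forall z, vnorm z <= r -> cmod (f z) < M.
Proof.
move=> hf; have [M M0 h] := entire_bounded hf (@compact_polybox r).
by exists M => // z zr; apply: h; exact: vnorm_polybox.
Qed.

Lemma compact_vnorm (K : set V) : compact K -> exists2 r, 0 <= r & forall z, K z -> vnorm z <= r.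
Proof.
move=> cK.
have /all_sig2[M M0 hM] : forall i, {M : R | 0 < M & forall z, K z -> cmod (z i 0) < M}.
  by move=> i; apply: cid2; exact: (entire_bounded (coord_entire i)).
exists (\sum_i M i); first by apply: sumr_ge0 => i _; exact: ltW.
move=> z Kz; apply: le_trans (vnorm_sum z) _; apply: ler_sum => i _.
by apply: ltW; exact: hM.
Qed.

Implicit Types (f g : entireType R N).

(** Compact sets lie in balls centered at 0 and balls lie in compact boxes, so suprema over balls
    define the topology. *)
Lemma entire_nbhs_ballP f (A : set (entireType R N)) : nbhs f A <->
  exists r e, [/\ 0 <= r, 0 < e &
    forall g, (forall z, vnorm z <= r -> cmod (f z - g z) < e) -> A g].
Proof.
split=> [/entire_nbhsP[K [_ [cK /gtc0P[e e0 ->] KA]]]|[r [e [r0 e0 h]]]].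
  have [r r0 hr] := compact_vnorm cK; exists r, e; split => // g hg; apply: KA => z Kz.
  by rewrite normE ofR_lt; apply/hg/hr.
apply/entire_nbhsP; exists (polybox r), (ofR e); split.
- exact: compact_polybox.
- by rewrite -ofR0 ofR_lt.
- move=> g hg; apply: h => z /vnorm_polybox/hg.
  by rewrite normE ofR_lt.
Qed.

Lemma entire_cvg_ballP (F : set_system (entireType R N)) f : Filter F ->
  (F --> f) <-> forall r e, 0 <= r -> 0 < e ->
    F [set g | forall z, vnorm z <= r -> cmod (f z - g z) < e].
Proof.
move=> FF; split=> [Ff r e r0 e0|h A /entire_nbhs_ballP[r [e [r0 e0 hA]]]].
  by apply: Ff; apply/entire_nbhs_ballP; exists r, e; split.
exact: filterS hA (h r e r0 e0).
Qed.

End vector_norm.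

(** * Taylor bounds, Cauchy estimates and Weierstrass limits in several variables *)

Section several_variables.
Variables (R : realType) (N : nat).
Local Notation C := R[i].
Local Notation V := 'cV[C]_N.
Implicit Types (z w h v : V) (s : C) (r e M : R) (f F : V -> C).

Lemma line_cdif f z w s : differentiable f (z + s *: w) ->
  cdif (fun s => f (z + s *: w)) s ('D_w f (z + s *: w)).
Proof.
set a := z + s *: w => df0; have df : derivable f a w := diff_derivable df0.
apply: small_cdif => e e0.
have := (cmod_cvgP (@dnbhs_filter _ (0 : C)) _ _).1 df.
move=> /(_ e e0); rewrite near_withinE => /nbhs_cmodP[d d0 hd].
exists d => // s' ss'; have [->|sn] := eqVneq s' s.
  by rewrite -/a !subrr mulr0 subrr cmod0 mulr0.
have sn0 : s' - s != 0 by rewrite subr_eq0.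
have := hd (s' - s); rewrite subr0 => /(_ ss' sn0) /=.
have -> : (s' - s) *: w + a = z + s' *: w.
  by rewrite /a scalerBl addrC -addrA [_ *: w + _]addrC subrK.
rewrite -/(derive f a w) => hlt.
have -> : f (z + s' *: w) - f a - 'D_w f a * (s' - s) =
    ((s' - s)^-1 *: (f (z + s' *: w) - f a) - 'D_w f a) * (s' - s).
  by rewrite mulrBl /GRing.scale/= mulrAC mulVf// mul1r.
by rewrite cmodM ler_wpM2r ?cmod_ge0// ltW.
Qed.

(** The bridge to the one-variable theory: Taylor expansions of [f] are those of its restrictions to
    complex lines. *)
Lemma line_holo f z w : entire f -> holo (fun s => f (z + s *: w)).
Proof. by move=> hf s; exists ('D_w f (z + s *: w)); exact: line_cdif. Qed.

Lemma cmod_sum6 (a b c d p q : C) : cmod (a - b + c - d - p + q) <=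
  cmod a + cmod b + cmod c + cmod d + cmod p + cmod q.
Proof.
apply: le_trans (cmodD _ _) _; rewrite lerD2r.
apply: le_trans (cmod_subD _ _) _; rewrite lerD2r.
apply: le_trans (cmod_subD _ _) _; rewrite lerD2r.
by apply: le_trans (cmodD _ _) _; rewrite lerD2r cmod_subD.
Qed.

Definition ebase i : V := delta_mx i 0.

Lemma derive_lin f z h : differentiable f z ->
  'D_h f z = \sum_i h i 0 * 'D_(ebase i) f z.
Proof.
move=> df; rewrite deriveE// {1}(_ : h = \sum_i h i 0 *: ebase i).
  by rewrite linear_sum; apply: eq_bigr => i _; rewrite linearZ deriveE.
apply/colP => j; rewrite summxE (bigD1 j)//= !mxE !eqxx mulr1 big1 ?addr0//.
by move=> i ij; rewrite !mxE eq_sym (negbTE ij) mulr0.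
Qed.

Lemma cauchy_coef0 (g : C -> C) M : holo g -> (forall t, cmod (g (circ t)) <= M) ->
  cauchy_coef g 0 = g 0.
Proof.
move=> hg hM; apply/esym/eqP; rewrite -subr_eq0; apply/eqP/eq0_small => e e0.
have s1 : cmod (0 : C) < 1 by rewrite cmod0.
have := taylor_bound s1 1 hg hM.
rewrite big_ord_recl big_ord0 addr0 expr0 mulr1 cmod0 expr1 mul0r mulr0.
by move/le_trans; apply; exact: ltW.
Qed.

(** On the line through [z] along [h] the unit disc stays in the ball where [f] is bounded by [M].
    For a parameter of modulus at most 1/2 the factor [1 / (1 - cmod l)] of [taylor_bound] is at
    most 2. *)
Lemma taylor_bound2 f z h l M : entire f -> (forall w, vnorm (w - z) <= vnorm h -> cmod (f w) <= M) ->
  cmod l <= 2^-1 ->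
  cmod (f (z + l *: h) - f z) <= 2 * M * cmod l /\
  cmod (f (z + l *: h) - f z - l * 'D_h f z) <= 2 * M * cmod l ^+ 2.
Proof.
move=> hf hM l2; pose g s := f (z + s *: h).
have hg : holo g := line_holo z h hf.
have gM t : cmod (g (circ t)) <= M.
  by apply: hM; rewrite addrC addKr vnormZ cmod_circ mul1r.
have M0 : 0 <= M := le_trans (cmod_ge0 _) (gM 0).
have l1 : cmod l < 1 by apply: le_lt_trans l2 _; rewrite invf_lt1// ltr1n.
have g0 : g 0 = f z by rewrite /g scale0r addr0.
have c0 : cauchy_coef g 0 = f z by rewrite (cauchy_coef0 hg gM).
have inv2 (s : C) n : cmod s <= 2^-1 -> M * (cmod s ^+ n / (1 - cmod s)) <= 2 * M * cmod s ^+ n.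
  move=> s2; rewrite [2 * M]mulrC -mulrA ler_wpM2l// mulrC ler_wpM2r ?exprn_ge0 ?cmod_ge0//.
  have -> : 2 = (2^-1)^-1 :> R by rewrite invrK.
  by rewrite lef_pV2 ?posrE; lra.
have c1 : cauchy_coef g 1 = 'D_h f z.
  have /cdif_small dg := line_cdif (s := 0) (hf (z + 0 *: h)).
  apply/eqP; rewrite -subr_eq0; apply/eqP/eq0_small => e e0.
  have e20 : 0 < e / 2 by lra.
  have [d d0 hd] := dg _ e20.
  (* At a parameter this small both the Taylor remainder and the error of differentiability apply,
     and [t * (4 * M + 1) <= e] lets the former, [2 * M * t ^+ 2], fit into [e / 2 * t]. Comparing
     the two expansions identifies the coefficient with the derivative. *)
  pose t : R := Num.min (2^-1) (Num.min (d / 2) (e / (4 * M + 1))).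
  have M4 : 0 < 4 * M + 1 by lra.
  have t0 : 0 < t by rewrite !lt_min invr_gt0 ltr0n !divr_gt0.
  have t2 : t <= 2^-1 by rewrite ge_min lexx.
  have td : t < d.
    have : t <= d / 2 by rewrite !ge_min lexx orbT.
    move=> h'; lra.
  have te : t * (4 * M + 1) <= e by rewrite -ler_pdivlMr// !ge_min lexx !orbT.
  have ct : cmod (ofR t) = t by rewrite cmod_ofR gtr0_norm.
  have t1 : cmod (ofR t) < 1 by rewrite ct; lra.
  have := taylor_bound t1 2 hg gM.
  rewrite big_ord_recl big_ord1 expr0 mulr1 c0 expr1 /= => b1.
  have b2 := le_trans b1 (inv2 (ofR t) 2%N _).
  have {b2} := b2 _; rewrite ct => /(_ t2) b2.
  have := hd (ofR t); rewrite subr0 ct => /(_ td).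
  rewrite scale0r addr0 -/(g _) => b3.
  rewrite -(ler_pM2r t0) -{1}ct -cmodM.
  have -> : (cauchy_coef g 1 - 'D_h f z) * ofR t =
    (g (ofR t) - f z - 'D_h f z * ofR t) - (g (ofR t) - (f z + cauchy_coef g 1 * ofR t)) by ring.
  apply: le_trans (cmod_subD _ _) _; apply: le_trans (lerD b3 b2) _; nra.
split.
  have := le_trans (taylor_bound l1 1 hg gM) (inv2 _ _ l2).
  by rewrite big_ord1 expr0 mulr1 c0 expr1.
have := le_trans (taylor_bound l1 2 hg gM) (inv2 _ _ l2).
by rewrite big_ord_recl big_ord1 expr0 mulr1 c0 /= c1 expr1 opprD addrA [_ * l]mulrC.
Qed.

(** The derivative is recovered from the two quantities bounded by [taylor_bound2] at the parameter
    1/2. The constant is generous; it reappears in [opT_continuous]. *)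
Lemma cauchy_estimate f z h M : entire f ->
  (forall w, vnorm (w - z) <= vnorm h -> cmod (f w) <= M) -> cmod ('D_h f z) <= 6 * M.
Proof.
move=> hf hM; have M0 : 0 <= M.
  by apply: le_trans (cmod_ge0 (f z)) (hM z _); rewrite subrr vnorm0 vnorm_ge0.
pose l : C := ofR 2^-1; have cl : cmod l = 2^-1 by rewrite cmod_ofR ger0_norm// invr_ge0.
have [] := @taylor_bound2 f z h l M hf hM; rewrite ?cl// => b1 b2.
have : cmod (l * 'D_h f z) <= 2 * M * 2^-1 + 2 * M * 2^-1 ^+ 2.
  have -> : l * 'D_h f z = (f (z + l *: h) - f z) - (f (z + l *: h) - f z - l * 'D_h f z) by ring.
  by apply: le_trans (cmod_subD _ _) _; exact: lerD.
by rewrite cmodM cl; lra.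
Qed.

(** A second-order bound is what survives the limit in [weierstrass]. Subtracting the linear part
    [L] reduces the claim to a function whose differential is zero. *)
Lemma quadratic_differentiable F z (l : 'I_N -> C) K d : 0 < d ->
  (forall h, vnorm h <= d ->
     cmod (F (z + h) - F z - \sum_i h i 0 * l i) <= K * vnorm h ^+ 2) ->
  differentiable F z.
Proof.
move=> d0 hF.
pose L (w : V) : C := \sum_i w i 0 * l i.
have dL w : differentiable L w.
  rewrite /L; under [X in differentiable X _]eq_fun => u do under eq_bigr do rewrite mulrC.
  rewrite (_ : (fun u => _) = \sum_i (fun u : V => l i *: (u i 0 : C))).
    apply: differentiable_sum => i; apply: differentiableZ; exact: differentiable_coord.
  by apply/funext => u; rewrite fct_sumE.
pose G w := F w - L w.
suff dG : differentiable G z.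
  rewrite (_ : F = G + L); first exact: differentiableD.
  by apply/funext => w; rewrite /G /= -[in RHS]/(_ + _) /= subrK.
have GE h : G (z + h) - G z = F (z + h) - F z - \sum_i h i 0 * l i.
  rewrite /G /L; under eq_bigr do rewrite mxE mulrDl.
  by rewrite big_split /=; ring.
have oG : G \o shift z = cst (G z) + (\0 : {linear V -> C}) +o_ (0 : V) id.
  apply/eqaddoP => _ /gtc0P[e e0 ->].
  pose K' := `|K| + 1; have K0 : 0 < K' by rewrite ltr_wpDl.
  apply/nbhs_vnormP; exists (Num.min d (e / K')).
    by rewrite lt_min d0 divr_gt0.
  move=> h; rewrite subr0 lt_min => /andP[hd he].
  rewrite vnormE normE -ofRM ofR_le.
  have -> : (G \o shift z - (cst (G z) + \0)) h = G (z + h) - G z.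
    by rewrite [z + h]addrC /= -[LHS]/(G (h + z) - (G z + 0)) addr0.
  rewrite GE; apply: le_trans (hF h (ltW hd)) _.
  rewrite expr2 mulrA ler_wpM2r ?vnorm_ge0//.
  apply: le_trans (_ : K' * vnorm h <= _).
    by rewrite ler_wpM2r ?vnorm_ge0// /K'; have := ler_norm K; lra.
  by rewrite mulrC -ler_pdivlMr// ltW.
have c0 : continuous (\0 : {linear V -> C}) by move=> w; exact: cst_continuous.
apply/diff_locallyP; rewrite (diff_unique c0 oG); split; first exact: c0.
exact: oG.
Qed.

Lemma lim_cmod_le (a : nat -> C) (b : C) K :
  (forall n, cmod (a n) <= K) ->
  (forall e, 0 < e -> exists n0, forall n, (n0 <= n)%N -> cmod (a n - b) < e) ->
  cmod b <= K.
Proof.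
move=> aK ab; apply/ler_addgt0Pr => e e0; have [n0 /(_ n0 (leqnn _)) h] := ab e e0.
have -> : b = a n0 - (a n0 - b) by ring.
by apply: le_trans (cmod_subD _ _) _; rewrite lerD// ltW.
Qed.

Definition pw_lim (fs : nat -> V -> C) f :=
  forall w e, 0 < e -> exists n0, forall n, (n0 <= n)%N -> cmod (fs n w - f w) < e.

Lemma weierstrass_budget M (t e a b c d p q : R) : 0 < t -> t * (8 * M + 8) <= e ->
  a <= 2 * M * t ^+ 2 -> b <= 2 * M * t ^+ 2 -> c < e * t / 8 -> d < e * t / 8 ->
  p < e * t / 8 -> q < e * t / 8 -> a + b + c + d + p + q < e * t.
Proof.
move=> t0 te; have := ler_wpM2l (ltW t0) te; have : 0 < t * t by rewrite mulr_gt0.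
rewrite expr2 => *; lra.
Qed.

(** Local boundedness makes the quadratic Taylor bound uniform in [n]. It first forces the partial
    derivatives at [z] to converge, then passes to the limit and gives differentiability. Pointwise
    convergence is therefore enough. *)
Theorem weierstrass (fs : nat -> V -> C) f : (forall n, entire (fs n)) ->
  (forall r, exists M, forall n w, vnorm w <= r -> cmod (fs n w) <= M) ->
  pw_lim fs f -> entire f.
Proof.
move=> hfs hB lim z.
have [M hM] := hB (vnorm z + 1).
have bM n h : vnorm h <= 1 -> forall w, vnorm (w - z) <= vnorm h -> cmod (fs n w) <= M.
  move=> h1 w wz; apply: hM; rewrite -(subrK z w) addrC.
  by apply: le_trans (vnormD _ _) _; rewrite lerD2l (le_trans wz).
have M0 : 0 <= M.
  by apply: le_trans (cmod_ge0 (fs 0%N z)) (hM 0%N z _); rewrite lerDl.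
have ebase1 i : vnorm (ebase i) <= 1.
  apply: vnorm_le => // j; rewrite !mxE eqxx andbT; case: (j == i).
    by rewrite mulr1n cmod1.
  by rewrite mulr0n cmod0.
have [l hl] : exists l : 'I_N -> C, forall i e, 0 < e -> exists n0, forall n, (n0 <= n)%N ->
    cmod ('D_(ebase i) (fs n) z - l i) < e.
  suff H i : exists l : C, forall e, 0 < e -> exists n0, forall n, (n0 <= n)%N ->
    cmod ('D_(ebase i) (fs n) z - l) < e.
    by have [l hl] := choice H; exists l.
  apply: cauchy_complex => e e0.
  (* At this fixed step the difference quotients approximate the derivatives of all [fs n] with the
     same error, so the Cauchy property reduces to convergence at the two points [z] and
     [z + ofR t *: ebase i]. *)
  pose t : R := Num.min (2^-1) (e / (8 * M + 8)).
  have M8 : 0 < 8 * M + 8 by lra.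
  have t0 : 0 < t by rewrite lt_min invr_gt0 ltr0n divr_gt0.
  have t2 : t <= 2^-1 by rewrite ge_min lexx.
  have te : t * (8 * M + 8) <= e by rewrite -ler_pdivlMr// !ge_min lexx !orbT.
  have ct : cmod (ofR t) = t by rewrite cmod_ofR gtr0_norm.
  have et : 0 < e * t / 8 by rewrite !mulr_gt0// invr_gt0.
  have [n1 h1] := lim z _ et; have [n2 h2] := lim (z + ofR t *: ebase i) _ et.
  exists (maxn n1 n2) => n m; rewrite !geq_max => /andP[n1n n2n] /andP[n1m n2m].
  have tb k : cmod (fs k (z + ofR t *: ebase i) - fs k z - ofR t * 'D_(ebase i) (fs k) z) <= 2 * M * t ^+ 2.
    by rewrite -{3}ct; apply: (taylor_bound2 (hfs k) (bM k _ (ebase1 i)) _).2; rewrite ct.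
  have := h1 _ n1n; have := h1 _ n1m; have := h2 _ n2n; have := h2 _ n2m.
  have := tb n; have := tb m.
  set dn := 'D__ (fs n) z; set dm := 'D__ (fs m) z.
  set an := fs n (z + _); set am := fs m (z + _); set a := f (z + _).
  move: (fs n z) (fs m z) (f z) => bn bm b.
  clearbody an am a dn dm => i1 i2 i3 i4 i5 i6.
  rewrite -(ltr_pM2r t0) -{1}ct -cmodM.
  have -> : (dn - dm) * ofR t = (am - bm - ofR t * dm) - (an - bn - ofR t * dn)
     + (an - a) - (am - a) - (bn - b) + (bm - b) by ring.
  apply: le_lt_trans (cmod_sum6 _ _ _ _ _ _) _.
  exact: (@weierstrass_budget M t e) t0 te i1 i2 i4 i3 i6 i5.
apply: (@quadratic_differentiable f z l (2 * M) (2^-1)) => [|h h2]; first by rewrite invr_gt0.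
have [->|h0] := eqVneq h 0.
  rewrite addr0 subrr sub0r cmodN big1 => [|i _]; last by rewrite mxE mul0r.
  by rewrite cmod0 vnorm0 expr0n mulr0.
pose a := vnorm h; have a0 : 0 < a by rewrite vnorm_gt0.
pose u := (ofR a)^-1 *: h.
have ca : cmod (ofR a) = a by rewrite cmod_ofR gtr0_norm.
have an0 : ofR a != 0 by rewrite -cmod_eq0 ca gt_eqF.
have hu : h = ofR a *: u by rewrite /u scalerA divff// scale1r.
have u1 : vnorm u = 1 by rewrite vnormZ cmodV ca mulVf// gt_eqF.
clearbody u.
(* The bound is obtained along the unit vector [u], for which [M] is available, with the parameter
   [a = vnorm h]; [derive_lin] then rewrites the derivative along [u] with the convergent partial
   derivatives. *)
apply: (@lim_cmod_le (fun n => fs n (z + h) - fs n z - ofR a * 'D_u (fs n) z)).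
  move=> n; rewrite {1}hu -/a -{3}ca.
  by apply: (taylor_bound2 (hfs n) (bM n u _) _).2; rewrite ?u1// ca.
move=> e e0.
have DE n : ofR a * 'D_u (fs n) z = \sum_i h i 0 * 'D_(ebase i) (fs n) z.
  rewrite (derive_lin _ (hfs n z)) mulr_sumr; apply: eq_bigr => i _.
  by rewrite mulrA [in RHS]hu mxE.
have e30 : 0 < e / 3 by lra.
pose q := e / (3 * (\sum_i cmod (h i 0) + 1)).
have S0 : 0 <= \sum_i cmod (h i 0) by apply: sumr_ge0 => i _; exact: cmod_ge0.
have q0 : 0 < q by rewrite divr_gt0// mulr_gt0// ltr_wpDl.
have [n1 h1] := lim z _ e30; have [n2 h2'] := lim (z + h) _ e30.
have /choice[n3 h3] : forall i, exists n0, forall n, (n0 <= n)%N ->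
    cmod ('D_(ebase i) (fs n) z - l i) < q by move=> i; exact: hl.
exists (maxn (maxn n1 n2) (\max_i n3 i)) => n; rewrite !geq_max => /andP[/andP[n1n n2n] n3n].
rewrite DE.
have b3 : cmod (\sum_i h i 0 * 'D_(ebase i) (fs n) z - \sum_i h i 0 * l i) <= e / 3.
  rewrite -sumrB; apply: le_trans (cmod_sum _ _ _) _.
  apply: (@le_trans _ _ (\sum_i cmod (h i 0) * q)).
    apply: ler_sum => i _; rewrite -mulrBr cmodM ler_wpM2l ?cmod_ge0// ltW// h3//.
    by apply: leq_trans n3n; exact: leq_bigmax.
  rewrite -mulr_suml /q; set S := \sum_i _ in S0 *.
  have S1 : 0 < S + 1 by rewrite ltr_wpDl.
  have -> : S * (e / (3 * (S + 1))) = e / 3 * (S / (S + 1)) by field; rewrite gt_eqF.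
  by rewrite ler_piMr ?(ltW e30)// ler_pdivrMr// mul1r lerDl.
have b1 := h1 _ n1n; have b2 := h2' _ n2n.
have -> : fs n (z + h) - fs n z - \sum_i h i 0 * 'D_(ebase i) (fs n) z -
    (f (z + h) - f z - \sum_i h i 0 * l i) = (fs n (z + h) - f (z + h)) -
  (fs n z - f z) - (\sum_i h i 0 * 'D_(ebase i) (fs n) z - \sum_i h i 0 * l i) by ring.
apply: le_lt_trans (cmod_subD _ _) _.
have := cmod_subD (fs n (z + h) - f (z + h)) (fs n z - f z); lra.
Qed.

(** The derivative is a pointwise limit of difference quotients, which are entire and locally
    bounded by [taylor_bound2]. The steps [s n] start at 1/2, the range of that lemma. *)
Theorem entire_derive f v : entire f -> entire (fun z => 'D_v f z).
Proof.
move=> hf; pose s n : C := ofR (n.+2%:R^-1).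
have cs n : cmod (s n) = n.+2%:R^-1 by rewrite cmod_ofR ger0_norm// invr_ge0.
have s2 n : cmod (s n) <= 2^-1 by rewrite cs lef_pV2 ?posrE// ler_nat.
have s0 n : 0 < cmod (s n) by rewrite cs invr_gt0.
pose fs n z := (s n)^-1 * (f (z + s n *: v) - f z).
apply: (@weierstrass fs) => [n|r|z e e0].
- move=> z; rewrite (_ : fs n = (s n)^-1 \*: ((fun z => f (z + s n *: v)) - f)); last exact/funext.
  apply: differentiableZ; apply: differentiableB; last exact: hf.
  apply: (@differentiable_comp _ _ _ _ (fun z : V => z + s n *: v) f); last exact: hf.
  by apply: differentiableD => //; exact: differentiable_cst.
- have [M M0 hM] := entire_ball_bounded (r + vnorm v) hf.
  exists (2 * M) => n w wr.
  have bM u : vnorm (u - w) <= vnorm v -> cmod (f u) <= M.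
    move=> uw; apply/ltW/hM; rewrite -(subrK w u) addrC.
    by apply: le_trans (vnormD _ _) _; exact: lerD.
  have [b _] := taylor_bound2 hf bM (s2 n).
  by rewrite cmodM cmodV mulrC ler_pdivrMr.
- have [M M0 hM] := entire_ball_bounded (vnorm z + vnorm v) hf.
  have bM u : vnorm (u - z) <= vnorm v -> cmod (f u) <= M.
    move=> uw; apply/ltW/hM; rewrite -(subrK z u) addrC.
    by apply: le_trans (vnormD _ _) _; rewrite lerD2l.
  have [n0 hn0] : exists n0, 2 * M / e < n0%:R.
    by exists (Num.bound (2 * M / e)); rewrite archi_boundP// divr_ge0 ?mulr_ge0// ltW.
  exists n0 => n nn0; have [_ b] := taylor_bound2 hf bM (s2 n).
  have sn0 : s n != 0 by rewrite -cmod_gt0.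
  have -> : fs n z - 'D_v f z = (s n)^-1 * (f (z + s n *: v) - f z - s n * 'D_v f z).
    by rewrite /fs; field.
  rewrite cmodM cmodV mulrC ltr_pdivrMr//; apply: le_lt_trans b _.
  rewrite expr2 mulrA ltr_pM2r// cs ltr_pdivrMr// [e * _]mulrC -ltr_pdivrMr//.
  by apply: (lt_le_trans hn0); rewrite ler_nat; apply: leq_trans nn0 _; rewrite -addn2 leq_addr.
Qed.

End several_variables.

(** * Polynomials and the operator *)

Section affine_maps.
Variables (R : realType) (N : nat).
Local Notation C := R[i].
Local Notation V := 'cV[C]_N.

Lemma mulmx_bound (B : 'M[C]_N) : exists2 a : R, 0 <= a & forall z : V, vnorm (B *m z) <= a * vnorm z.
Proof.
exists (\sum_i \sum_j cmod (B i j)).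
  by apply: sumr_ge0 => i _; apply: sumr_ge0 => j _; exact: cmod_ge0.
move=> z; apply: le_trans (vnorm_sum _) _; rewrite mulr_suml; apply: ler_sum => i _.
rewrite mxE; apply: le_trans (cmod_sum _ _ _) _; rewrite mulr_suml; apply: ler_sum => j _.
by rewrite cmodM ler_wpM2l ?cmod_ge0// cmod_vnorm.
Qed.

Lemma entireP (f : entireType R N) : entire f.
Proof. by have := entire_funP f; rewrite inE. Qed.

Lemma entire_ext (f g : entireType R N) : (f : _ -> _) =1 g -> f = g.
Proof. by move=> fg; apply: val_inj; apply/funext. Qed.

Lemma mulmx_differentiable (B : 'M[C]_N) (c z : V) : differentiable (fun z => B *m z + c) z.
Proof.
apply: differentiableD; last exact: differentiable_cst.
have [a a0 ha] := mulmx_bound B.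
have cB : continuous (mulmx B : {linear V -> V}).
  move=> w P /nbhs_vnormP[d d0 hd]; apply/nbhs_vnormP.
  have a1 : 0 < a + 1 by rewrite ltr_wpDl.
  exists (d / (a + 1)); first by rewrite divr_gt0.
  move=> w' ww'; apply: hd; rewrite -mulmxBr; apply: le_lt_trans (ha _) _.
  apply: (@le_lt_trans _ _ ((a + 1) * vnorm (w' - w))).
    by rewrite ler_wpM2r ?vnorm_ge0// lerDl.
  by rewrite mulrC -ltr_pdivlMr.
exact: linear_differentiable.
Qed.

Lemma entire_affine (f : V -> C) (B : 'M[C]_N) (c : V) : entire f ->
  entire (fun z => f (B *m z + c)).
Proof.
move=> hf z; apply: (@differentiable_comp _ _ _ _ (fun z : V => B *m z + c) f); last exact: hf.
exact: mulmx_differentiable.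
Qed.

End affine_maps.

Section polynomials.
Variables (R : realType) (N : nat).
Local Notation C := R[i].
Local Notation V := 'cV[C]_N.
Variable p : V.
Implicit Types (f g q : V -> C) (z w : V) (d : nat).

(** Polynomial functions of degree at most [d], in a nested Horner form centered at the fixed point
    [p]. The form is not unique, but it makes sums, products, derivatives and primitives plain
    inductions on [d]. *)
Fixpoint pdeg d f : Prop :=
  if d is d'.+1 then exists (c : C) (g : 'I_N -> V -> C),
    (forall i, pdeg d' (g i)) /\ f = (fun z => c + \sum_i (z i 0 - p i 0) * g i z)
  else exists c : C, f = (fun=> c).

Lemma pdeg_cst d (c : C) : pdeg d (fun=> c).
Proof.
elim: d c => [|d IH] c /=; first by exists c.
exists c, (fun _ _ => 0); split => [i|]; first exact: IH.
by apply/funext => z; rewrite big1 ?addr0// => i _; rewrite mulr0.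
Qed.

Lemma pdegD d f g : pdeg d f -> pdeg d g -> pdeg d (fun z => f z + g z).
Proof.
elim: d f g => [|d IH] f g /=.
  by move=> [c ->] [c' ->]; exists (c + c').
move=> [c [F [hF ->]]] [c' [G [hG ->]]].
exists (c + c'), (fun i z => F i z + G i z); split => [i|]; first exact: IH.
apply/funext => z; rewrite addrACA -big_split /=; congr (_ + _).
by apply: eq_bigr => i _; rewrite mulrDr.
Qed.

Lemma pdegZ d (k : C) f : pdeg d f -> pdeg d (fun z => k * f z).
Proof.
elim: d f => [|d IH] f /=.
  by move=> [c ->]; exists (k * c).
move=> [c [F [hF ->]]]; exists (k * c), (fun i z => k * F i z); split => [i|]; first exact: IH.
apply/funext => z; rewrite mulrDr mulr_sumr; congr (_ + _).
by apply: eq_bigr => i _; rewrite mulrCA.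
Qed.

Lemma pdeg_sum d I (s : seq I) (F : I -> V -> C) : (forall i, pdeg d (F i)) ->
  pdeg d (fun z => \sum_(i <- s) F i z).
Proof.
move=> hF; elim: s => [|i s IH].
  rewrite (_ : (fun _ => _) = fun=> 0); first exact: pdeg_cst.
  by apply/funext => z; rewrite big_nil.
rewrite (_ : (fun _ => _) = fun z => F i z + \sum_(j <- s) F j z); first exact: pdegD.
by apply/funext => z; rewrite big_cons.
Qed.

Lemma pdegS d f : pdeg d f -> pdeg d.+1 f.
Proof.
elim: d f => [|d IH] f; first by move=> [c ->]; exact: pdeg_cst.
by move=> [c [F [hF ->]]]; exists c, F; split => // i; exact: (IH _ (hF i)).
Qed.

Lemma pdeg_le d d' f : (d <= d')%N -> pdeg d f -> pdeg d' f.
Proof.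
move=> /subnK <- hf; elim: (d' - d)%N => [//|k IH].
by rewrite addSn; exact: pdegS.
Qed.

Lemma pdegX d i f : pdeg d f -> pdeg d.+1 (fun z => (z i 0 - p i 0) * f z).
Proof.
move=> hf; exists 0, (fun j => if j == i then f else fun=> 0); split => [j|].
  by case: ifP => _ //; exact: pdeg_cst.
apply/funext => z; rewrite add0r (bigD1 i)//= eqxx big1 ?addr0// => j /negbTE ->.
by rewrite mulr0.
Qed.

Lemma pdegM d d' f g : pdeg d f -> pdeg d' g -> pdeg (d + d') (fun z => f z * g z).
Proof.
elim: d f => [|d IH] f.
  by move=> [c ->] hg; exact: pdegZ.
move=> [c [F [hF ->]]] hg.
rewrite (_ : (fun _ => _) = fun z => c * g z + \sum_i (z i 0 - p i 0) * (F i z * g z)); last first.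
  apply/funext => z; rewrite mulrDl mulr_suml; congr (_ + _).
  by apply: eq_bigr => i _; rewrite mulrA.
apply: pdegD; first by apply: pdeg_le (pdegZ c hg); rewrite addSn ltnW// ltnS leq_addl.
by rewrite addSn; apply: pdeg_sum => i; apply: pdegX; exact: (IH _ (hF i) hg).
Qed.

Lemma pdeg_entire d f : pdeg d f -> entire f.
Proof.
elim: d f => [|d IH] f /=.
  by move=> [c ->] z; exact: differentiable_cst.
move=> [c [F [hF ->]]] z.
rewrite (_ : (fun _ => _) = cst c + \sum_i (fun z => (z i 0 - p i 0) * F i z)); last first.
  by apply/funext => w; rewrite /= -[RHS]/(c + _) fct_sumE.
apply: differentiableD; first exact: differentiable_cst.
apply: differentiable_sum => i; apply: differentiableM; last exact: IH.
apply: differentiableB; last exact: differentiable_cst.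
exact: differentiable_coord.
Qed.

Lemma pdeg_growth d f : pdeg d f ->
  exists2 K : R, 0 <= K & forall z, cmod (f z) <= K * (1 + vnorm (z - p)) ^+ d.
Proof.
elim: d f => [|d IH] f /=.
  by move=> [c ->]; exists (cmod c); [exact: cmod_ge0|move=> z; rewrite expr0 mulr1].
move=> [c [F [hF ->]]].
have /all_sig2[K K0 hK] : forall i, {K : R | 0 <= K &
    forall z, cmod (F i z) <= K * (1 + vnorm (z - p)) ^+ d}.
  by move=> i; apply: cid2; exact: IH.
exists (cmod c + \sum_i K i); first by rewrite addr_ge0 ?cmod_ge0// sumr_ge0.
move=> z; have z0 := vnorm_ge0 (z - p).
have z1 : 1 <= 1 + vnorm (z - p) by rewrite lerDl.
apply: le_trans (cmodD _ _) _; rewrite mulrDl; apply: lerD.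
  by rewrite ler_peMr ?cmod_ge0// exprn_ege1.
apply: le_trans (cmod_sum _ _ _) _; rewrite mulr_suml; apply: ler_sum => i _.
rewrite cmodM exprS mulrCA; apply: ler_pM; rewrite ?cmod_ge0//.
have := cmod_vnorm (z - p) i; rewrite !mxE => /le_trans; apply; lra.
Qed.

(** Centering at [p] pays off here: a substitution fixing [p] replaces the centered coordinates by
    linear combinations of themselves, so the degree does not grow. *)
Lemma pdeg_comp (B : 'M[C]_N) d f : pdeg d f -> pdeg d (fun z => f (p + B *m (z - p))).
Proof.
elim: d f => [|d IH] f /=; first by move=> [c ->]; exists c.
move=> [c [F [hF ->]]].
exists c, (fun j z => \sum_i B i j * F i (p + B *m (z - p))); split.
  by move=> j; apply: pdeg_sum => i; apply: pdegZ; exact: IH.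
apply/funext => z; congr (_ + _).
under [RHS]eq_bigr do rewrite mulr_sumr.
rewrite exchange_big /=; apply: eq_bigr => i _.
rewrite mxE [p i 0 + _]addrC addrK mxE mulr_suml; apply: eq_bigr => j _.
by rewrite !mxE mulrA [B i j * _]mulrC.
Qed.

Lemma line_cdif_entire f w z : entire f -> forall s, cdif (fun s => f (z + s *: w)) s ('D_w f (z + s *: w)).
Proof. by move=> hf s; apply: line_cdif; exact: hf. Qed.

Lemma cdif_unique (g : C -> C) s l m : cdif g s l -> cdif g s m -> l = m.
Proof.
move=> [phi [h1 c1 <-]] [psi [h2 c2 <-]].
apply/eqP; rewrite -subr_eq0; apply/eqP/eq0_small => e e0.
have e2 : 0 < e / 2 by lra.
have [d1 d10 hd1] := continuous_small c1 e2.
have [d2 d20 hd2] := continuous_small c2 e2.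
pose t := Num.min d1 d2 / 2; have m0 : 0 < Num.min d1 d2 by rewrite lt_min d10.
have t0 : 0 < t by rewrite divr_gt0.
have tm : t < Num.min d1 d2 by rewrite /t; lra.
have := tm; rewrite lt_min => /andP[td1 td2].
have ws : s + ofR t - s = ofR t by rewrite addrC addKr.
have E : phi (s + ofR t) = psi (s + ofR t).
  have tn0 : ofR t != 0 by rewrite -cmod_eq0 cmod_ofR normr_eq0 gt_eqF.
  by apply: (mulIf tn0); have := h1 (s + ofR t); have := h2 (s + ofR t); rewrite ws => <- <-.
have := hd1 (s + ofR t); have := hd2 (s + ofR t).
rewrite ws cmod_ofR gtr0_norm// => /(_ td2) b2 /(_ td1) b1.
have -> : phi s - psi s = (psi (s + ofR t) - psi s) - (phi (s + ofR t) - phi s) by rewrite E; ring.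
by apply: le_trans (cmod_subD _ _) _; lra.
Qed.

Lemma derive_cdif f w z l : entire f -> cdif (fun s => f (z + s *: w)) 0 l -> 'D_w f z = l.
Proof.
move=> hf dl; have := line_cdif_entire w z hf 0; rewrite scale0r addr0 => h.
exact: cdif_unique h dl.
Qed.

Lemma deriveM_entire f g w z : entire f -> entire g ->
  'D_w (fun z => f z * g z) z = 'D_w f z * g z + f z * 'D_w g z.
Proof.
move=> hf hg; have hfg : entire (fun z => f z * g z).
  by move=> u; apply: differentiableM; [exact: hf|exact: hg].
apply: derive_cdif => //.
have := cdifM (line_cdif_entire w z hf 0) (line_cdif_entire w z hg 0).
by rewrite scale0r addr0.
Qed.

Lemma deriveD_entire f g w z : entire f -> entire g ->
  'D_w (fun z => f z + g z) z = 'D_w f z + 'D_w g z.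
Proof.
move=> hf hg; have hfg : entire (fun z => f z + g z).
  by move=> u; apply: differentiableD; [exact: hf|exact: hg].
apply: derive_cdif => //.
have := cdifD (line_cdif_entire w z hf 0) (line_cdif_entire w z hg 0).
by rewrite scale0r addr0.
Qed.

Lemma entireZ (k : C) f : entire f -> entire (fun z => k * f z).
Proof. by move=> hf u; apply: differentiableM; [exact: differentiable_cst|exact: hf]. Qed.

Lemma derive_cst_entire (c : C) w z : 'D_w (fun _ : V => c) z = 0.
Proof.
apply: derive_cdif; last exact: cdif_cst.
by move=> u; exact: differentiable_cst.
Qed.

Lemma deriveZ_entire (k : C) f w z : entire f -> 'D_w (fun z => k * f z) z = k * 'D_w f z.
Proof.
move=> hf; rewrite deriveM_entire//.
by rewrite derive_cst_entire mul0r add0r.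
Qed.

Lemma entire_sum I (s : seq I) (F : I -> V -> C) : (forall i, entire (F i)) ->
  entire (fun z => \sum_(i <- s) F i z).
Proof.
move=> hF z; rewrite (_ : (fun _ => _) = \sum_(i <- s) F i); last first.
  by apply/funext => u; rewrite fct_sumE.
elim: s => [|i s IH]; first by rewrite big_nil; exact: differentiable_cst.
by rewrite big_cons; apply: differentiableD => //; exact: hF.
Qed.

Lemma derive_sum_entire I (s : seq I) (F : I -> V -> C) w z : (forall i, entire (F i)) ->
  'D_w (fun z => \sum_(i <- s) F i z) z = \sum_(i <- s) 'D_w (F i) z.
Proof.
move=> hF; elim: s => [|i s IH].
  under [X in derive X]eq_fun do rewrite big_nil.
  by rewrite derive_cst_entire big_nil.
under [X in derive X]eq_fun do rewrite big_cons.
by rewrite deriveD_entire ?big_cons ?IH//; exact: entire_sum.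
Qed.

Lemma coord_sub_entire i : entire (fun z : V => z i 0 - p i 0).
Proof.
move=> z; apply: differentiableB; last exact: differentiable_cst.
exact: differentiable_coord.
Qed.

Lemma derive_coord i w z : 'D_w (fun z : V => z i 0 - p i 0) z = w i 0.
Proof.
apply: derive_cdif; first exact: coord_sub_entire.
rewrite (_ : (fun _ => _) = fun s => (z i 0 - p i 0) + w i 0 * s); last first.
  by apply/funext => s; rewrite !mxE; ring.
by rewrite -[X in cdif _ _ X]mulr1 -[X in cdif _ _ X]add0r; apply: cdifD;
  [exact: cdif_cst|apply: cdifZ; exact: cdif_id].
Qed.

Lemma pdeg_derive d f w : pdeg d.+1 f -> pdeg d (fun z => 'D_w f z).
Proof.
elim: d f => [|d IH] f [c [F [hF ->]]].
- have hE i : entire (F i) := @pdeg_entire 0 _ (hF i).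
  rewrite (_ : (fun _ => _) = fun z => \sum_i w i 0 * F i z); last first.
    apply/funext => z; rewrite deriveD_entire; last 2 first.
    + by move=> u; exact: differentiable_cst.
    + apply: entire_sum => i u; apply: differentiableM; first exact: coord_sub_entire.
      exact: hE.
    rewrite derive_cst_entire add0r derive_sum_entire => [|i u].
      apply: eq_bigr => i _; rewrite deriveM_entire; last 2 first.
      + exact: coord_sub_entire.
      + exact: hE.
      have [k ->] := hF i.
      by rewrite derive_coord derive_cst_entire mulr0 addr0.
    apply: differentiableM; first exact: coord_sub_entire.
    exact: hE.
  by apply: pdeg_sum => i; exact: pdegZ.
- have hE i : entire (F i) := @pdeg_entire d.+1 _ (hF i).
  rewrite (_ : (fun _ => _) = fun z => \sum_i w i 0 * F i z +
      \sum_i (z i 0 - p i 0) * 'D_w (F i) z); last first.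
    apply/funext => z; rewrite deriveD_entire; last 2 first.
    + by move=> u; exact: differentiable_cst.
    + apply: entire_sum => i u; apply: differentiableM; first exact: coord_sub_entire.
      exact: hE.
    rewrite derive_cst_entire add0r derive_sum_entire => [|i u].
      rewrite -big_split; apply: eq_bigr => i _; rewrite deriveM_entire; last 2 first.
      + exact: coord_sub_entire.
      + exact: hE.
      by rewrite derive_coord.
    apply: differentiableM; first exact: coord_sub_entire.
    exact: hE.
  apply: pdegD; first by apply: pdeg_sum => i; exact: pdegZ.
  by apply: pdeg_sum => i; apply: pdegX; exact: IH.
Qed.

(** The homogeneous term of degree [k] of the Taylor expansion of [f] at [p], read on the line from
    [p] through [z]. *)
Definition taylor_coef f k z := cauchy_coef (fun s => f (p + s *: (z - p))) k.

Lemma cauchy_coef_sum I (s : seq I) (k : nat) (a : I -> C) (G : I -> C -> C) : (forall i, holo (G i)) ->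
  holo (fun x : C => \sum_(i <- s) a i * G i x) /\
  cauchy_coef (fun x : C => \sum_(i <- s) a i * G i x) k = \sum_(i <- s) a i * cauchy_coef (G i) k.
Proof.
move=> hG; elim: s => [|i s [IH1 IH2]].
  split; first by move=> w; exists 0; under eq_fun do rewrite big_nil; exact: cdif_cst.
  rewrite /cauchy_coef; under eq_fun do rewrite big_nil mul0r.
  by rewrite mean_cst big_nil.
have hi : holo (fun x : C => a i * G i x).
  by move=> w; have [l dl] := hG i w; exists (a i * l); exact: cdifZ.
split.
  move=> w; have [l dl] := IH1 w; have [m dm] := hi w; exists (m + l).
  by under eq_fun do rewrite big_cons; exact: cdifD.
rewrite big_cons -IH2 /cauchy_coef; under eq_fun do rewrite big_cons mulrDl -mulrA.
rewrite meanD; last 2 first.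
- by apply: contZ; apply: holo_circ_continuous; exact: hG.
- exact: (@holo_circ_continuous _ (fun x => \sum_(j <- s) a j * G j x) k IH1).
by rewrite meanZ//; apply: holo_circ_continuous; exact: hG.
Qed.

(** Euler's identity: [k + 1] times the term of degree [k + 1] is the sum of the [z i 0 - p i 0]
    times the terms of degree [k] of the partial derivatives, by [cauchy_coef_deriv]. *)
Lemma pdeg_taylor_coef k f : entire f -> pdeg k (taylor_coef f k).
Proof.
elim: k f => [|k IH] f hf.
  exists (f p); apply/funext => z.
  have [M M0 hM] := entire_ball_bounded (vnorm p + vnorm (z - p)) hf.
  rewrite /taylor_coef (@cauchy_coef0 _ _ M); first by rewrite scale0r addr0.
    exact: line_holo.
  move=> t; apply/ltW/hM; apply: le_trans (vnormD _ _) _.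
  by rewrite vnormZ cmod_circ mul1r.
exists 0, (fun i z => k.+1%:R^-1 * taylor_coef (fun z => 'D_(@ebase R N i) f z) k z); split.
  by move=> i; apply: pdegZ; apply: IH; exact: entire_derive.
apply/funext => z; rewrite add0r.
have k0 : k.+1%:R != 0 :> C by rewrite pnatr_eq0.
apply: (mulfI k0); rewrite /taylor_coef.
have hD i : holo (fun s => 'D_(@ebase R N i) f (p + s *: (z - p))).
  exact: (@line_holo _ _ (fun z => 'D_(@ebase R N i) f z) p (z - p) (entire_derive _ hf)).
have [h1 h2] := cauchy_coef_sum (index_enum 'I_N) k (fun i => (z - p) i 0) hD.
have hh : holo (fun s => 'D_(z - p) f (p + s *: (z - p))).
  exact: (@line_holo _ _ (fun u => 'D_(z - p) f u) p (z - p) (entire_derive _ hf)).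
rewrite (cauchy_coef_deriv k (line_cdif_entire (z - p) p hf) hh).
have E x : 'D_(z - p) f (p + x *: (z - p)) =
    \sum_i (z - p) i 0 * 'D_(@ebase R N i) f (p + x *: (z - p)).
  by rewrite (derive_lin _ (hf (p + x *: (z - p)))).
have {}E := congr1 (fun g : C -> C => cauchy_coef g k) (funext E).
transitivity (\sum_i (z - p) i 0 *
    cauchy_coef (fun s => 'D_(@ebase R N i) f (p + s *: (z - p))) k); first exact: etrans E h2.
rewrite mulr_sumr; apply: eq_bigr => i _.
by rewrite mulrCA mulVKf// !mxE.
Qed.

Lemma poly_dense f r e : entire f -> 0 <= r -> 0 < e -> exists d q, pdeg d q /\
  forall z, vnorm (z - p) <= r -> cmod (f z - q z) < e.
Proof.
(* Dilating by 2 about [p] turns the value of [f] at [z] into the value of [F] at the parameter 1/2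
   of the line from [p] to [z], where Taylor remainders are at most [2 * M * 2^-1 ^+ n], uniformly
   on the ball. *)
move=> hf r0 e0; pose F z := f ((2 : C)%:M *m z - p).
have hF : entire F := entire_affine _ _ hf.
have [M M0 hM] := entire_ball_bounded (vnorm p + r) hF.
have [n hn] : exists n, 2 * M * 2^-1 ^+ n < e.
  have c : (fun n => 2 * M * 2^-1 ^+ n) @ \oo --> 2 * M * (0 : R).
    by apply: cvgMl_tmp; apply: cvg_expr; rewrite ger0_norm// invf_lt1// ltr1n.
  move: c; rewrite mulr0 => /cvgrPdist_lt/(_ _ e0)[n _ /(_ n (leqnn n))].
  rewrite /= sub0r normrN ger0_norm; first by exists n.
  by rewrite !mulr_ge0 ?(ltW M0)// exprn_ge0.
exists n, (fun z => \sum_(k < n) (ofR 2^-1) ^+ k * taylor_coef F k z); split.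
  apply: pdeg_sum => k; apply: pdegZ; apply: pdeg_le (pdeg_taylor_coef k hF).
  by rewrite ltnW.
move=> z zr; pose g s := F (p + s *: (z - p)).
have gM t : cmod (g (circ t)) <= M.
  apply/ltW/hM; apply: le_trans (vnormD _ _) _.
  by rewrite vnormZ cmod_circ mul1r lerD2l.
have hg : holo g by exact: line_holo.
have ct : cmod (ofR (2^-1 : R)) = 2^-1 by rewrite cmod_ofR ger0_norm// invr_ge0.
have t1 : cmod (ofR (2^-1 : R)) < 1 by rewrite ct invf_lt1// ltr1n.
have := taylor_bound t1 n hg gM.
have -> : g (ofR 2^-1) = f z.
  rewrite /g /F mul_scalar_mx scalerDr scalerA (_ : 2 * ofR 2^-1 = 1) ?scale1r.
    congr f; rewrite -[2 : C]/(1 + 1) scalerDl scale1r.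
    by apply/colP => i; rewrite !mxE; ring.
  have -> : (2 : C) = ofR 2 by rewrite /ofR rmorph_nat.
  by rewrite -ofRM divff.
under eq_bigr do rewrite mulrC.
move/le_lt_trans; apply; apply: le_lt_trans hn; rewrite ct.
have -> : 1 - 2^-1 = 2^-1 :> R by lra.
rewrite invrK (_ : M * _ = 2 * M * 2^-1 ^+ n)//.
by move: (2^-1 ^+ n) => x; ring.
Qed.

End polynomials.

(** * The operator and its continuity *)

Section operator.
Variables (R : realType) (N : nat).
Local Notation C := R[i].
Local Notation V := 'cV[C]_N.
Variables (A : 'M[C]_N) (b v : V).

Definition opT (f : entireType R N) : entireType R N :=
  mkEntire (entire_affine A b (entire_derive v (entireP f))).

Lemma opTE f : (opT f : _ -> _) = 'D_v f \o affine A b.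
Proof. by []. Qed.

Lemma opT_linear : linear opT.
Proof.
move=> k f g; apply: entire_ext => z.
rewrite -[RHS]/(k * opT f z + opT g z) /opT /=.
have hf := entireP f; have hg := entireP g.
by rewrite (deriveD_entire _ _ (entireZ k hf) hg) (deriveZ_entire _ _ _ hf).
Qed.

HB.instance Definition _ := GRing.isLinear.Build C (entireType R N) (entireType R N) _ opT opT_linear.

Lemma opT_continuous : continuous opT.
Proof.
move=> f; have FF : Filter (opT x @[x --> f]) by apply: fmap_filter; exact: nbhs_filter.
apply/entire_cvg_ballP => r e r0 e0.
have [a a0 ha] := mulmx_bound A.
(* The ball contains all points within [vnorm v] of the image of the ball of radius [r], as
   [cauchy_estimate] requires; the constant 6 of that estimate explains the 7. *)
apply/entire_nbhs_ballP; exists (a * r + vnorm b + vnorm v), (e / 7); split.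
- by rewrite !addr_ge0 ?mulr_ge0 ?vnorm_ge0.
- by rewrite divr_gt0.
move=> g hg /= z zr.
rewrite -[opT f z - opT g z]/((opT f - opT g) z) -linearB /opT /=.
have : cmod ('D_v (f - g : entireType R N) (A *m z + b)) <= 6 * (e / 7).
  apply: cauchy_estimate; first exact: entireP.
  move=> w hw; apply/ltW/hg.
  rewrite -(subrK (A *m z + b) w) addrC.
  apply: le_trans (vnormD _ _) _; apply: lerD => //.
  apply: le_trans (vnormD _ _) _; rewrite lerD2r.
  by apply: le_trans (ha _) _; rewrite ler_wpM2l.
by move/le_lt_trans; apply; lra.
Qed.

End operator.

(** * Orthogonality and the contraction *)

Section hermitian.
Variables (R : realType) (N : nat).
Local Notation C := R[i].
Local Notation V := 'cV[C]_N.
Implicit Types (u w x y z : V) (s : C) (M : {vspace V}).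

Lemma innerDl u w z : inner (u + w) z = inner u z + inner w z.
Proof. by rewrite /inner -big_split; apply: eq_bigr => i _; rewrite mxE mulrDl. Qed.
Lemma innerZl s u z : inner (s *: u) z = s * inner u z.
Proof. by rewrite /inner mulr_sumr; apply: eq_bigr => i _; rewrite mxE mulrA. Qed.
Lemma inner_conj u w : inner w u = (inner u w)^*.
Proof.
rewrite /inner rmorph_sum; apply: eq_bigr => i _.
by rewrite rmorphM /= conjCK mulrC.
Qed.
Lemma innerDr u w z : inner z (u + w) = inner z u + inner z w.
Proof. by rewrite inner_conj innerDl rmorphD /= -!inner_conj. Qed.
Lemma innerZr s u z : inner z (s *: u) = s^* * inner z u.
Proof. by rewrite inner_conj innerZl rmorphM /= -inner_conj. Qed.
Lemma innerNl u z : inner (- u) z = - inner u z.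
Proof. by rewrite -scaleN1r innerZl mulN1r. Qed.
Lemma innerBl u w z : inner (u - w) z = inner u z - inner w z.
Proof. by rewrite innerDl innerNl. Qed.
Lemma inner0l z : inner 0 z = 0.
Proof. by rewrite -(scale0r 0) innerZl mul0r. Qed.

Definition sqn u : R := \sum_i cmod (u i 0) ^+ 2.

Lemma innerE u : inner u u = ofR (sqn u).
Proof.
rewrite /inner /sqn /ofR rmorph_sum; apply: eq_bigr => i _.
by rewrite -normCK normE -!/(ofR _) expr2 -ofRM -expr2.
Qed.

Lemma sqn_ge0 u : 0 <= sqn u.
Proof. by apply: sumr_ge0 => i _; exact: sqr_ge0. Qed.

Lemma sqn_eq0 u : sqn u = 0 -> u = 0.
Proof.
move=> /eqP; rewrite psumr_eq0 => [/allP h|i _]; last exact: sqr_ge0.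
apply/colP => i; have := h i (mem_index_enum i).
by rewrite /= sqrf_eq0 cmod_eq0 => /eqP ->; rewrite mxE.
Qed.

Lemma inner_eq0 u : inner u u = 0 -> u = 0.
Proof. by rewrite innerE => /ofR_inj/sqn_eq0. Qed.

Lemma enormE u : enorm u = Num.sqrt (sqn u).
Proof. by rewrite /enorm innerE. Qed.

Lemma enorm_ge0 u : 0 <= enorm u. Proof. exact: sqrtr_ge0. Qed.

Lemma enorm_sqr u : enorm u ^+ 2 = sqn u.
Proof. by rewrite enormE sqr_sqrtr// sqn_ge0. Qed.

Lemma enormZ s u : enorm (s *: u) = cmod s * enorm u.
Proof.
have -> : enorm (s *: u) = Num.sqrt (cmod s ^+ 2 * sqn u).
  rewrite enormE /sqn mulr_sumr; congr Num.sqrt; apply: eq_bigr => i _.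
  by rewrite mxE cmodM exprMn.
by rewrite sqrtrM ?sqr_ge0// sqrtr_sqr ger0_norm ?cmod_ge0// enormE.
Qed.

Lemma enorm_eq0 u : enorm u = 0 -> u = 0.
Proof. by move=> e; apply: sqn_eq0; rewrite -enorm_sqr e expr0n. Qed.

Lemma enorm0 : enorm (0 : V) = 0.
Proof. by rewrite -(scale0r 0) enormZ cmod0 mul0r. Qed.

Lemma enorm_gt0 u : u != 0 -> 0 < enorm u.
Proof. by move=> u0; rewrite lt_def enorm_ge0 andbT; apply: contra_neq u0; exact: enorm_eq0. Qed.

Lemma sqn_orth u w : inner u w = 0 -> sqn (u + w) = sqn u + sqn w.
Proof.
move=> uw; apply: ofR_inj; rewrite ofRD -!innerE innerDl !innerDr uw.
by rewrite (inner_conj u w) uw conjC0 addr0 add0r.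
Qed.

Lemma enorm_orth u w : inner u w = 0 -> enorm u <= enorm (u + w).
Proof.
by move=> uw; rewrite !enormE ler_wsqrtr// sqn_orth// lerDl sqn_ge0.
Qed.

Lemma enorm_orthr u w : inner u w = 0 -> enorm w <= enorm (u + w).
Proof.
by move=> uw; rewrite !enormE ler_wsqrtr// sqn_orth// lerDr sqn_ge0.
Qed.

Lemma vnorm_enorm u : vnorm u <= enorm u.
Proof.
apply: vnorm_le => [|i]; first exact: enorm_ge0.
rewrite -(@ler_pXn2r _ 2) ?nnegrE ?cmod_ge0 ?enorm_ge0// enorm_sqr /sqn (bigD1 i)//= lerDl.
by apply: sumr_ge0 => j _; exact: sqr_ge0.
Qed.

Lemma enorm_vnorm u : enorm u <= N%:R * vnorm u.
Proof.
have N0 : 0 <= N%:R * vnorm u by rewrite mulr_ge0 ?vnorm_ge0.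
rewrite -(@ler_pXn2r _ 2) ?nnegrE ?enorm_ge0// enorm_sqr.
apply: (@le_trans _ _ (N%:R * vnorm u ^+ 2)).
  rewrite mulr_natl -[X in _ *+ X]card_ord -sumr_const; apply: ler_sum => i _.
  by rewrite lerXn2r ?nnegrE ?cmod_ge0 ?vnorm_ge0// cmod_vnorm.
rewrite exprMn ler_wpM2r ?sqr_ge0//; case: N => [|n]; first by rewrite expr0n.
by rewrite expr2 ler_peMr// ler1n.
Qed.

(** Gram-Schmidt: the new vector [w] is first made orthogonal to the previous span, then the
    component of [z] along it is removed. *)
Lemma orth_decomp_span (X : seq V) z : exists2 x, x \in <<X>>%VS &
  forall u, u \in <<X>>%VS -> inner (z - x) u = 0.
Proof.
elim: X z => [|w X IH] z.
  exists 0; first by rewrite mem0v.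
  move=> u; rewrite span_nil memv0 => /eqP ->.
  by rewrite inner_conj inner0l conjC0.
have [w0 w0X w0P] := IH w; have [x0 x0X x0P] := IH z.
pose w' := w - w0; pose z' := z - x0.
have sub u : u \in <<X>>%VS -> u \in <<w :: X>>%VS.
  by move=> uX; rewrite span_cons; apply: subvP uX; exact: addvSr.
have [w'0|w'0] := eqVneq w' 0.
  exists x0; first exact: sub.
  have wX : w \in <<X>>%VS by rewrite (subr0_eq w'0).
  move=> u; rewrite span_cons => /memv_addP[u1 /vlineP[k ->] [u2 u2X ->]].
  by apply: x0P; apply: memvD => //; exact: memvZ.
pose al := inner z' w' / inner w' w'.
have ww : inner w' w' != 0 by apply: contra_neq w'0; exact: inner_eq0.
exists (x0 + al *: w').
  apply: memvD; first exact: sub.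
  apply: memvZ; apply: memvB; last exact: sub.
  by rewrite span_cons; apply: subvP (memv_line w); exact: addvSl.
have o u : u \in <<X>>%VS -> inner (z - (x0 + al *: w')) u = 0.
  by move=> uX; rewrite opprD addrA innerBl innerZl (x0P _ uX) (w0P _ uX) mulr0 subrr.
have ow : inner (z - (x0 + al *: w')) w' = 0.
  by rewrite opprD addrA innerBl innerZl -/z' /al divfK// subrr.
move=> u; rewrite span_cons => /memv_addP[u1 /vlineP[k ->] [u2 u2X ->]].
rewrite innerDr (o _ u2X) addr0 innerZr.
by rewrite -(subrK w0 w) -/w' innerDr ow (o _ w0X) addr0 mulr0.
Qed.

Lemma orth_decomp M z : exists x y, [/\ z = x + y, x \in M & orthogonal_complement M y].
Proof.
have [x xM xP] := orth_decomp_span (vbasis M) z.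
rewrite (span_basis (vbasisP M)) in xM xP.
by exists x, (z - x); split => //; rewrite addrC subrK.
Qed.

Section contraction.
Variables (A : 'M[C]_N) (M : {vspace V}).
Hypothesis (Au : A \in unitmx) (MA : reduces M A).
Hypothesis (MN : (operator_norm ((restriction A M)^-1)%VF < 1)%E).

(** The inverse of a linear function is a true inverse only once its kernel is known to vanish; here
    it does because [A] is invertible. *)
Lemma invmx_restriction x : x \in M ->
  invmx A *m x = vsval (((restriction A M)^-1)%VF (vsproj M x)).
Proof.
move=> xM; set f := restriction A M.
have fE (u : subvs_of M) : vsval (f u) = A *m vsval u.
  rewrite /f /restriction lfunE /= vsprojK//; apply: MA.1; exact: subvsP.
have k0 : lker f == 0%VS.
  rewrite -subv0; apply/subvP => u; rewrite memv_ker memv0 => /eqP fu.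
  have e : A *m vsval u = 0 by rewrite -fE fu linear0.
  by apply/eqP; apply: val_inj; rewrite /= -[LHS](mulKmx Au) e mulmx0.
have := fE ((f^-1)%VF (vsproj M x)); rewrite (lker0_lfunVK k0) vsprojK// => e.
by rewrite {1}e mulKmx.
Qed.

Lemma invmx_M x : x \in M -> invmx A *m x \in M.
Proof. by move=> xM; rewrite invmx_restriction// subvsP. Qed.

Lemma inverse_contraction : exists c : R, [/\ 0 <= c, c < 1 &
  forall x, x \in M -> enorm (invmx A *m x) <= c * enorm x].
Proof.
pose g := ((restriction A M)^-1)%VF; pose s := operator_norm g.
have s1 : (s < 1)%E := MN.
have sub (u : subvs_of M) : enorm (vsval u) <= 1 -> ((enorm (vsval (g u)))%:E <= s)%E.
  by move=> u1; apply: ereal_sup_ubound; exists u.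
have s0 : (0 <= s)%E.
  apply: le_trans (sub 0 _); first by rewrite lee_fin enorm_ge0.
  by rewrite linear0 enorm0.
have sf : s \is a fin_num by rewrite ge0_fin_numE// (lt_trans s1)// ltry.
exists (fine s); split; first exact: fine_ge0.
  by rewrite -lte_fin fineK.
move=> x xM; have [->|x0] := eqVneq x 0; first by rewrite mulmx0 enorm0 mulr0.
have e0 := enorm_gt0 x0; pose k : C := ofR (enorm x)^-1.
have ck : cmod k = (enorm x)^-1 by rewrite cmod_ofR ger0_norm// invr_ge0 ltW.
have := sub (vsproj M (k *: x)); rewrite vsprojK; last exact: memvZ.
rewrite -invmx_restriction; last exact: memvZ.
rewrite -scalemxAr !enormZ ck mulVf ?gt_eqF// => /(_ (lexx _)).
rewrite -[s]fineK// lee_fin mulrC ler_pdivrMr//.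
Qed.

(** If the preimage of [y] had a component [x'] in [M], then [A *m x'] would be in [M] and, as
    [y - A *m y'], also orthogonal to [M]; so it is 0. *)
Lemma invmx_orth y : orthogonal_complement M y -> orthogonal_complement M (invmx A *m y).
Proof.
move=> yo; have [x' [y' [e x'M y'o]]] := orth_decomp M (invmx A *m y).
suff x'0 : x' = 0 by rewrite e x'0 add0r.
have Ay' := MA.2 _ y'o; have Ax' := MA.1 _ x'M.
have eA : A *m x' = y - A *m y'.
  by rewrite -(mulKVmx Au y) e mulmxDr [_ - A *m y']addrK.
have : A *m x' = 0.
  by apply: inner_eq0; rewrite {1}eA innerBl (yo _ Ax') (Ay' _ Ax') subrr.
by move/(congr1 (mulmx (invmx A))); rewrite mulKmx// mulmx0.
Qed.

End contraction.

End hermitian.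

Section fast_decay.
Variable R : realType.

(** The factors [8 * q * c ^+ i] are eventually below 1, so their products stop growing and the sum
    of the first ones bounds them all. The rate 1/8 leaves room for coefficients growing like powers
    of 2, since [8^-1 * 2 = 4^-1]. *)
Lemma prod_geometric_decay (c q : R) : 0 <= c -> c < 1 -> 0 <= q ->
  exists2 K, 0 <= K & forall k, \prod_(i < k) (q * c ^+ i) <= K * 8^-1 ^+ k.
Proof.
move=> c0 c1 q0; pose P k := \prod_(i < k) (8 * q * c ^+ i).
have P0 k : 0 <= P k by apply: prodr_ge0 => i _; rewrite !mulr_ge0// exprn_ge0.
have [i0 hi0] : exists i0, 8 * q * c ^+ i0 < 1.
  have l : (fun n => 8 * q * c ^+ n) @ \oo --> 8 * q * (0 : R).
    by apply: cvgMl_tmp; apply: cvg_expr; rewrite ger0_norm.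
  move: l; rewrite mulr0 => /cvgrPdist_lt/(_ _ ltr01)[n _ /(_ n (leqnn n))].
  by rewrite /= sub0r normrN ger0_norm; [exists n|rewrite !mulr_ge0// exprn_ge0].
have dec k : (i0 <= k)%N -> P k.+1 <= P k.
  move=> ik; rewrite /P big_ord_recr /= ler_piMr; [by []|exact: P0|].
  apply: le_trans (ltW hi0); rewrite ler_wpM2l ?mulr_ge0//.
  by apply: ler_wiXn2l => //; exact: ltW.
have bd k : P k <= \sum_(j < i0.+1) P j.
  have [ki|ik] := leqP k i0.
    rewrite (bigD1 (Ordinal (ki : (k < i0.+1)%N)))//= lerDl.
    by apply: sumr_ge0 => j _; exact: P0.
  elim: k ik => [//|k IH]; rewrite ltnS leq_eqVlt => /predU1P[<-|ik].
    apply: le_trans (dec _ (leqnn _)) _; rewrite big_ord_recr /= lerDr.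
    by apply: sumr_ge0 => j _; exact: P0.
  by apply: le_trans (dec _ (ltnW ik)) (IH ik).
exists (\sum_(j < i0.+1) P j) => [|k]; first by apply: sumr_ge0 => j _; exact: P0.
have -> : \prod_(i < k) (q * c ^+ i) = P k * 8^-1 ^+ k.
  rewrite /P -[k in 8^-1 ^+ k]card_ord -prodr_const -big_split /=.
  by apply: eq_bigr => i _; move: (c ^+ i) => x; field.
by rewrite ler_wpM2r// exprn_ge0// invr_ge0.
Qed.

End fast_decay.

(** * Chains of polynomials *)

Section chains.
Variables (R : realType) (N : nat).
Local Notation C := R[i].
Local Notation V := 'cV[C]_N.
Variables (A : 'M[C]_N) (v b p : V) (M : {vspace V}).
Hypothesis (A_invertible : A \in unitmx) (v_neq0 : v != 0).
Hypothesis (p_fixed : affine A b p = p) (v_in_M : v \in M) (M_reduces : reduces M A).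
Hypothesis (M_norm : (operator_norm ((restriction A M)^-1)%VF < 1)%E).
Implicit Types (f g q Q u : V -> C) (z w x y : V) (d k j : nat) (s : seq 'I_N).

Definition pdegP f := exists d, pdeg p d f.

Lemma pdegP_entire f : pdegP f -> entire f.
Proof. by move=> [d]; exact: pdeg_entire. Qed.

Lemma affineE z : affine A b z = p + A *m (z - p).
Proof.
rewrite mulmxBr -{1}p_fixed /affine; apply/colP => i; rewrite !mxE; ring.
Qed.

Definition invaff z : V := p + invmx A *m (z - p).

Lemma addpK w : p + w - p = w.
Proof. by rewrite addrC addKr. Qed.

Lemma affineK z : invaff (affine A b z) = z.
Proof. by rewrite /invaff affineE addpK mulKmx// addrC subrK. Qed.

Lemma invaffK z : affine A b (invaff z) = z.
Proof. by rewrite affineE /invaff addpK mulKVmx// addrC subrK. Qed.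

Lemma inner_vv : inner v v != 0.
Proof. by apply: contra_neq v_neq0; exact: inner_eq0. Qed.

(** [ell] and [proj] split [z] into a coordinate along [v] and a point of the hyperplane
    [p + v^perp], on which the primitives below are made to vanish. *)
Definition ell z : C := inner (z - p) v / inner v v.
Definition proj z : V := z - ell z *: v.

Lemma ellD z (t : C) : ell (z + t *: v) = ell z + t.
Proof.
have e : z + t *: v - p = (z - p) + t *: v by rewrite addrAC.
by rewrite /ell e (innerDl (z - p)) innerZl mulrDl mulfK// inner_vv.
Qed.

Lemma ell_proj z : ell (proj z) = 0.
Proof. by rewrite /proj -scaleNr ellD subrr. Qed.

Lemma projD z (t : C) : proj (z + t *: v) = proj z.
Proof. by rewrite /proj ellD scalerDl opprD addrACA subrr addr0. Qed.

Lemma pdeg_ell : pdeg p 1 ell.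
Proof.
exists 0, (fun i _ => (v i 0)^* / inner v v); split => [i|]; first by exists ((v i 0)^* / inner v v).
apply/funext => z; rewrite add0r /ell /inner mulr_suml; apply: eq_bigr => i _.
by rewrite !mxE mulrA.
Qed.

Lemma ell_entire : entire ell.
Proof. exact: (pdeg_entire pdeg_ell). Qed.

Lemma derive_ell z : 'D_v ell z = 1.
Proof.
apply: derive_cdif; first exact: ell_entire.
rewrite (_ : (fun _ => _) = fun t => ell z + t); last by apply/funext => t; exact: ellD.
by rewrite -[1]add0r; apply: cdifD; [exact: cdif_cst|exact: cdif_id].
Qed.

Lemma pdeg_ellX m : pdeg p m (fun z => ell z ^+ m).
Proof.
elim: m => [|m IH]; first exact: pdeg_cst.
rewrite (_ : (fun _ => _) = fun z => ell z * ell z ^+ m); last by apply/funext => z; rewrite exprS.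
by rewrite -add1n; exact: pdegM pdeg_ell IH.
Qed.

Lemma derive_ellX m z : 'D_v (fun z => ell z ^+ m.+1) z = m.+1%:R * ell z ^+ m.
Proof.
have E k := pdeg_entire (pdeg_ellX k).
elim: m => [|m IH].
  rewrite (_ : (fun _ => _) = ell) ?derive_ell ?mul1r//.
rewrite (_ : (fun _ => _) = fun z => ell z * ell z ^+ m.+1); last by apply/funext => w; rewrite exprS.
rewrite deriveM_entire; [|exact: ell_entire|exact: E].
by rewrite derive_ell IH mul1r -[m.+2%:R]natr1 !exprS; ring.
Qed.

(** Each coordinate [z i 0 - p i 0] is [r i z + v i 0 * ell z] with [r i] constant along [v]. The
    first summand passes through the integration and the second raises the power of [ell]; hence the
    induction carries an arbitrary power [m]. *)
Lemma primitive d f : pdeg p d f -> forall m, exists Q, [/\ pdegP Q,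
  forall z, 'D_v Q z = ell z ^+ m * f z & forall z, ell z = 0 -> Q z = 0].
Proof.
have cst m (c : C) : exists Q, [/\ pdegP Q,
  forall z, 'D_v Q z = ell z ^+ m * c & forall z, ell z = 0 -> Q z = 0].
  exists (fun z => c / m.+1%:R * ell z ^+ m.+1); split.
  - by exists m.+1; apply: pdegZ; exact: pdeg_ellX.
  - move=> z; rewrite deriveZ_entire; last exact: (pdeg_entire (pdeg_ellX _)).
    by rewrite derive_ellX mulrA divfK 1?mulrC// pnatr_eq0.
  - by move=> z ->; rewrite expr0n mulr0.
elim: d f => [|d IH] f; first by move=> [c ->] m; exact: cst.
move=> [c [g [hg ->]]] m.
have [Qc [[dc hc] Dc Zc]] := cst m c.
have /choice[Q1 hQ1] : forall i, exists Q, [/\ pdegP Q,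
  forall z, 'D_v Q z = ell z ^+ m * g i z & forall z, ell z = 0 -> Q z = 0].
  by move=> i; exact: (IH _ (hg i) m).
have /choice[Q2 hQ2] : forall i, exists Q, [/\ pdegP Q,
  forall z, 'D_v Q z = ell z ^+ m.+1 * g i z & forall z, ell z = 0 -> Q z = 0].
  by move=> i; exact: (IH _ (hg i) m.+1).
have /choice[d1 hd1] : forall i, exists d, pdeg p d (Q1 i) by move=> i; have [] := hQ1 i.
have /choice[d2 hd2] : forall i, exists d, pdeg p d (Q2 i) by move=> i; have [] := hQ2 i.
pose r i z := (z i 0 - p i 0) - v i 0 * ell z.
have rd i : pdeg p 1 (r i).
  rewrite (_ : r i = fun z => (z i 0 - p i 0) * 1 + - v i 0 * ell z); last first.
    by apply/funext => z; rewrite mulr1 mulNr.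
  apply: pdegD; last by apply: pdegZ; exact: pdeg_ell.
  by apply: pdegX; exact: pdeg_cst.
have rD i z : 'D_v (r i) z = 0.
  apply: derive_cdif; first exact: (pdeg_entire (rd i)).
  rewrite (_ : (fun _ => _) = fun=> r i z); first exact: cdif_cst.
  by apply/funext => t; rewrite /r ellD !mxE; ring.
pose G i z := r i z * Q1 i z + v i 0 * Q2 i z.
have EQ1 i : entire (Q1 i) := pdeg_entire (hd1 i).
have EQ2 i : entire (Q2 i) := pdeg_entire (hd2 i).
have Er i : entire (r i) := pdeg_entire (rd i).
have dG i : pdeg p (1 + d1 i + d2 i) (G i).
  apply: pdegD; first by apply: pdeg_le (pdegM (rd i) (hd1 i)); rewrite leq_addr.
  by apply: pdegZ; apply: pdeg_le (hd2 i); rewrite leq_addl.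
have EG i : entire (G i) := pdeg_entire (dG i).
exists (fun z => Qc z + \sum_i G i z); split.
- exists (dc + \max_i (1 + d1 i + d2 i)); apply: pdegD.
    by apply: pdeg_le hc; rewrite leq_addr.
  apply: pdeg_sum => i; apply: pdeg_le (dG i).
  by apply: leq_trans (leq_addl _ _); exact: (leq_bigmax (F := fun i => 1 + d1 i + d2 i)%N).
- move=> z; rewrite deriveD_entire; [|exact: (pdeg_entire hc)|exact: entire_sum].
  rewrite derive_sum_entire// Dc mulrDr mulr_sumr; congr (_ + _); apply: eq_bigr => i _.
  have [_ D1 _] := hQ1 i; have [_ D2 _] := hQ2 i.
  have E1 : entire (fun z => r i z * Q1 i z).
    by move=> w; apply: differentiableM; [exact: Er|exact: EQ1].
  rewrite /G (deriveD_entire _ _ E1 (entireZ (v i 0) (EQ2 i))).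
  rewrite (deriveM_entire _ _ (Er i) (EQ1 i)) (deriveZ_entire _ _ _ (EQ2 i)) rD D1 D2.
  by rewrite /r exprS; ring.
- move=> z z0; rewrite (Zc _ z0) add0r big1// => i _.
  have [_ _ Z1] := hQ1 i; have [_ _ Z2] := hQ2 i.
  by rewrite /G (Z1 _ z0) (Z2 _ z0) !mulr0 addr0.
Qed.

Definition funT f z : C := 'D_v f (affine A b z).

Lemma preimage q : pdegP q -> exists Q, [/\ pdegP Q, forall z, funT Q z = q z &
  forall z, ell z = 0 -> Q z = 0].
Proof.
move=> [d hq]; have hq' := pdeg_comp (invmx A) hq.
have [Q [h1 h2 h3]] := primitive hq' 0.
exists Q; split => // z.
by rewrite /funT h2 expr0 mul1r -/(invaff (affine A b z)) affineK.
Qed.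

(** A single map defined on all functions, and specified only on polynomials, can be iterated to
    build the chains. *)
Lemma rightinv_exists : exists F : (V -> C) -> (V -> C), forall q, pdegP q ->
  [/\ pdegP (F q), forall z, funT (F q) z = q z & forall z, ell z = 0 -> F q z = 0].
Proof.
have H q : exists Q, pdegP q -> [/\ pdegP Q, forall z, funT Q z = q z &
    forall z, ell z = 0 -> Q z = 0].
  have [/preimage[Q hQ]|nq] := pselect (pdegP q); first by exists Q.
  by exists q.
by have [F hF] := choice H; exists F.
Qed.

Definition rightinv : (V -> C) -> (V -> C) := sval (cid rightinv_exists).

Lemma rightinvP q : pdegP q ->
  [/\ pdegP (rightinv q), forall z, funT (rightinv q) z = q z & forall z, ell z = 0 -> rightinv q z = 0].
Proof. exact: (svalP (cid rightinv_exists)). Qed.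

Definition mono s z : C := \prod_(i <- s) (z i 0 - p i 0).

Lemma pdeg_mono s : pdeg p (size s) (mono s).
Proof.
elim: s => [|i s IH].
  by exists 1; apply/funext => z; rewrite /mono big_nil.
rewrite (_ : mono _ = fun z => (z i 0 - p i 0) * mono s z); first exact: pdegX.
by apply/funext => z; rewrite /mono big_cons.
Qed.

Lemma projE z : proj z = p + (1%:M - v *m (\row_i ((v i 0)^* / inner v v))) *m (z - p).
Proof.
rewrite mulmxBl mul1mx -mulmxA [_ *m (z - p)]mx11_scalar mul_mx_scalar.
rewrite addrA [p + _]addrC subrK /proj; congr (_ - _ *: _).
rewrite mxE /ell /inner mulr_suml; apply: eq_bigr => i _.
by rewrite !mxE [RHS]mulrC mulrA.
Qed.

Lemma pdeg_proj d f : pdeg p d f -> pdeg p d (fun z => f (proj z)).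
Proof.
move=> hf; rewrite (_ : (fun _ => _) = fun z =>
  f (p + (1%:M - v *m (\row_i ((v i 0)^* / inner v v))) *m (z - p))).
  exact: pdeg_comp.
by apply/funext => z; rewrite projE.
Qed.

(* The words in the coordinates are enumerated by [pickle]; T kills [root_poly j]
   since it only depends on the projection orthogonal to v. *)
Definition word j : seq 'I_N := odflt [::] (unpickle j).

Definition root_poly j z : C := mono (word j) (proj z).

Definition chain_fun j k : V -> C := iter k rightinv (root_poly j).

Lemma pdegP_root j : pdegP (root_poly j).
Proof. by exists (size (word j)); apply: pdeg_proj; exact: pdeg_mono. Qed.

Lemma pdegP_chain j k : pdegP (chain_fun j k).
Proof. by elim: k => [|k IH]; [exact: pdegP_root|have [] := rightinvP IH]. Qed.

Definition chain j k : entireType R N := mkEntire (pdegP_entire (pdegP_chain j k)).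

Lemma opT_chain0 j : opT A b v (chain j 0) = 0.
Proof.
apply: entire_ext => z; rewrite opTE /=.
apply: derive_cdif; first exact: (pdegP_entire (pdegP_root j)).
rewrite (_ : (fun _ => _) = fun=> root_poly j (affine A b z)); first exact: cdif_cst.
by apply/funext => t; rewrite /chain_fun /= /root_poly projD.
Qed.

Lemma opT_chainS j k : opT A b v (chain j k.+1) = chain j k.
Proof.
apply: entire_ext => z; rewrite opTE /=.
by have [_ h _] := rightinvP (pdegP_chain j k); exact: h.
Qed.

Lemma funTD f g : entire f -> entire g ->
  funT (fun z => f z + g z) = fun z => funT f z + funT g z.
Proof. by move=> hf hg; apply/funext => z; exact: deriveD_entire. Qed.

Lemma funTZ (c : C) f : entire f -> funT (fun z => c * f z) = fun z => c * funT f z.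
Proof. by move=> hf; apply/funext => z; exact: deriveZ_entire. Qed.

Lemma pdeg_funT d f : pdeg p d.+1 f -> pdeg p d (funT f).
Proof.
move=> hf.
have -> : funT f = fun z => 'D_v f (p + A *m (z - p)).
  by apply/funext => z; rewrite /funT affineE.
exact: (@pdeg_comp _ _ p A d (fun z => 'D_v f z) (pdeg_derive v hf)).
Qed.

Lemma funT_cst (c : C) : funT (fun=> c) = fun=> 0.
Proof. by apply/funext => z; exact: derive_cst_entire. Qed.

Lemma pdegP_funT f : pdegP f -> pdegP (funT f).
Proof. by move=> [d hf]; exists d; apply: pdeg_funT; exact: pdegS. Qed.

Lemma pdegP_iterT n f : pdegP f -> pdegP (iter n funT f).
Proof. by move=> hf; elim: n => [//|n IH]; exact: pdegP_funT. Qed.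

Lemma pdegPD f g : pdegP f -> pdegP g -> pdegP (fun z => f z + g z).
Proof.
move=> [d hf] [d' hg]; exists (d + d')%N; apply: pdegD.
  by apply: pdeg_le hf; rewrite leq_addr.
by apply: pdeg_le hg; rewrite leq_addl.
Qed.

Lemma pdegPZ (c : C) f : pdegP f -> pdegP (fun z => c * f z).
Proof. by move=> [d hf]; exists d; exact: pdegZ. Qed.

Lemma iterTD n f g : pdegP f -> pdegP g ->
  iter n funT (fun z => f z + g z) = fun z => iter n funT f z + iter n funT g z.
Proof.
move=> hf hg; elim: n => [//|n IH]; rewrite iterS IH funTD//.
  by apply: pdegP_entire; exact: pdegP_iterT.
by apply: pdegP_entire; exact: pdegP_iterT.
Qed.

Lemma iterTZ n (c : C) f : pdegP f ->
  iter n funT (fun z => c * f z) = fun z => c * iter n funT f z.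
Proof.
move=> hf; elim: n => [//|n IH]; rewrite iterS IH funTZ//.
by apply: pdegP_entire; exact: pdegP_iterT.
Qed.

Lemma iterT_nilpotent d f : pdeg p d f -> iter d.+1 funT f = fun=> 0.
Proof.
elim: d f => [|d IH] f; first by move=> [c ->]; exact: funT_cst.
by move=> /pdeg_funT/IH; rewrite -iterSr.
Qed.

(** [closedD] and [closedZ] let a predicate play the part of a linear subspace: that a family spans
    is expressed by saying that every such predicate holding on the family holds everywhere. *)
Definition closedD (W : (V -> C) -> Prop) :=
  forall f g, W f -> W g -> W (fun z => f z + g z).
Definition closedZ (W : (V -> C) -> Prop) := forall (c : C) f, W f -> W (fun z => c * f z).

(** The induction on the degree carries a monomial [mono s] in front of [f]: each level of the
    Horner form moves one coordinate into the word [s]. *)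
Lemma span_root (W : (V -> C) -> Prop) : closedD W -> closedZ W ->
  (forall j, W (root_poly j)) -> forall d f, pdeg p d f -> W (fun z => f (proj z)).
Proof.
move=> WD WZ Wr.
have Wm s : W (fun z => mono s (proj z)).
  by have := Wr (pickle s); rewrite /root_poly /word pickleK.
have W0 : W (fun=> 0).
  by have := WZ 0 _ (Wm [::]); congr W; apply/funext => z; rewrite mul0r.
have Wsum (G : 'I_N -> V -> C) : (forall i, W (G i)) -> W (fun z => \sum_i G i z).
  move=> hG; elim: (index_enum _) => [|i r IH].
    by under eq_fun do rewrite big_nil.
  by under eq_fun do rewrite big_cons; exact: WD.
suff H d f s : pdeg p d f -> W (fun z => mono s (proj z) * f (proj z)).
  move=> d f /(H d f [::]); congr W; apply/funext => z.
  by rewrite /mono big_nil mul1r.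
elim: d f s => [|d IH] f s.
  move=> [c ->]; have := WZ c _ (Wm s); congr W; apply/funext => z.
  by rewrite mulrC.
move=> [c [g [hg ->]]].
have h1 := WZ c _ (Wm s).
have h2 : W (fun z => \sum_i mono (rcons s i) (proj z) * g i (proj z)).
  by apply: Wsum => i; apply: IH; exact: hg.
have := WD _ _ h1 h2; congr W; apply/funext => z.
rewrite mulrDr [c * _]mulrC; congr (_ + _); rewrite mulr_sumr; apply: eq_bigr => i _.
by rewrite /mono big_rcons /= mulrA.
Qed.

(** The affine map is onto, so the derivative of [f] along [v] vanishes everywhere and [f] is
    constant on the segment from [proj z] to [z]. *)
Lemma funT_eq0_proj f : entire f -> funT f = (fun=> 0) -> forall z, f z = f (proj z).
Proof.
move=> hf f0 z; have D0 w : 'D_v f w = 0.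
  by rewrite -(invaffK w); exact: (congr1 (fun g => g (invaff w)) f0).
have D t : cder (fun t => f (proj z + (ell z * ofR t) *: v)) t 0.
  have d1 : cder (fun t => ell z * ofR t) t (ell z * 1) by apply: cderZ; exact: cder_ofR.
  have := cder_comp d1 (line_cdif_entire v (proj z) hf (ell z * ofR t)).
  by rewrite D0 mul0r.
have e1 : f (proj z + (ell z * ofR 1) *: v) = f z by rewrite ofR1 mulr1 /proj subrK.
have e0 : f (proj z + (ell z * ofR 0) *: v) = f (proj z) by rewrite ofR0 mulr0 scale0r addr0.
apply/eqP; rewrite -subr_eq0 -e1 -e0; apply/eqP/eq0_small => e epos.
apply: le_trans (ltW epos); rewrite -[leRHS](mul0r `|1 - 0|).
apply: (@cder_between_bound _ (fun t => f (proj z + (ell z * ofR t) *: v)) (fun=> 0)) => t _.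
  exact: D.
by rewrite cmod0.
Qed.

(** If [n + 1] iterates of T kill [f], the [n]-th one lies in the kernel of T and is a combination
    of root polynomials. The same combination of chain elements of rank [n] has the same image under
    the [n]-th iterate; subtracting it lowers the order of nilpotency. *)
Lemma span_chain (W : (V -> C) -> Prop) : closedD W -> closedZ W ->
  (forall j k, W (chain_fun j k)) -> forall d f, pdeg p d f -> W f.
Proof.
move=> WD WZ Wc.
have iterK n j : iter n funT (chain_fun j n) = root_poly j.
  elim: n => [//|n IH]; rewrite iterSr -[RHS]IH; congr (iter n funT).
  by apply/funext => z; have [_ h _] := rightinvP (pdegP_chain j n); exact: h.
have ker n g : pdegP g -> funT g = (fun=> 0) ->
    exists h, [/\ W h, pdegP h & iter n funT h = g].
  move=> [d hg] g0.
  have := @span_root (fun g => exists h, [/\ W h, pdegP h & iter n funT h = g]) _ _ _ d g hg.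
  rewrite -(funext (funT_eq0_proj (pdeg_entire hg) g0)); apply.
  - move=> f1 f2 [h1 [W1 P1 <-]] [h2 [W2 P2 <-]]; exists (fun z => h1 z + h2 z).
    by split; [exact: WD|exact: pdegPD|exact: iterTD].
  - move=> c f1 [h1 [W1 P1 <-]]; exists (fun z => c * h1 z).
    by split; [exact: WZ|exact: pdegPZ|exact: iterTZ].
  - by move=> j; exists (chain_fun j n); split; [exact: Wc|exact: pdegP_chain|exact: iterK].
have main n f : pdegP f -> iter n funT f = (fun=> 0) -> W f.
  elim: n f => [|n IH] f hf.
    move=> /= ->; have := WZ 0 _ (Wc 0%N 0%N); congr W; apply/funext => z.
    by rewrite mul0r.
  rewrite iterS => f0.
  have [h [Wh Ph hE]] := ker n _ (pdegP_iterT n hf) f0.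
  have Wd : W (fun z => f z + -1 * h z).
    apply: IH; first by apply: pdegPD => //; exact: pdegPZ.
    rewrite iterTD//; last exact: pdegPZ.
    by rewrite iterTZ// hE; apply/funext => z; rewrite mulN1r subrr.
  have := WD _ _ Wd Wh; congr W; apply/funext => z.
  by rewrite mulN1r subrK.
by move=> d f hf; apply: (main d.+1); [exists d|exact: iterT_nilpotent].
Qed.

(** The radii in [M] and in its complement are separate because [A^-1] shrinks the first and may
    enlarge the second. *)
Definition bibox (rho sig : R) : set V := [set z | exists x y,
  [/\ z = p + (x + y), x \in M, orthogonal_complement M y, enorm x <= rho & enorm y <= sig]].

(* One integration along v costs a factor rho / |v|, and evaluates q on a set
   whose size in the direction of M is smaller by the factor c. *)
Lemma rightinv_bound (c a : R) q (rho sig B : R) : 0 <= a ->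
  (forall x, x \in M -> enorm (invmx A *m x) <= c * enorm x) ->
  (forall y, enorm (invmx A *m y) <= a * enorm y) -> 0 <= c ->
  pdegP q -> (forall w, bibox (c * rho) (a * sig) w -> cmod (q w) <= B) ->
  forall z, bibox rho sig z -> cmod (rightinv q z) <= rho / enorm v * B.
Proof.
move=> a0 hc ha c0 hq hB z [x [y [zE xM yo xr ys]]].
have [Pl Tl Zl] := rightinvP hq; have El := pdegP_entire Pl.
have nv := enorm_gt0 v_neq0.
have yv : inner y v = 0 by exact: yo.
have lE : ell z = inner x v / inner v v.
  by rewrite /ell zE addrC addKr innerDl yv addr0.
have orth (t : C) : inner (x - ell z *: v) (t *: v) = 0.
  by rewrite innerZr innerBl innerZl lE divfK ?inner_vv// subrr mulr0.
have lx : cmod (ell z) * enorm v <= enorm x.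
  by rewrite -enormZ -[X in _ <= enorm X](subrK (ell z *: v) x); apply: enorm_orthr; exact: orth.
have r0 : 0 <= rho := le_trans (enorm_ge0 _) xr.
have lr : cmod (ell z) <= rho / enorm v by rewrite ler_pdivlMr// (le_trans lx).
pose U t := rightinv q (proj z + (ell z * ofR t) *: v).
have Dl w : 'D_v (rightinv q) w = q (invaff w).
  by rewrite -Tl /funT invaffK.
have U1 : U 1 = rightinv q z by rewrite /U ofR1 mulr1 /proj subrK.
have U0 : U 0 = 0 by rewrite /U ofR0 mulr0 scale0r addr0 Zl// ell_proj.
have B0 : 0 <= B.
  apply: le_trans (cmod_ge0 (q p)) (hB _ _); exists 0, 0; split.
  - by rewrite !addr0.
  - exact: mem0v.
  - by move=> u _; rewrite inner0l.
  - by rewrite enorm0 mulr_ge0.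
  - by rewrite enorm0 mulr_ge0// (le_trans (enorm_ge0 y)).
rewrite -U1 -[U 1]subr0 -U0.
apply: (@le_trans _ _ (cmod (ell z) * B * `|1 - 0|)); last first.
  by rewrite subr0 normr1 mulr1 ler_wpM2r.
apply: (@cder_between_bound _ U (fun t => q (invaff (proj z + (ell z * ofR t) *: v)) * ell z)).
  move=> t _; rewrite -Dl -[X in _ * X]mulr1.
  apply: (cder_comp _ (line_cdif_entire v (proj z) El (ell z * ofR t))).
  by apply: cderZ; exact: cder_ofR.
move=> t /betweenP[|]/andP[t0 t1]; last by lra.
rewrite cmodM mulrC ler_wpM2l ?cmod_ge0//; apply: hB.
exists (invmx A *m (x - ell z *: v + (ell z * ofR t) *: v)), (invmx A *m y).
have xt : enorm (x - ell z *: v + (ell z * ofR t) *: v) <= enorm x.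
  rewrite -(@ler_pXn2r _ 2) ?nnegrE ?enorm_ge0// !enorm_sqr (sqn_orth (orth _)).
  rewrite -[X in _ <= sqn X](subrK (ell z *: v)) (sqn_orth (orth (ell z))) lerD2l -!enorm_sqr.
  rewrite !enormZ cmodM cmod_ofR ger0_norm// lerXn2r ?nnegrE ?mulr_ge0 ?cmod_ge0 ?enorm_ge0//.
  by rewrite ler_wpM2r ?enorm_ge0// ler_piMr ?cmod_ge0.
have xtM : x - ell z *: v + (ell z * ofR t) *: v \in M.
  by apply: memvD; [apply: memvB => //|]; exact: memvZ.
split.
- rewrite -mulmxDr /invaff; congr (p + _ *m _).
  by rewrite /proj {1}zE; apply/colP => i; rewrite !mxE; ring.
- exact: invmx_M.
- exact: invmx_orth.
- by apply: le_trans (hc _ xtM) _; rewrite ler_wpM2l// (le_trans xt).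
- by apply: le_trans (ha y) _; rewrite ler_wpM2l.
Qed.

Lemma chain_bound j r : exists2 K, 0 <= K & forall k z, vnorm z <= r ->
  cmod (chain j k z) <= K * 8^-1 ^+ k.
Proof.
have [c [c0 c1 hc]] := inverse_contraction A_invertible M_reduces M_norm.
have [a0' a00 ha0] := mulmx_bound (invmx A).
(* The factor [N%:R] converts the bound on the sup norm into one on the Euclidean norm. The summand
   1 ensures [1 <= a ^+ k], so that [a ^+ k] can be factored out of [1 + rho + a ^+ k * rho]. *)
pose a := 1 + N%:R * a0'; have a1 : 1 <= a by rewrite lerDl mulr_ge0.
have a0 : 0 <= a by rewrite (le_trans _ a1).
have ha y : enorm (invmx A *m y) <= a * enorm y.
  apply: le_trans (enorm_vnorm _) _.
  apply: (@le_trans _ _ (N%:R * (a0' * enorm y))).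
    by rewrite ler_wpM2l//; apply: le_trans (ha0 y) _; rewrite ler_wpM2l// vnorm_enorm.
  by rewrite mulrA ler_wpM2r ?enorm_ge0// lerDr.
have nv := enorm_gt0 v_neq0.
have [d hd] := pdegP_root j.
have [K K0 hK] := pdeg_growth hd.
(* Each integration applies the bound of the previous rank with radii [c * rho] and [a * sig], so
   the induction must hold for all radii. *)
have bound k rho sig : 0 <= rho -> 0 <= sig -> forall z, bibox rho sig z ->
    cmod (chain_fun j k z) <= \prod_(i < k) (c ^+ i * rho / enorm v) *
      (K * (1 + rho + a ^+ k * sig) ^+ d).
  elim: k rho sig => [|k IH] rho sig r0 s0 z zB.
    rewrite big_ord0 mul1r expr0 mul1r; apply: le_trans (hK z) _.
    rewrite ler_wpM2l// lerXn2r ?nnegrE ?addr_ge0 ?vnorm_ge0// -addrA lerD2l.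
    have [x [y [-> _ _ xr ys]]] := zB; rewrite addpK.
    apply: le_trans (vnormD _ _) _; apply: lerD.
      exact: le_trans (vnorm_enorm _) xr.
    exact: le_trans (vnorm_enorm _) ys.
  have := @rightinv_bound c a (chain_fun j k) rho sig _ a0 hc ha c0 (pdegP_chain j k)
     (IH (c * rho) (a * sig) (mulr_ge0 c0 r0) (mulr_ge0 a0 s0)) z zB.
  move/le_trans; apply; rewrite mulrA; apply: ler_pM.
  - by rewrite mulr_ge0 ?divr_ge0 ?(ltW nv)// prodr_ge0// => i _; rewrite divr_ge0 ?mulr_ge0 ?exprn_ge0// ltW.
  - by rewrite mulr_ge0// exprn_ge0// !addr_ge0 ?mulr_ge0// exprn_ge0.
  - rewrite big_ord_recl /= expr0 mul1r ler_wpM2l ?divr_ge0 ?(ltW nv)//.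
    by apply: ler_prod => i _; rewrite divr_ge0 ?mulr_ge0 ?exprn_ge0 ?(ltW nv)//= exprSr -!mulrA lexx.
  - rewrite ler_wpM2l// lerXn2r ?nnegrE ?addr_ge0 ?mulr_ge0 ?exprn_ge0//.
    by rewrite exprSr -mulrA lerD2r lerD2l ler_piMl// ltW.
pose rho := N%:R * (`|r| + vnorm p); have rho0 : 0 <= rho by rewrite mulr_ge0// addr_ge0// vnorm_ge0.
(* The expansion in the complement of [M] costs [a ^+ k] to the power [d]; it is spread as one
   factor [a ^+ d] over each of the [k] integrations. *)
have [K2 K20 hK2] := prod_geometric_decay c0 c1 (q := a ^+ d * rho / enorm v)
  (divr_ge0 (mulr_ge0 (exprn_ge0 d a0) rho0) (ltW nv)).
exists (K2 * (K * (1 + rho + rho) ^+ d)).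
  by rewrite !mulr_ge0// exprn_ge0// !addr_ge0.
move=> k z zr; have zB : bibox rho rho z.
  have [x [y [e xM yo]]] := orth_decomp M (z - p).
  have xy : inner x y = 0 by rewrite inner_conj yo// conjC0.
  have zpr : enorm (z - p) <= rho.
    apply: le_trans (enorm_vnorm _) _; rewrite ler_wpM2l//.
    apply: le_trans (vnormD _ _) _; rewrite vnormN lerD2r.
    by apply: le_trans zr _; exact: ler_norm.
  exists x, y; split => //.
  - by rewrite -e addrC subrK.
  - by apply: le_trans zpr; rewrite e; exact: enorm_orth.
  - by apply: le_trans zpr; rewrite e; exact: enorm_orthr.
apply: le_trans (bound k rho rho rho0 rho0 z zB) _.
rewrite mulrAC; apply: (@le_trans _ _ ((\prod_(i < k) (a ^+ d * rho / enorm v * c ^+ i)) *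
   (K * (1 + rho + rho) ^+ d))); last first.
  by rewrite ler_wpM2r ?hK2// mulr_ge0// exprn_ge0// !addr_ge0.
clearbody rho.
have ak1 : 1 <= a ^+ k by rewrite exprn_ege1.
apply: (@le_trans _ _ (\prod_(i < k) (c ^+ i * rho / enorm v) *
    (K * ((a ^+ k) ^+ d * (1 + rho + rho) ^+ d)))).
  have P0 : 0 <= \prod_(i < k) (c ^+ i * rho / enorm v).
    by apply: prodr_ge0 => i _; rewrite divr_ge0 ?enorm_ge0// mulr_ge0// exprn_ge0.
  have h : 0 <= (a ^+ k - 1) * (1 + rho) by rewrite mulr_ge0 ?subr_ge0 ?addr_ge0.
  have h2 : 0 <= a ^+ k * rho by rewrite mulr_ge0// (le_trans _ ak1).
  rewrite (ler_wpM2l P0)// ler_wpM2l// -exprMn lerXn2r ?nnegrE//; first by lra.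
    by rewrite mulr_ge0 ?(le_trans _ ak1)//; lra.
  by lra.
have -> : \prod_(i < k) (a ^+ d * rho / enorm v * c ^+ i) =
    \prod_(i < k) (c ^+ i * rho / enorm v) * (a ^+ k) ^+ d.
  rewrite exprAC -[k in (a ^+ d) ^+ k]card_ord -prodr_const -big_split /=.
  by apply: eq_bigr => i _; move: (c ^+ i) (a ^+ d) (enorm v)^-1 => *; ring.
move: (\prod_(i < k) _) ((a ^+ k) ^+ d) ((1 + rho + rho) ^+ d) => x1 x2 x3.
by rewrite le_eqVlt (_ : x1 * (K * (x2 * x3)) = x1 * x2 * (K * x3)) ?eqxx//; ring.
Qed.

End chains.

(** * Coin tossing *)

Definition bits := nat -> bool.
HB.instance Definition _ := Pointed.copy bits (nat -> bool).

Definition cylinder (n : nat) (w : bits) : set bits :=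
  [set o | forall i, (i < n)%N -> o i = w i].

Definition cylinders : set (set bits) :=
  [set A | A = set0 \/ exists n w, A = cylinder n w].

Lemma cylinders_setI : setI_closed cylinders.
Proof.
move=> A B [->|[n [w ->]]]; first by left; rewrite set0I.
move=> [->|[m [w' ->]]]; first by left; rewrite setI0.
have [[i [im iN e]]|/forallNP h] := pselect (exists i, [/\ (i < m)%N, (i < n)%N & w i <> w' i]).
  left; apply/seteqP; split=> // o [/= h1 h2]; apply: e.
  by rewrite -h1// h2.
right; exists (maxn n m), (fun i => if (i < n)%N then w i else w' i).
apply/seteqP; split=> o /=.
  move=> [h1 h2] i; rewrite leq_max => /orP[iN|im]; first by rewrite iN h1.
  by case: ifPn => iN; [rewrite h1|rewrite h2].
move=> ho; split=> i ii.
  by rewrite ho ?ii// leq_max ii.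
rewrite ho; last by rewrite leq_max ii orbT.
case: ifPn => // iN; have := h i => /not_and3P[]//.
by move=> /contrapT.
Qed.

Lemma cylinder0 w : cylinder 0 w = setT.
Proof. by apply/seteqP; split. Qed.

Lemma cylindersT : cylinders setT.
Proof. by right; exists 0%N, (fun=> false); rewrite cylinder0. Qed.

Definition cantorT := g_sigma_algebraType cylinders.
HB.instance Definition _ := Measurable.on cantorT.

Lemma measurable_cylinder n w : measurable (cylinder n w : set cantorT).
Proof. by apply: sub_sigma_algebra; right; exists n, w. Qed.

Definition mfun_of d d' (T : measurableType d) (T' : measurableType d') (f : T -> T')
  (mf : measurable_fun setT f) : {mfun T >-> T'} := mfun_Sub (mem_set mf).

(** * Independence from generating families stable under intersection *)

Section independence_half.
Context d d1 d2 (T : measurableType d) (T1 : measurableType d1) (T2 : measurableType d2)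
  (R : realType).
Variables (P : probability T R) (X : T -> T1) (Y : T -> T2).
Hypotheses (mX : measurable_fun setT X) (mY : measurable_fun setT Y).
Variables (G1 : set (set T1)).
Hypotheses (gG1 : measurable = <<s G1 >>).
Hypotheses (IG1 : setI_closed G1) (TG1 : G1 setT).
Local Open Scope ereal_scope.

Lemma measurable_preimage d' (T' : measurableType d') (Z : T -> T') B :
  measurable_fun setT Z -> measurable B -> measurable (Z @^-1` B).
Proof. by move=> mZ mB; rewrite -[X in measurable X]setTI; exact: mZ. Qed.

(** For fixed [B] both sides are finite measures, compared on the sigma-algebra generated by [X],
    where they agree on a generating family stable under intersection. *)
Lemma product_rule_l B : measurable B ->
  (forall A, G1 A -> P (X @^-1` A `&` Y @^-1` B) = P (X @^-1` A) * P (Y @^-1` B)) ->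
  forall A, measurable A -> P (X @^-1` A `&` Y @^-1` B) = P (X @^-1` A) * P (Y @^-1` B).
Proof.
move=> mB hG A mA.
have mYB := measurable_preimage mY mB.
have r0 : (0 <= fine (P (Y @^-1` B)))%R by exact: fine_ge0.
have PB : (fine (P (Y @^-1` B)))%:E = P (Y @^-1` B) by rewrite fineK// fin_num_measure.
pose G := preimage_set_system setT X G1.
have GX C : <<s G1 >> C -> <<s G >> (X @^-1` C).
  by move=> sC; rewrite /G g_sigma_preimageE; exists C => //; rewrite setTI.
have m2E C : mscale (NngNum r0) P C = P C * P (Y @^-1` B) by rewrite /mscale /= PB muleC.
suff : mrestr P mYB (X @^-1` A) = mscale (NngNum r0) P (X @^-1` A).
  by rewrite /mrestr /mscale /= PB muleC.
apply: (@g_sigma_algebra_measure_unique _ _ _ G _ (fun=> setT)).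
- move=> _ [C GC <-]; rewrite setTI; apply: measurable_preimage => //.
  by rewrite gG1; exact: sub_sigma_algebra.
- by move=> _; exists setT => //; rewrite setTI.
- by rewrite bigcup_const//; exists 0%N.
- move=> _ _ [C GC <-] [D GD <-]; exists (C `&` D); first exact: IG1.
  by rewrite !setTI.
- by move=> _ [C GC <-]; rewrite setTI; exact: etrans (hG _ GC) (esym (m2E _)).
- move=> _; have : P ([set: T] `&` Y @^-1` B) < +oo.
    by rewrite setTI ltey_eq fin_num_measure.
  exact.
- by apply: GX; rewrite -gG1.
Qed.

End independence_half.

Section independence.
Context d d1 d2 (T : measurableType d) (T1 : measurableType d1) (T2 : measurableType d2)
  (R : realType).
Variables (P : probability T R) (X : T -> T1) (Y : T -> T2).
Hypotheses (mX : measurable_fun setT X) (mY : measurable_fun setT Y).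
Variables (G1 : set (set T1)) (G2 : set (set T2)).
Hypotheses (gG1 : measurable = <<s G1 >>) (gG2 : measurable = <<s G2 >>).
Hypotheses (IG1 : setI_closed G1) (IG2 : setI_closed G2) (TG1 : G1 setT) (TG2 : G2 setT).
Local Open Scope ereal_scope.

Lemma product_rule :
  (forall A B, G1 A -> G2 B -> P (X @^-1` A `&` Y @^-1` B) = P (X @^-1` A) * P (Y @^-1` B)) ->
  forall A B, measurable A -> measurable B ->
    P (X @^-1` A `&` Y @^-1` B) = P (X @^-1` A) * P (Y @^-1` B).
Proof.
move=> hG A B mA mB.
apply: (product_rule_l mX mY gG1 IG1 TG1) => // C GC.
rewrite setIC muleC; apply: (product_rule_l mY mX gG2 IG2 TG2) => //.
  by rewrite gG1; exact: sub_sigma_algebra.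
by move=> D GD; rewrite setIC muleC; exact: hG.
Qed.

End independence.

Section coin_tossing.
Variable R : realType.
Implicit Types (x : R) (n : nat) (w : bits).

(** The doubling map modulo 1, whose itinerary with respect to the two halves of the unit interval
    gives the binary digits. *)
Definition dtau x : R := 2 * x - (2^-1 <= x)%R%:R.
Definition digit x n : bool := (2^-1 <= iter n dtau x)%R.
Definition shiftb (o : bits) : bits := fun n => o n.+1.
(** The dyadic number with the first [n] binary digits of [w], that is, the left end of the interval
    of numbers starting with these digits. *)
Fixpoint low n w : R := if n is n'.+1 then ((w 0%N)%:R + low n' (shiftb w)) / 2 else 0.

Lemma digitS x n : digit x n.+1 = digit (dtau x) n.
Proof. by rewrite /digit iterSr. Qed.

Lemma low_bounds n w : 0 <= low n w /\ low n w + 2^-1 ^+ n <= 1.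
Proof.
elim: n w => [|n IH] w /=; first by rewrite add0r.
have [h1 h2] := IH (shiftb w); rewrite exprS.
move: (low n _) (2^-1 ^+ n) h1 h2 => a e h1 h2; case: (w 0%N); split; rewrite ?mulr1n ?mulr0n; lra.
Qed.

Lemma dtau_bounds x : 0 <= x < 1 -> 0 <= dtau x < 1.
Proof. by move=> /andP[x0 x1]; rewrite /dtau; case: (leP 2^-1 x) => h /=; apply/andP; split; lra. Qed.

Lemma digits_itv n w x : 0 <= x < 1 ->
  cylinder n w (digit x) <-> low n w <= x < low n w + 2^-1 ^+ n.
Proof.
elim: n w x => [|n IH] w x xb.
  by split => // _; rewrite /= add0r.
have E : cylinder n.+1 w (digit x) <-> digit x 0 = w 0%N /\ cylinder n (shiftb w) (digit (dtau x)).
  split=> [h|[h0 h] [|i]// ii]; last by rewrite digitS h.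
  by split=> [|i ii]; [exact: h|rewrite -digitS; exact: h].
rewrite E IH; last exact: dtau_bounds.
have [h1 h2] := low_bounds n (shiftb w).
rewrite /= exprS; move: (low n _) (2^-1 ^+ n) h1 h2 => a e h1 h2.
rewrite /digit /= /dtau; move/andP: xb => [x0 x1].
split.
  by move=> [<-]; case: (leP 2^-1 x) => h; rewrite ?mulr1n ?mulr0n => /andP[? ?]; apply/andP; split; lra.
case: (w 0%N); rewrite ?mulr1n ?mulr0n => /andP[? ?]; case: (leP 2^-1 x) => h;
  (split; [try by []; lra|apply/andP; split; rewrite ?mulr1n ?mulr0n; lra]).
Qed.

Definition toss x : cantorT := if 0 <= x < 1 then digit x else fun=> false.

Lemma toss_cylinder n w :
  (toss @^-1` cylinder n w) `&` `[0, 1[ = [set` `[low n w, low n w + 2^-1 ^+ n[].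
Proof.
have [h1 h2] := low_bounds n w.
apply/seteqP; split=> x /=; rewrite !in_itv /= /toss.
  by move=> [+ xb]; rewrite xb => /digits_itv; exact.
move=> hx; have xb : 0 <= x < 1 by case/andP: hx => ? ?; apply/andP; split; lra.
by split => //; rewrite xb; apply/digits_itv.
Qed.

Lemma measurable_toss : measurable_fun setT (toss : measurableTypeR R -> cantorT).
Proof.
apply: (@measurability _ _ (measurableTypeR R) cantorT setT toss cylinders) => // _ [_ [->|[n [w ->]]] <-].
  by rewrite preimage_set0 setI0.
rewrite setTI.
have -> : toss @^-1` cylinder n w = (toss @^-1` cylinder n w) `&` `[0, 1[ `|`
    ((fun=> (fun=> false) : bits) @^-1` cylinder n w `&` ~` `[0%R, 1%R[%classic).
  apply/seteqP; split=> x.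
    move=> h; have [xb|xb] := boolP (0 <= x < 1).
      by left; split => //; rewrite /= in_itv.
    right; split; last by rewrite /= in_itv /= (negbTE xb).
    by move: h; rewrite /= /toss (negbTE xb).
  move=> [[]//|[h]] /=; rewrite in_itv /= => /negP xb.
  by rewrite /toss (negbTE xb).
rewrite toss_cylinder; apply: measurableU; first exact: measurable_itv.
apply: measurableI; last by apply: measurableC; exact: measurable_itv.
have [h|h] := pselect (cylinder n w (fun=> false)).
  by rewrite (_ : _ @^-1` _ = setT); [exact: measurableT|apply/seteqP; split].
by rewrite (_ : _ @^-1` _ = set0); [exact: measurable0|apply/seteqP; split].
Qed.

Let mu01 : {measure set (measurableTypeR R) -> \bar R} := mrestr (@lebesgue_measure R) (measurable_itv `[0%R, 1%R[).

(* The law of the binary digits of a uniform variable on [0, 1[. *)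
Definition coin (A : set cantorT) : \bar R := mu01 (toss @^-1` A).

Let coin0 : coin set0 = 0%E.
Proof. by rewrite /coin preimage_set0 measure0. Qed.

Let coin_ge0 A : (0 <= coin A)%E.
Proof. exact: measure_ge0. Qed.

Let coin_sigma_additive : semi_sigma_additive coin.
Proof.
move=> F mF tF mUF; rewrite /coin preimage_bigcup.
apply: measure_semi_sigma_additive.
- by move=> n; rewrite -[X in measurable X]setTI; exact: measurable_toss.
- apply/trivIsetP => /= i j _ _ ij; rewrite -preimage_setI.
  by move/trivIsetP : tF => /(_ _ _ _ _ ij) ->//; rewrite preimage_set0.
- by rewrite -preimage_bigcup -[X in measurable X]setTI; exact: measurable_toss.
Qed.

HB.instance Definition _ := isMeasure.Build _ _ _ coin coin0 coin_ge0 coin_sigma_additive.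

Lemma coin_cylinder n w : coin (cylinder n w) = (2^-1 ^+ n)%:E.
Proof.
rewrite /coin /mu01 /= /mrestr toss_cylinder lebesgue_measure_itv /= lte_fin.
by rewrite ltrDl exprn_gt0 ?invr_gt0// -EFinB addrC addKr.
Qed.

Let coinT : coin setT = 1%E.
Proof. by rewrite -(cylinder0 (fun=> false)) coin_cylinder expr0. Qed.

HB.instance Definition _ := Measure_isProbability.Build _ _ _ coin coinT.

Definition evens (o : bits) : bits := fun n => o n.*2.
Definition odds (o : bits) : bits := fun n => o n.*2.+1.

Lemma measurable_coord_fun d (T : measurableType d) (f : T -> cantorT) :
  (forall i : nat, measurable_fun setT (fun o => (f o : bits) i)) -> measurable_fun setT f.
Proof.
move=> mf; apply: (@measurability _ _ T cantorT setT f cylinders) => // _ [_ [->|[n [w ->]]] <-].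
  by rewrite preimage_set0 setI0.
rewrite setTI (_ : _ @^-1` _ = \bigcap_(i in `I_n) ((fun o => (f o : bits) i) @^-1` [set w i])).
  apply: bigcap_measurableType => i _.
  by rewrite -[X in measurable X]setTI; exact: mf.
by apply/seteqP; split=> o h i /= ii; exact: h.
Qed.

Lemma measurable_bit i : measurable_fun setT (fun o : cantorT => (o : bits) i).
Proof.
apply: (@measurable_fun_bool _ _ setT _ true).
rewrite setTI; set b := true; change (measurable [set o : cantorT | (o : bits) i = b]).
(* A tuple of length [i] fixes the digits before rank [i]; at rank [i] itself [nth] falls back on
   its default [b], the prescribed digit. *)
rewrite (_ : [set _ | _] = \bigcup_(s : i.-tuple bool)
      cylinder i.+1 (fun k => nth b s k)).
  apply: countable_bigcupT_measurable => [|s]; first exact: countableP.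
  exact: measurable_cylinder.
apply/seteqP; split=> o /=.
  move=> oi; exists [tuple (o : bits) k | k < i] => // k; rewrite ltnS leq_eqVlt => /predU1P[->|ki].
    by rewrite nth_default// size_tuple.
  by rewrite -(nth_mktuple (fun k : 'I_i => (o : bits) k) b (Ordinal ki)) /=.
by move=> [s _] /(_ i (ltnSn _)) ->; rewrite nth_default// size_tuple.
Qed.

Lemma measurable_evens : measurable_fun setT (evens : cantorT -> cantorT).
Proof. by apply: measurable_coord_fun => i; exact: measurable_bit. Qed.

Lemma measurable_odds : measurable_fun setT (odds : cantorT -> cantorT).
Proof. by apply: measurable_coord_fun => i; exact: measurable_bit. Qed.

Local Open Scope ereal_scope.

Lemma coin_unique (m : {measure set cantorT -> \bar R}) :
  (forall n w, m (cylinder n w) = (2^-1 ^+ n)%:E) -> forall A, measurable A -> m A = coin A.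
Proof.
move=> h A mA.
apply: (@measure_unique _ R cantorT cylinders (fun=> setT) _ _ _ _ m coin) => //.
- exact: cylinders_setI.
- by move=> _; exact: cylindersT.
- by rewrite bigcup_const//; exists 0%N.
- by move=> _ [->|[n [w ->]]]; [rewrite !measure0|exact: etrans (h n w) (esym (coin_cylinder n w))].
- by move=> _; rewrite -(cylinder0 (fun=> false)); rewrite h ltry.
Qed.

Definition agree (s : seq nat) w : set cantorT := [set o | forall i, i \in s -> (o : bits) i = w i].

Lemma measurable_agree s w : measurable (agree s w).
Proof.
elim: s => [|j s IH].
  by rewrite (_ : agree _ _ = setT); [exact: measurableT|apply/seteqP; split].
rewrite (_ : agree _ _ = ((fun o : cantorT => (o : bits) j) @^-1` [set w j]) `&` agree s w).
  apply: measurableI => //.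
  by rewrite -[X in measurable X]setTI; exact: measurable_bit.
apply/seteqP; split=> o /=.
  by move=> h; split=> [|i si]; apply: h; rewrite inE ?eqxx// si orbT.
by move=> [h1 h2] i; rewrite inE => /predU1P[->//|]; exact: h2.
Qed.

(** The missing positions [t] complete [s] to an initial segment, for which the event is a cylinder.
    The induction on [t] frees one position at a time, the event being the disjoint union over its
    two values. *)
Lemma coin_agree s w : uniq s -> coin (agree s w) = (2^-1 ^+ size s)%:E.
Proof.
move=> us; have [N sN] : exists N, forall i, i \in s -> (i < N)%N.
  by exists (\max_(i <- s) i).+1 => i si; rewrite ltnS; exact: leq_bigmax_seq.
pose t := [seq i <- iota 0 N | i \notin s].
have {sN} : perm_eq (s ++ t) (iota 0 N).
  apply: uniq_perm; [|exact: iota_uniq|].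
    rewrite cat_uniq us filter_uniq ?iota_uniq// andbT /=.
    by apply/hasPn => i; rewrite mem_filter => /andP[].
  move=> i; rewrite mem_cat mem_filter mem_iota /= add0n.
  by case: (boolP (i \in s)) => //= /sN ->.
move: t => t; elim: t s w {us} => [|j t IH] s w.
  rewrite cats0 => sN; rewrite (perm_size sN) size_iota -(coin_cylinder _ w); congr coin.
  apply/seteqP; split=> o /= h i.
    by move=> iN; apply: h; rewrite (perm_mem sN) mem_iota.
  by rewrite (perm_mem sN) mem_iota => /andP[_]; exact: h.
move=> sN; have js : j \notin s.
  have := perm_uniq sN; rewrite iota_uniq cat_uniq => /and3P[_ /hasPn/(_ j) h _].
  by apply: h; rewrite inE eqxx.
pose w' b : bits := fun i => if i == j then b else w i.
have E : agree s w = agree (j :: s) (w' true) `|` agree (j :: s) (w' false).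
  have wi b i : i \in s -> w' b i = w i.
    by move=> si; rewrite /w' ifN//; apply: contraNneq js => <-.
  apply/seteqP; split=> o /=.
    move=> h; case oj : ((o : bits) j); [left|right] => i; rewrite inE => /predU1P[->|si].
    - by rewrite /w' eqxx.
    - by rewrite wi// h.
    - by rewrite /w' eqxx.
    - by rewrite wi// h.
  by move=> [h|h] i si; rewrite h ?inE ?si ?orbT// wi.
have perm' : perm_eq ((j :: s) ++ t) (iota 0 N).
  by rewrite (perm_trans _ sN)// -cat1s -catA perm_catCA.
transitivity (coin (agree (j :: s) (w' true)) + coin (agree (j :: s) (w' false))); last first.
  rewrite !(IH _ _ perm') /= -EFinD exprS; congr (_%:E).
  by move: (2^-1 ^+ size s)%R => x; lra.
rewrite E; apply: measureU; [exact: measurable_agree|exact: measurable_agree|].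
apply/seteqP; split=> // o [/(_ j) h1 /(_ j) h2]; move: h1 h2.
by rewrite inE eqxx /w' eqxx => -> // /(_ isT).
Qed.


Lemma evens_cylinder n w :
  evens @^-1` cylinder n w = agree [seq i.*2 | i <- iota 0 n] (fun i => w i./2).
Proof.
apply/seteqP; split=> o /= h i.
  by move=> /mapP[k]; rewrite mem_iota /= => kn ->; rewrite doubleK; exact: h.
move=> iN; rewrite /evens h ?doubleK//; apply/mapP; exists i => //.
by rewrite mem_iota.
Qed.

Lemma half_doubleS n : n.*2.+1./2 = n.
Proof. exact: uphalf_double. Qed.

Lemma odds_cylinder n w :
  odds @^-1` cylinder n w = agree [seq i.*2.+1 | i <- iota 0 n] (fun i => w i./2).
Proof.
apply/seteqP; split=> o /= h i.
  by move=> /mapP[k]; rewrite mem_iota /= => kn ->; rewrite half_doubleS; exact: h.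
move=> iN; rewrite /odds h ?half_doubleS//; apply/mapP; exists i => //.
by rewrite mem_iota.
Qed.

Lemma uniq_evens n : uniq [seq i.*2 | i <- iota 0 n].
Proof. by rewrite map_inj_uniq ?iota_uniq//; exact: double_inj. Qed.

Lemma uniq_odds n : uniq [seq i.*2.+1 | i <- iota 0 n].
Proof. by rewrite map_inj_uniq ?iota_uniq// => i j [] /double_inj. Qed.

Lemma coin_evens (A : set cantorT) : measurable A -> coin (evens @^-1` A) = coin A.
Proof.
move=> mA; have h n w : distribution coin (mfun_of measurable_evens) (cylinder n w) = (2^-1 ^+ n)%:E.
  rewrite /distribution /= /pushforward evens_cylinder.
  by rewrite coin_agree ?uniq_evens// size_map size_iota.
exact: (coin_unique h mA).
Qed.

Lemma coin_odds (A : set cantorT) : measurable A -> coin (odds @^-1` A) = coin A.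
Proof.
move=> mA; have h n w : distribution coin (mfun_of measurable_odds) (cylinder n w) = (2^-1 ^+ n)%:E.
  rewrite /distribution /= /pushforward odds_cylinder.
  by rewrite coin_agree ?uniq_odds// size_map size_iota.
exact: (coin_unique h mA).
Qed.

Lemma coin_split (A B : set cantorT) : measurable A -> measurable B ->
  coin (evens @^-1` A `&` odds @^-1` B) = coin A * coin B.
Proof.
move=> mA mB; rewrite -(coin_evens mA) -(coin_odds mB).
apply: (@product_rule _ _ _ cantorT cantorT cantorT R coin evens odds measurable_evens
  measurable_odds cylinders cylinders) => //.
- exact: cylinders_setI.
- exact: cylinders_setI.
- exact: cylindersT.
- exact: cylindersT.
move=> D D' [->|[n [w ->]]]; first by rewrite preimage_set0 set0I !measure0 mul0e.
move=> [->|[m [w' ->]]]; first by rewrite preimage_set0 setI0 !measure0 mule0.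
change (coin (evens @^-1` cylinder n w `&` odds @^-1` cylinder m w') =
  coin (evens @^-1` cylinder n w) * coin (odds @^-1` cylinder m w')).
have u : uniq ([seq i.*2 | i <- iota 0 n] ++ [seq i.*2.+1 | i <- iota 0 m]).
  rewrite cat_uniq uniq_evens uniq_odds andbT; apply/hasPn => _ /mapP[k _ ->].
  by apply/mapP => -[l _ /(congr1 odd)]; rewrite /= !odd_double.
have -> : evens @^-1` cylinder n w `&` odds @^-1` cylinder m w' =
   agree ([seq i.*2 | i <- iota 0 n] ++ [seq i.*2.+1 | i <- iota 0 m])
     (fun i => if odd i then w' i./2 else w i./2).
  rewrite evens_cylinder odds_cylinder; apply/seteqP; split=> o /=.
    move=> [h1 h2] i; rewrite mem_cat => /orP[/mapP[k kn ->]|/mapP[k kn ->]].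
      by rewrite odd_double h1//; exact: map_f.
    by rewrite oddS odd_double h2//; apply/mapP; exists k.
  move=> h; split=> i /mapP[k kn ->].
    rewrite h ?odd_double ?doubleK//.
    by rewrite mem_cat map_f.
  rewrite h ?oddS ?odd_double ?half_doubleS//.
  by rewrite mem_cat; apply/orP; right; apply/mapP; exists k.
rewrite evens_cylinder odds_cylinder !coin_agree ?uniq_evens ?uniq_odds//.
by rewrite size_cat !size_map !size_iota exprD EFinM.
Qed.

Lemma coin_iter_odds n (A : set cantorT) : measurable A -> coin (iter n odds @^-1` A) = coin A.
Proof.
elim: n A => [//|n IH] A mA.
have -> : iter n.+1 odds @^-1` A = iter n odds @^-1` (odds @^-1` A).
  by apply/seteqP; split=> o /=; rewrite -iterS.
by rewrite IH ?coin_odds// -[X in measurable X]setTI; exact: measurable_odds.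
Qed.

Lemma measurable_iter_odds n : measurable_fun setT (iter n odds : cantorT -> cantorT).
Proof.
elim: n => [|n IH]; first exact: measurable_id.
exact: (measurableT_comp measurable_odds IH).
Qed.

End coin_tossing.

(** * Mixing of the shift *)

Section real_probability.
Context d (T : measurableType d) (R : realType) (P : probability T R).
Implicit Types A B : set T.

Definition pr A : R := fine (P A).

Lemma prE A : measurable A -> P A = (pr A)%:E.
Proof. by move=> mA; rewrite fineK// fin_num_measure. Qed.

Lemma pr_ge0 A : 0 <= pr A.
Proof. exact: fine_ge0. Qed.

Lemma prT : pr setT = 1.
Proof. by rewrite /pr probability_setT. Qed.

Lemma pr0 : pr set0 = 0.
Proof. by rewrite /pr measure0. Qed.

Lemma le_pr A B : measurable A -> measurable B -> A `<=` B -> pr A <= pr B.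
Proof. by move=> mA mB AB; rewrite -lee_fin -!prE//; apply: le_measure; rewrite ?inE. Qed.

Lemma pr_le1 A : measurable A -> pr A <= 1.
Proof. by move=> mA; rewrite -prT; exact: le_pr. Qed.

Lemma prD A B : measurable A -> measurable B -> pr A = pr (A `\` B) + pr (A `&` B).
Proof.
move=> mA mB; apply/eqP; rewrite -eqe EFinD -!prE//.
- by rewrite (measureDI P mA mB).
- exact: measurableI.
- exact: measurableD.
Qed.

Lemma pr_setD A B : measurable A -> measurable B -> B `<=` A -> pr (A `\` B) = pr A - pr B.
Proof. by move=> mA mB /setIidr BA; rewrite (prD mA mB) BA addrK. Qed.

Lemma pr_setC A : measurable A -> pr (~` A) = 1 - pr A.
Proof. by move=> mA; rewrite -setTD pr_setD// prT. Qed.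

Lemma le_prU A B : measurable A -> measurable B -> pr (A `|` B) <= pr A + pr B.
Proof.
move=> mA mB; have mU := measurableU _ _ mA mB.
rewrite (prD mU mB) lerD//; apply: le_pr => //.
- exact: measurableD.
- by move=> x [[//|Bx] /(_ Bx)].
- exact: measurableI.
Qed.

Lemma pr_nondecreasing (F : nat -> set T) : (forall n, measurable (F n)) ->
  nondecreasing_seq F -> pr (F n) @[n --> \oo] --> pr (\bigcup_n F n).
Proof.
move=> mF ndF; have mU : measurable (\bigcup_n F n) by exact: bigcupT_measurable.
have h : (P \o F) n @[n --> \oo] --> (pr (\bigcup_n F n))%:E.
  by rewrite -prE//; exact: nondecreasing_cvg_mu.
exact: (fine_cvg h).
Qed.

Lemma pr_nonincreasing (F : nat -> set T) : (forall n, measurable (F n)) ->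
  (forall n, F n.+1 `<=` F n) -> pr (F n) @[n --> \oo] --> pr (\bigcap_n F n).
Proof.
move=> mF ndF; have mU : measurable (\bigcap_n F n) by exact: bigcapT_measurable.
have h : pr (~` F n) @[n --> \oo] --> pr (\bigcup_n ~` F n).
  apply: pr_nondecreasing => [n|]; first exact: measurableC.
  by apply/nondecreasing_seqP => n; apply/subsetPset; exact: subsetC.
rewrite -setC_bigcap in h; rewrite pr_setC// in h.
have : 1 - pr (~` F n) @[n --> \oo] --> 1 - (1 - pr (\bigcap_n F n)).
  by apply: cvgB => //; exact: cvg_cst.
rewrite opprB addrC subrK; apply: cvg_trans; apply: near_eq_cvg; near=> n.
by rewrite pr_setC// opprB addrC subrK.
Unshelve. all: by end_near. Qed.

Lemma pr_bigcup_le (F : nat -> set T) (c : R) : (forall n, measurable (F n)) ->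
  (forall n, \sum_(i < n) pr (F i) <= c) -> pr (\bigcup_n F n) <= c.
Proof.
move=> mF hc; pose G n := \big[setU/set0]_(i < n) F i.
have mG n : measurable (G n) by exact: bigsetU_measurable.
have h : pr (G n) @[n --> \oo] --> pr (\bigcup_n G n).
  apply: pr_nondecreasing => //; apply/nondecreasing_seqP => n; apply/subsetPset.
  by rewrite /G big_ord_recr /=; exact: subsetUl.
have -> : \bigcup_n F n = \bigcup_n G n.
  apply/seteqP; split=> x [n _ hx].
    by exists n.+1 => //; rewrite /G big_ord_recr /=; right.
  by move: hx; rewrite /G -bigcup_mkord => -[i _ Fx]; exists i.
rewrite -(cvg_lim _ h)//; apply: limr_le; first exact: (cvgP _ h).
apply: nearW => n; apply: le_trans (hc n); elim: n => [|n IH]; first by rewrite /G !big_ord0 pr0.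
rewrite big_ord_recr /= {1}/G big_ord_recr /=.
by apply: le_trans (le_prU (mG n) (mF n)) _; rewrite lerD2r.
Qed.

(** The point is stability under increasing unions: replacing the union by some [F k] changes the
    probability of the intersection with [W n] by at most the difference of their probabilities,
    uniformly in [n]. Mixing need then be checked on cylinders only. *)
Lemma mixing_lambda (W : nat -> set T) (c : R) : (forall n, measurable (W n)) ->
  (forall n, pr (W n) = c) -> 
  lambda_system setT [set A | measurable A /\ pr (A `&` W n) @[n --> \oo] --> pr A * c].
Proof.
move=> mW Wc; split=> //.
- split; first exact: measurableT.
  rewrite prT mul1r; apply: cvg_near_cst; near=> n.
  by rewrite setTI Wc.
- move=> A B BA [mA hA] [mB hB]; split; first exact: measurableD.
  rewrite pr_setD// mulrBl.
  have : pr (A `&` W n) - pr (B `&` W n) @[n --> \oo] --> pr A * c - pr B * c by exact: cvgB.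
  apply: cvg_trans.
  apply: near_eq_cvg; near=> n.
  rewrite /= -pr_setD; [congr pr|exact: measurableI|exact: measurableI|exact: setSI].
  apply/seteqP; split=> x /=; first by move=> [[Ax Wx] nBW]; split=> //; split=> // Bx; exact: nBW.
  by move=> [[Ax Bx] Wx]; split=> // -[].
move=> F ndF hF; have mF n : measurable (F n) by case: (hF n).
have mU : measurable (\bigcup_n F n) by exact: bigcupT_measurable.
split=> //; apply/cvgrPdist_lt => e e0.
have e40 : 0 < e / 4 by rewrite divr_gt0.
have /cvgrPdist_lt/(_ _ e40) [k _ /(_ k (leqnn k)) hk] := pr_nondecreasing mF ndF.
have [_ /cvgrPdist_lt/(_ _ e40)] := hF k; apply: filterS => n hn.
have FU : F k `<=` \bigcup_n F n by exact: bigcup_sup.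
have c1 : 0 <= c <= 1 by rewrite -(Wc 0%N) pr_ge0 pr_le1.
have kU : pr (F k) <= pr (\bigcup_n F n) by exact: le_pr.
have mUW := measurableI _ _ mU (mW n); have mFW := measurableI _ _ (mF k) (mW n).
have h1 : pr (F k `&` W n) <= pr (\bigcup_n F n `&` W n) by apply: le_pr => //; exact: setSI.
have : pr (\bigcup_n F n `&` W n) - pr (F k `&` W n) <= pr (\bigcup_n F n) - pr (F k).
  rewrite -!pr_setD//; last exact: setSI.
  apply: le_pr; [exact: measurableD|exact: measurableD|].
  by move=> x [[Ux Wx] nF]; split=> // Fx; exact: nF.
move: hk hn; rewrite !ltr_norml.
move: (pr (\bigcup_n F n)) (pr (F k)) (pr (F k `&` W n)) (pr (\bigcup_n F n `&` W n)) kU h1 => u f fw wu fu h1 /andP[_ hk] /andP[h2 h3] h4.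
have h5 : 0 <= (u - f) * c <= u - f.
  by rewrite mulr_ge0 ?subr_ge0//=; [rewrite ler_piMr ?subr_ge0//; case/andP: c1|case/andP: c1].
by move: ((u - f) * c) (mulrBl c u f) h5 => y -> /andP[? ?]; apply/andP; split; lra.
Unshelve. all: by end_near. Qed.

End real_probability.

Section coin_mixing.
Variable R : realType.
Local Notation coin := (coin R).

Lemma cylinder_split n w : cylinder n w =
  evens @^-1` cylinder (uphalf n) (w \o double) `&`
  odds @^-1` cylinder n./2 (fun i => w i.*2.+1).
Proof.
apply/seteqP; split=> o /=.
  by move=> h; split=> i ii; rewrite /evens /odds /= h//; lia.
move=> [h1 h2] i ii.
move: (odd_double_half i); move: (i./2) (odd i) => j [] ji; rewrite -ji.
  by rewrite add1n; apply: h2; lia.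
by rewrite add0n; apply: h1; lia.
Qed.

(** On cylinders independence is exact from rank [n] on. A cylinder splits into constraints on even
    and on odd ranks: the even ones are independent of anything read after [odds], the odd ones form
    a cylinder of half the length to which the induction applies with one iteration less. *)
Lemma coin_cylinder_mixing m n w (B : set cantorT) : (n <= m)%N -> measurable B ->
  coin (cylinder n w `&` iter m odds @^-1` B) = (coin (cylinder n w) * coin B)%E.
Proof.
elim/ltn_ind: n m w => n IH m w nm mB.
have [->|n0] := posnP n.
  rewrite cylinder0 setTI coin_iter_odds// -(cylinder0 w) coin_cylinder expr0 mul1e//.
case: m nm => [|m] nm; first by move: n0; rewrite ltnNge nm.
have mBm : measurable (iter m odds @^-1` B : set cantorT) by exact: measurable_preimage (measurable_iter_odds m) mB.
pose E : set cantorT := cylinder (uphalf n) (w \o double); pose O : set cantorT := cylinder n./2 (fun i => w i.*2.+1).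
have mE : measurable E := measurable_cylinder _ _.
have mO : measurable O := measurable_cylinder _ _.
have e : cylinder n w = evens @^-1` E `&` odds @^-1` O := cylinder_split n w.
have -> : cylinder n w `&` iter m.+1 odds @^-1` B =
  evens @^-1` E `&` odds @^-1` (O `&` iter m odds @^-1` B).
  rewrite e -setIA; congr (_ `&` _); apply/seteqP; split=> o /= [h1 h2]; split=> //.
    by move: h2; rewrite -iterSr.
  by rewrite -iterSr in h2.
rewrite coin_split//; last exact: measurableI.
rewrite IH//; [|lia|lia].
by rewrite e coin_split// muleA.
Qed.

Lemma coin_mixing (A B : set cantorT) : measurable A -> measurable B ->
  pr coin (A `&` iter n odds @^-1` B) @[n --> \oo] --> pr coin A * pr coin B.
Proof.
move=> mA mB.
have mW n : measurable (iter n odds @^-1` B : set cantorT).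
  exact: measurable_preimage (measurable_iter_odds n) mB.
have Wc n : pr coin (iter n odds @^-1` B) = pr coin B.
  by congr fine; exact: coin_iter_odds.
have L := mixing_lambda mW Wc.
suff : <<s cylinders >> `<=` [set A : set cantorT | measurable A /\
    pr coin (A `&` iter n odds @^-1` B) @[n --> \oo] --> pr coin A * pr coin B].
  by move=> /(_ A mA)[].
apply: lambda_system_subset => //; first exact: cylinders_setI.
move=> _ [->|[k [w ->]]].
  split=> //; rewrite pr0 mul0r; apply: cvg_near_cst; near=> n.
  by rewrite set0I pr0.
have mc := measurable_cylinder k w.
split=> //; apply: cvg_near_cst; near=> n.
apply: EFin_inj; rewrite EFinM -!prE//; last exact: measurableI.
by apply: coin_cylinder_mixing => //; near: n; exact: nbhs_infty_ge.
Unshelve. all: by end_near. Qed.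

End coin_mixing.

(** * Gaussian variables on the coin-tossing space *)

Section quantile.
Variables (R : realType) (mu : probability (measurableTypeR R) R).
Implicit Types (t x : R) (o : bits) (n k : nat).
Local Notation coin := (coin R).

Let F t : R := pr mu `]-oo, t].

Let mray t : measurable (`]-oo, t]%classic : set (measurableTypeR R)).
Proof. exact: measurable_itv. Qed.

Let F_homo s t : s <= t -> F s <= F t.
Proof.
move=> st; apply: le_pr => // x /=; rewrite !in_itv /= => xs.
exact: le_trans xs st.
Qed.

Let F_right t c : (forall s, t < s -> c <= F s) -> c <= F t.
Proof.
move=> h; have mr n := mray (t + n.+1%:R^-1).
have dr n : `]-oo, t + n.+2%:R^-1]%classic `<=` `]-oo, t + n.+1%:R^-1].
  move=> x /=; rewrite !in_itv /= => /le_trans; apply; rewrite lerD2l.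
  by rewrite lef_pV2 ?posrE// ler_nat.
have := pr_nonincreasing (P := mu) mr dr.
have -> : \bigcap_n `]-oo, t + n.+1%:R^-1]%classic = `]-oo, t]%classic.
  apply/seteqP; split=> x /=; rewrite in_itv /=; last first.
    by move=> xt n _ /=; rewrite in_itv /= (le_trans xt)// lerDl.
  move=> hx; apply/ler_addgt0Pr => e e0.
  have [n ne] : exists n, n.+1%:R^-1 < e.
    exists (Num.trunc e^-1); rewrite invf_plt ?posrE//.
    exact: truncnS_gt.
  by have := hx n I; rewrite /= in_itv /= => /le_trans; apply; rewrite lerD2l ltW.
move=> l; rewrite /F -(cvg_lim _ l)//; apply: limr_ge; first exact: (cvgP _ l).
by apply: nearW => n; apply: h; rewrite ltrDl.
Qed.

Let F_left c : 0 < c -> exists t, F t < c.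
Proof.
move=> c0; have mr n := mray (- n%:R).
have dr n : `]-oo, - n.+1%:R]%classic `<=` `]-oo, (- n%:R : R)].
  move=> x /=; rewrite !in_itv /= => /le_trans; apply.
  by rewrite lerN2 ler_nat.
have := pr_nonincreasing (P := mu) mr dr.
have -> : \bigcap_n `]-oo, (- n%:R : R)]%classic = set0.
  apply/seteqP; split=> // x /(_ (Num.trunc (- x)).+1 I) /=; rewrite in_itv /= lerNr.
  by move/(lt_le_trans (truncnS_gt (- x))); rewrite ltxx.
rewrite pr0 => /cvgrPdist_lt/(_ _ c0)[n _ /(_ n (leqnn n))].
rewrite sub0r normrN ger0_norm ?pr_ge0// => h; by exists (- n%:R).
Qed.

Let F_top c : c < 1 -> exists n, c < F n%:R.
Proof.
move=> c1; have mr n := mray n%:R.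
have : pr mu `]-oo, n%:R] @[n --> \oo] --> pr mu (\bigcup_n `]-oo, (n%:R : R)]%classic).
  apply: pr_nondecreasing => //; apply/nondecreasing_seqP => n; apply/subsetPset => x /=.
  by rewrite !in_itv /= => /le_trans; apply; rewrite ler_nat.
have -> : \bigcup_n `]-oo, (n%:R : R)]%classic = setT.
  apply/seteqP; split=> // x _; exists (Num.trunc x).+1 => //=; rewrite in_itv /=.
  by rewrite ltW// truncnS_gt.
have e0 : 0 < 1 - c by rewrite subr_gt0.
rewrite prT => /cvgrPdist_lt/(_ _ e0)[n _ /(_ n (leqnn n))] h; exists n.
by move: h; rewrite -/(F _) => /(le_lt_trans (ler_norm _)); move: (F _) => y; lra.
Qed.

Let good o := (exists n, 0 < low R n o) /\ exists k, forall n, low R n o <= F k%:R.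

(* The generalized inverse of the distribution function, evaluated at the real
   number with binary digits [o]; it is only correct off the null set of the
   sequences that stand for 0 or for a number exceeding the distribution
   function. *)
Definition quantile o : R :=
  if `[< good o >] then inf [set t | forall n, low R n o <= F t] else 0.

(** The Galois connection between quantile and distribution function: right continuity puts the
    infimum in the set, and [good] makes the set nonempty and bounded below. *)
Let quantile_le o t : good o -> quantile o <= t <-> forall n, low R n o <= F t.
Proof.
move=> go; rewrite /quantile asboolT//; case: go => -[m m0] [k hk].
set U := [set _ | _].
have lb : has_lbound U.
  have [s hs] := F_left m0; exists s => u Uu; rewrite leNgt; apply/negP => us.
  by have := lt_le_trans hs (Uu m); rewrite ltNge F_homo// ltW.
split=> h; last by apply: ge_inf.
move=> n; apply: F_right => s ts.
have [u Uu us] : exists2 u, U u & u < s.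
  by apply: inf_lt; [exists k%:R|exact: le_lt_trans h ts].
by apply: le_trans (Uu n) _; rewrite F_homo// ltW.
Qed.

Lemma measurable_low n : measurable_fun setT (low R n : cantorT -> R).
Proof.
elim: n => [|n IH] /=; first exact: measurable_cst.
apply: measurable_funM; last exact: measurable_cst.
apply: measurable_funD.
  apply: (measurableT_comp (f := fun b : bool => b%:R : R)) => //.
  exact: measurable_bit.
have ms : measurable_fun setT (shiftb : cantorT -> cantorT).
  by apply: measurable_coord_fun => i; exact: measurable_bit.
exact: (measurableT_comp IH ms).
Qed.

Let measurable_low_le n t : measurable ([set o : cantorT | low R n o <= t]).
Proof.
rewrite (_ : [set _ | _] = low R n @^-1` `]-oo, t]); last first.
  by apply/seteqP; split=> o /=; rewrite in_itv.
exact: measurable_preimage (measurable_low n) (mray t).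
Qed.

Let measurable_lows_le t : measurable ([set o : cantorT | forall n, low R n o <= t]).
Proof.
rewrite (_ : [set _ | _] = \bigcap_n [set o : cantorT | low R n o <= t]).
  by apply: bigcapT_measurable => n; exact: measurable_low_le.
by apply/seteqP; split=> o /= h n; [move=> _|]; exact: h.
Qed.

Let measurable_good : measurable (good : set cantorT).
Proof.
have -> : (good : set cantorT) = (\bigcup_n ~` [set o : cantorT | low R n o <= 0]) `&`
    \bigcup_k [set o : cantorT | forall n, low R n o <= F k%:R].
  apply/seteqP; split=> o.
    by move=> [[n h] [k hk]]; split; [exists n => //=; apply/negP; rewrite -ltNge|exists k].
  by move=> [[n _ /= /negP]]; rewrite -ltNge => h [k _ hk]; split; [exists n|exists k].
apply: measurableI; apply: bigcupT_measurable => n; last exact: measurable_lows_le.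
by apply: measurableC; exact: measurable_low_le.
Qed.

Let measurable_quantile_le t : measurable ([set o : cantorT | quantile o <= t]).
Proof.
rewrite (_ : [set _ | _] = good `&` [set o : cantorT | forall n, low R n o <= F t] `|`
  ~` good `&` [set o : cantorT | 0 <= t]).
  apply: measurableU; apply: measurableI => //; first exact: measurableC.
  have [h|h] := boolP (0 <= t).
    by rewrite (_ : [set _ | _] = setT); [exact: measurableT|apply/seteqP; split].
  by rewrite (_ : [set _ | _] = set0); [exact: measurable0|apply/seteqP; split].
apply/seteqP; split=> o /=.
  have [go|go] := pselect (good o); first by move=> /(quantile_le _ go); left.
  by rewrite /quantile asboolF//; right.
move=> [[go h]|[go h]]; first exact/quantile_le.
by rewrite /quantile asboolF.
Qed.

Lemma measurable_quantile : measurable_fun setT (quantile : cantorT -> measurableTypeR R).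
Proof.
apply: (measurability _ (RGenOInfty.measurableE R)) => // _ [_ [t ->] <-].
rewrite setTI (_ : _ @^-1` _ = ~` [set o : cantorT | quantile o <= t]).
  exact: measurableC.
by apply/seteqP; split=> o /=; rewrite in_itv /= andbT ltNge => /negP.
Qed.

Let good_toss x : 0 < x < 1 -> good (toss x) /\ forall t, quantile (toss x) <= t <-> x <= F t.
Proof.
move=> /andP[x0 x1]; have xb : 0 <= x < 1 by rewrite ltW.
have tx : toss x = digit x by rewrite /toss xb.
have lo n : low R n (digit x) <= x < low R n (digit x) + 2^-1 ^+ n by apply/digits_itv.
have lole t : (forall n, low R n (digit x) <= t) <-> x <= t.
  split=> [h|h n]; last by case/andP: (lo n) => /le_trans + _; apply.
  apply/ler_addgt0Pr => e e0.
  have : (2^-1 : R) ^+ n @[n --> \oo] --> 0 by apply: cvg_expr; rewrite ger0_norm; lra.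
  move=> /cvgrPdist_lt/(_ _ e0)[n _ /(_ n (leqnn n))].
  rewrite sub0r normrN ger0_norm ?exprn_ge0// => h2.
  by case/andP: (lo n) => _; move: (h n) h2; lra.
have go : good (toss x).
  rewrite tx; split.
    apply: contrapT => /forallNP h; suff : x <= 0 by rewrite leNgt x0.
    by apply/lole => n; rewrite leNgt; exact/negP.
  by have [k /ltW hk] := F_top x1; exists k; apply/lole.
by split=> // t; rewrite (quantile_le _ go) tx lole.
Qed.

Let coin_quantile_le t : coin [set o | quantile o <= t] = mu `]-oo, t]%classic.
Proof.
rewrite prE//; rewrite -/(F t).
have mQ : measurable (@toss R @^-1` [set o : cantorT | quantile o <= t] : set (measurableTypeR R)).
  exact: measurable_preimage (@measurable_toss R) (measurable_quantile_le t).
have m01 : measurable (`[0, 1[%classic : set (measurableTypeR R)) by exact: measurable_itv.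
pose S : set (measurableTypeR R) := @toss R @^-1` [set o : cantorT | quantile o <= t] `&` `[0, 1[.
have mS : measurable S by exact: measurableI.
transitivity (@lebesgue_measure R S) => //.
(* The digits of 0 fail [good], so the quantile takes its default value there; the point is removed
   at no cost. *)
transitivity (@lebesgue_measure R (S `\` [set 0])).
  have m0 : measurable ([set 0] : set (measurableTypeR R)) by exact: measurable_set1.
  have z : lebesgue_measure (S `&` [set 0]) = 0%E.
    apply/eqP; rewrite -measure_le0 -(lebesgue_measure_set1 (0 : R)).
    by apply: le_measure; rewrite ?inE//; exact: measurableI.
  apply: etrans (measureDI _ mS m0) _; rewrite -[RHS]adde0; congr (_ + _)%E; exact: z.
have SE x : S x = (quantile (toss x) <= t /\ 0 <= x < 1) by rewrite /S /setI /= in_itv.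
clearbody S; have Ft0 : 0 <= F t := pr_ge0 _ _.
have Ft1 : F t <= 1 by exact: pr_le1 (mray t).
(* The set is the interval from 0 excluded to [F t] included, except that 1 lies outside the domain
   of [toss] when [F t = 1]. *)
have [F1|F1] := ltP (F t) 1.
  rewrite (_ : _ `\` _ = `]0, F t]%classic).
    rewrite lebesgue_measure_itv /= lte_fin sube0; case: ltgtP Ft0 => // <- //.
  apply/seteqP; split=> x; rewrite /setD /= SE in_itv /=.
    move=> [[h /andP[x0 x1]] xn0]; have xp : 0 < x by rewrite lt_neqAle x0 andbT eq_sym; exact/eqP.
    by rewrite xp; apply/(good_toss _).2; rewrite ?xp.
  move=> /andP[x0 xF]; have x1 := le_lt_trans xF F1.
  split; last by move=> x00; rewrite x00 ltxx in x0.
  by split; [apply/(good_toss _).2; rewrite ?x0|rewrite ltW].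
have -> : F t = 1 by apply/eqP; rewrite eq_le Ft1.
rewrite (_ : _ `\` _ = `]0, 1[%classic).
  by rewrite lebesgue_measure_itv /= lte_fin ltr01 sube0.
apply/seteqP; split=> x; rewrite /setD /= SE in_itv /=.
  by move=> [[h /andP[x0 x1]] xn0]; rewrite x1 lt_neqAle x0 !andbT eq_sym; exact/eqP.
move=> /andP[x0 x1]; split; last by move=> x00; rewrite x00 ltxx in x0.
split; last by rewrite ltW.
by apply/(good_toss _).2; [rewrite x0|rewrite (le_trans (ltW x1))].
Qed.

Lemma coin_quantile (U : set (measurableTypeR R)) : measurable U -> coin (quantile @^-1` U) = mu U.
Proof.
move=> mU.
apply: (@measure_unique _ R (measurableTypeR R) _ (fun n => `]- n%:R, +oo[%classic) (RGenOInfty.measurableE R) _ _ _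
  (distribution coin (mfun_of measurable_quantile)) mu) => //.
- move=> _ _ [s ->] [t ->]; exists (Num.max s t); apply/seteqP; split=> x /=.
    by rewrite !in_itv /= !andbT gt_max => -[-> ->].
  by rewrite !in_itv /= !andbT gt_max => /andP.
- by move=> n; exists (- n%:R).
- apply/seteqP; split=> // x _; exists (Num.trunc (- x)).+1 => //=.
  by rewrite in_itv /= andbT ltrNl truncnS_gt.
- move=> _ [t ->].
  have e (Q : set (measurableTypeR R)) : Q = `]t, +oo[%classic -> Q = ~` `]-oo, t].
    by move=> ->; rewrite setCitvl.
  transitivity (1 - mu `]-oo, t]%classic)%E; last first.
    by rewrite (e _ erefl); exact: esym (probability_setC mu (mray t)).
  rewrite -coin_quantile_le.
  apply: etrans (probability_setC coin (measurable_quantile_le t)).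
  rewrite /distribution /= /pushforward; congr coin.
  by apply/seteqP; split=> o /=; rewrite in_itv /= andbT ltNge => /negP.
- move=> n; apply: le_lt_trans (ltry 1); apply: probability_le1.
  exact: measurable_itv.
Qed.

End quantile.

(** * Positivity and tail bounds for centered normal laws *)

Section normal_estimates.
Variables (R : realType) (s : R).
Hypothesis s0 : s != 0.
Implicit Types (a b x : R).
Local Notation mu := (@lebesgue_measure R).
Local Open Scope ereal_scope.

Let s2 : (0 < s ^+ 2 *+ 2)%R.
Proof. by rewrite pmulrn_lgt0// exprn_even_gt0. Qed.

Let pdfE x t : t != 0%R -> normal_pdf 0 t x = (normal_peak t * expR (- (x ^+ 2 / (t ^+ 2 *+ 2))))%R.
Proof. by move=> t0; rewrite (normal_pdfE 0 t0) /normal_fun subr0 mulNr. Qed.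

Let measurable_pdf t (D : set (measurableTypeR R)) :
  measurable_fun D (fun x : measurableTypeR R => (normal_pdf 0 t x)%:E).
Proof. by apply/measurable_EFinP; apply: measurable_funTS; exact: measurable_normal_pdf. Qed.

Lemma normal_prob_itv_gt0 a b : (a < b)%R -> 0 < normal_prob 0 s `]a, b[%classic.
Proof.
(* [m] bounds [x ^+ 2] on the interval whatever the signs of its ends, so the density is at least
   [c] there. *)
move=> ab; pose m : R := (a ^+ 2 + b ^+ 2)%R.
pose c : R := (normal_peak s * expR (- (m / (s ^+ 2 *+ 2))))%R.
have c0 : (0 < c)%R by rewrite mulr_gt0 ?expR_gt0// normal_peak_gt0.
have mab : measurable (`]a, b[%classic : set (measurableTypeR R)) by exact: measurable_itv.
have : \int[mu]_(x in `]a, b[%classic) cst c%:E x <= normal_prob 0 s `]a, b[%classic.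
  apply: ge0_le_integral => //.
    by move=> x _; rewrite lee_fin ltW.
  move=> x /=; rewrite in_itv /= => /andP[ax xb].
  rewrite lee_fin pdfE// ler_pM2l ?normal_peak_gt0// ler_expR lerN2.
  rewrite ler_pM2r ?invr_gt0// /m.
  by have [x0|x0] := leP 0%R x; nra.
rewrite integral_cst//; apply: lt_le_trans.
have := lebesgue_measure_itv (R := R) `]a, b[; rewrite /= lte_fin ab => ->.
by rewrite -EFinB -EFinM lte_fin mulr_gt0// subr_gt0.
Qed.

(** A bound of Chebyshev type without computing a second moment: the density is compared with that
    of deviation [2 * s], of total mass 1. Their ratio is [k] times the exponential of
    [- 3/4 * (x ^+ 2 / u)], and [expR (- y) <= y^-1] bounds it by a multiple of [1 / a ^+ 2] on the
    tail. *)
Lemma normal_prob_tail : exists2 K : R, (0 < K)%R &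
  forall a, (0 < a)%R -> normal_prob 0 s (~` `[(- a)%R, a]%classic) <= (K / a ^+ 2)%:E.
Proof.
have t0 : (2 * s != 0)%R by rewrite mulf_neq0.
have t2 : ((2 * s) ^+ 2 *+ 2 = 4 * (s ^+ 2 *+ 2))%R by rewrite -[LHS]mulr_natr -[in RHS]mulr_natr; ring.
have [k k0 hk] : exists2 k : R, (0 < k)%R & (normal_peak s = k * normal_peak (2 * s))%R.
  by exists (normal_peak s / normal_peak (2 * s))%R; rewrite ?divr_gt0 ?divfK ?gt_eqF// normal_peak_gt0.
have [u u0 hu] : exists2 u : R, (0 < u)%R & (s ^+ 2 *+ 2 = u)%R by exists (s ^+ 2 *+ 2)%R.
exists (k * (u * 2))%R; first by rewrite !mulr_gt0.
move=> a a0; pose D : set (measurableTypeR R) := ~` `[(- a)%R, a]%classic.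
have mD : measurable D by apply: measurableC; exact: measurable_itv.
have [e eE] : exists e : R, (e = k * (u * 2) / a ^+ 2)%R by eexists.
have e0 : (0 <= e)%R by rewrite eE divr_ge0 ?exprn_ge0// ltW// !mulr_gt0.
rewrite -eE.
have h1 : normal_prob 0 s D <= \int[mu]_(x in D) (e%:E * (normal_pdf 0 (2 * s) x)%:E).
  apply: ge0_le_integral => //.
  - by move=> x _; rewrite lee_fin normal_pdf_ge0.
  - by apply: emeasurable_funM; [exact: measurable_cst|exact: measurable_pdf].
  move=> x; rewrite /D /= in_itv /= => /negP xa.
  have ax : (a ^+ 2 <= x ^+ 2)%R.
    move: xa; rewrite negb_and -!ltNge => /orP[h|h]; nra.
  have x0 : (0 < x ^+ 2)%R by rewrite (lt_le_trans _ ax)// exprn_gt0.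
  rewrite -EFinM lee_fin !pdfE// t2 hu.
  have -> : (x ^+ 2 / u = x ^+ 2 / (4 * u) + 3 / 4 * (x ^+ 2 / u))%R.
    by field; rewrite gt_eqF.
  rewrite opprD expRD mulrA.
  have np := normal_peak_gt0 t0.
  rewrite hk.
  have y0 : (0 < 3 / 4 * (x ^+ 2 / u))%R by apply: mulr_gt0; [lra|exact: divr_gt0].
  have : (expR (- (3 / 4 * (x ^+ 2 / u))) <= u * 2 / a ^+ 2)%R.
    rewrite expRN; set y := (3 / 4 * _)%R in y0 *.
    apply: (@le_trans _ _ (y^-1)%R).
      by rewrite lef_pV2 ?posrE ?expR_gt0//; apply: le_trans (expR_ge1Dx y); rewrite lerDr.
    rewrite -[leRHS]invrK lef_pV2 ?posrE//; last by rewrite invr_gt0 divr_gt0 ?exprn_gt0// mulr_gt0.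
    rewrite invf_div ler_pdivrMr ?(mulr_gt0 u0)// /y.
    rewrite (_ : 3 / 4 * (x ^+ 2 / u) * (u * 2) = x ^+ 2 * (3 / 2))%R; last by field; rewrite gt_eqF.
    by move: x0 ax; move: (x ^+ 2)%R (a ^+ 2)%R => X Y; lra.
  have p0 : (0 <= k * normal_peak (2 * s) * expR (- (x ^+ 2 / (4 * u))))%R.
    by rewrite !mulr_ge0 ?expR_ge0// ltW.
  move=> /(ler_wpM2l p0) /le_trans; apply; rewrite eE le_eqVlt; apply/orP; left; apply/eqP.
  by ring.
apply: (le_trans h1); rewrite ge0_integralZl_EFin//; last by move=> x _; rewrite lee_fin normal_pdf_ge0.
rewrite -[leRHS]mule1 lee_wpmul2l ?lee_fin// -(integral_normal_pdf 0 (2 * s)).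
apply: ge0_subset_integral => //.
by move=> x _; rewrite lee_fin normal_pdf_ge0.
Qed.

End normal_estimates.

(** * Convergence of random series *)

Section weighted_series.
Variables (R : realType) (N : nat).
Local Notation C := R[i].
Local Notation V := 'cV[C]_N.
Variables (x : nat -> entireType R N) (a w : nat -> R) (W : R).
Hypotheses (a_gt0 : forall n, 0 < a n) (w_ge0 : forall n, 0 <= w n)
  (w_le : forall m, \sum_(i < m) w i <= W)
  (w_cvg : forall e, 0 < e -> exists m0, forall m, (m0 <= m)%N -> W - \sum_(i < m) w i < e)
  (x_bound : forall r, exists2 D, 0 <= D & forall n z, vnorm z <= r -> cmod (x n z) * a n <= D * w n).
Implicit Types (c u : nat -> C) (f : entireType R N) (z : V) (r e : R).

Let psum c m z := \sum_(i < m) c i * x i z.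

(** The constant [K] may depend on the random outcome, while the growth [a] does not. *)
Definition controlled (K : R) c := forall n, cmod (c n) <= K * a n.

Lemma controlled_ge0 K c : controlled K c -> 0 <= K.
Proof. by move=> /(_ 0%N) /(le_trans (cmod_ge0 _)); rewrite pmulr_lge0. Qed.

Lemma tail_bound u D m n : (forall i, cmod (u i) <= D * w i) -> (m <= n)%N -> 0 <= D ->
  cmod (\sum_(i < n) u i - \sum_(i < m) u i) <= D * (W - \sum_(i < m) w i).
Proof.
move=> hu mn D0.
have spl (M : zmodType) (F : nat -> M) : \sum_(i < n) F i - \sum_(i < m) F i = \sum_(m <= i < n) F i.
  by rewrite -!(big_mkord xpredT F) (big_cat_nat (n := m))//= addrAC subrr add0r.
rewrite spl; apply: le_trans (cmod_sum _ _ _) _.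
apply: (@le_trans _ _ (D * \sum_(m <= i < n) w i)).
  by rewrite mulr_sumr; apply: ler_sum => i _; exact: hu.
by rewrite ler_wpM2l// -spl lerD2r.
Qed.

Lemma term_bound K c D r n z : controlled K c ->
  (forall n z, vnorm z <= r -> cmod (x n z) * a n <= D * w n) -> vnorm z <= r ->
  cmod (c n * x n z) <= (K * D) * w n.
Proof.
move=> hc hD zr; rewrite cmodM; apply: (@le_trans _ _ (K * a n * cmod (x n z))).
  by rewrite ler_wpM2r ?cmod_ge0.
by rewrite -!mulrA ler_wpM2l ?(controlled_ge0 hc)// mulrC hD.
Qed.

(** The sum is characterized by its remainder, for all admissible constants at once, rather than as
    a limit: this gives locally uniform convergence as well as the comparison of sums with different
    coefficients. *)
Let is_sum c f := forall K D r, controlled K c -> 0 <= D ->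
  (forall n z, vnorm z <= r -> cmod (x n z) * a n <= D * w n) ->
  forall m z, vnorm z <= r -> cmod (f z - psum c m z) <= K * D * (W - \sum_(i < m) w i).

Let psum_entire c m : entire (psum c m).
Proof. by apply: entire_sum => i; apply: entireZ; exact: entireP. Qed.

Let sum_exists K c : controlled K c -> exists f, is_sum c f.
Proof.
move=> hc; have K0 := controlled_ge0 hc.
have cauchy z : exists l, forall e, 0 < e -> exists n0, forall n, (n0 <= n)%N -> cmod (psum c n z - l) < e.
  apply: cauchy_complex => e e0; have [D D0 hD] := x_bound (vnorm z).
  have d0 : 0 < e / 2 / (K * D + 1) by rewrite !divr_gt0// ltr_wpDl// mulr_ge0.
  have [m0 hm0] := w_cvg d0; exists m0 => n m nm mm.
  have B k : (m0 <= k)%N -> cmod (psum c k z - psum c m0 z) < e / 2.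
    move=> mk; apply: le_lt_trans (tail_bound (fun i => term_bound i hc hD (lexx _)) mk (mulr_ge0 K0 D0)) _.
    have := hm0 _ (leqnn m0); have := w_le m0; move: (\sum_(i < m0) _) => s sW.
    rewrite ltr_pdivlMr ?ltr_wpDl ?mulr_ge0// => h; apply: le_lt_trans h.
    by rewrite mulrC ler_wpM2l ?subr_ge0// lerDl.
  rewrite -(subrKA (psum c m0 z)) [e]splitr; apply: le_lt_trans (cmodD _ _) _.
  by rewrite ltrD ?B// cmodB B.
have [f0 hf0] := choice cauchy.
have lim : pw_lim (psum c) f0 by move=> z e /hf0; exact.
have bd r : exists M, forall n z, vnorm z <= r -> cmod (psum c n z) <= M.
  have [D D0 hD] := x_bound r; exists (K * D * W) => n z zr.
  have := tail_bound (fun i => term_bound i hc hD zr) (leq0n n) (mulr_ge0 K0 D0).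
  by rewrite !big_ord0 !subr0.
exists (mkEntire (weierstrass (psum_entire c) bd lim)) => K' D r hc' D0 hD m z zr.
apply/ler_addgt0Pr => e e0; have [n0 hn0] := lim z e e0.
have KD := mulr_ge0 (controlled_ge0 hc') D0.
rewrite -(subrKA (psum c (maxn n0 m) z)); apply: le_trans (cmodD _ _) _.
rewrite [leRHS]addrC lerD//.
  by rewrite cmodB ltW// hn0// leq_maxl.
exact: (tail_bound (fun i => term_bound i hc' hD zr) (leq_maxr _ _) KD).
Qed.

(* Meaningful for controlled c only: the bounds in [is_sum] hold vacuously
   otherwise. *)
Definition series_sum c : entireType R N := xget 0 [set f | is_sum c f].

Lemma series_sumP K c : controlled K c -> is_sum c (series_sum c).
Proof. by move=> /sum_exists [f hf]; exact: (xgetPex 0 (ex_intro _ f hf)). Qed.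

Lemma series_sum_lim K c z : controlled K c -> forall e, 0 < e ->
  exists m0, forall m, (m0 <= m)%N -> cmod (\sum_(i < m) c i * x i z - series_sum c z) < e.
Proof.
move=> hc e e0; have [D D0 hD] := x_bound (vnorm z).
have K0 := controlled_ge0 hc; have KD1 : 0 < K * D + 1 by rewrite ltr_wpDl// mulr_ge0.
have [m0 hm0] := w_cvg (divr_gt0 e0 KD1); exists m0 => m mm.
rewrite cmodB; apply: le_lt_trans (series_sumP hc hc D0 hD m (lexx _)) _.
have := hm0 m mm; have := w_le m; move: (\sum_(i < m) _) => s sW.
rewrite ltr_pdivlMr// => h; apply: le_lt_trans h.
by rewrite mulrC ler_wpM2l ?subr_ge0// lerDl.
Qed.

Lemma series_sum_cvg K c : controlled K c ->
  (\sum_(0 <= k < n) c k *: x k)%R @[n --> \oo] --> series_sum c.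
Proof.
move=> hc; have FF : Filter ((\sum_(0 <= k < n) c k *: x k)%R @[n --> \oo]) by exact: fmap_filter.
apply/entire_cvg_ballP => r e r0 e0; have [D D0 hD] := x_bound r.
have K0 := controlled_ge0 hc; have KD1 : 0 < K * D + 1 by rewrite ltr_wpDl// mulr_ge0.
have [m0 hm0] := w_cvg (divr_gt0 e0 KD1); exists m0 => // m /= mm z zr.
have -> : (\sum_(0 <= k < m) c k *: x k : entireType R N) z = psum c m z.
  rewrite /psum big_mkord; elim: m {mm} => [|m IH]; first by rewrite !big_ord0.
  by rewrite !big_ord_recr /= -IH.
apply: le_lt_trans (series_sumP hc hc D0 hD m zr) _.
have := hm0 m mm; have := w_le m; move: (\sum_(i < m) _) => s sW.
rewrite ltr_pdivlMr// => h; apply: le_lt_trans h.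
by rewrite mulrC ler_wpM2l ?subr_ge0// lerDl.
Qed.

(** At a fixed level of control the tails are uniformly small, so finitely many coefficients decide
    the sum on a ball up to [e]. Both the measurability of the random sum and its full support rest
    on this. *)
Lemma series_sum_near K c r e : controlled K c -> 0 <= r -> 0 < e ->
  exists m d, 0 < d /\ forall c', controlled K c' ->
    (forall i, (i < m)%N -> cmod (c' i - c i) < d) ->
    forall z, vnorm z <= r -> cmod (series_sum c z - series_sum c' z) < e.
Proof.
move=> hc r0 e0; have [D D0 hD] := x_bound r.
have K0 := controlled_ge0 hc; have KD1 : 0 < K * D + 1 by rewrite ltr_wpDl// mulr_ge0.
have e30 : 0 < e / 3 by rewrite divr_gt0.
have [m hm] := w_cvg (divr_gt0 e30 KD1).
pose s := \sum_(i < m) (D * w i / a i).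
have s0 : 0 <= s by apply: sumr_ge0 => i _; rewrite divr_ge0//; [exact: mulr_ge0|exact: ltW].
have d0 : 0 < e / 3 / (s + 1) by rewrite divr_gt0// ltr_wpDl.
exists m, (e / 3 / (s + 1)); split=> // c' hc' cc z zr.
have T : K * D * (W - \sum_(i < m) w i) < e / 3.
  have := hm m (leqnn m); have := w_le m; move: (\sum_(i < m) _) => t tW.
  rewrite ltr_pdivlMr// => h; apply: le_lt_trans h.
  by rewrite mulrC ler_wpM2l ?subr_ge0// lerDl.
have h1 := le_lt_trans (series_sumP hc hc D0 hD m zr) T.
have h2 := le_lt_trans (series_sumP hc' hc' D0 hD m zr) T.
have h3 : cmod (psum c m z - psum c' m z) <= e / 3.
  rewrite /psum -sumrB; apply: le_trans (cmod_sum _ _ _) _.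
  apply: (@le_trans _ _ (\sum_(i < m) (e / 3 / (s + 1)) * (D * w i / a i))).
    apply: ler_sum => i _; rewrite -mulrBl cmodM ler_pM ?cmod_ge0//.
      by rewrite cmodB ltW// cc.
    by rewrite ler_pdivlMr// hD.
  by rewrite -mulr_sumr -/s mulrAC ler_pdivrMr ?ltr_wpDl// ler_wpM2l ?lerDl// ltW.
rewrite -(subrKA (psum c m z)); apply: le_lt_trans (cmodD _ _) _.
rewrite -(subrKA (psum c' m z) (psum c m z)).
have := cmodD (psum c m z - psum c' m z) (psum c' m z - series_sum c' z).
rewrite [X in _ <= _ + X]cmodB.
by move: h1 h2 h3; move: (cmod _) (cmod _) (cmod _) (cmod _) => p q t u; lra.
Qed.

Lemma series_sum_unique K c l z : controlled K c -> (forall e, 0 < e ->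
  exists m0, forall m, (m0 <= m)%N -> cmod (\sum_(i < m) c i * x i z - l) < e) ->
  series_sum c z = l.
Proof.
move=> hc hl; apply/eqP; rewrite -subr_eq0; apply/eqP/eq0_small => e e0.
have e20 : 0 < e / 2 by rewrite divr_gt0.
have [m hm] := series_sum_lim z hc e20; have [n hn] := hl _ e20.
rewrite -(subrKA (\sum_(i < maxn m n) c i * x i z)).
apply: le_trans (cmodD _ _) _; rewrite [e]splitr ltW// ltrD//.
  by rewrite cmodB hm// leq_maxl.
by rewrite hn// leq_maxr.
Qed.

(** T moves each nonzero term along its chain, hence to an unrelated place in the enumeration of
    pairs. Domination by [D * w n] makes the order of summation irrelevant. *)
Lemma series_reindex u (t : nat -> nat) D l : 0 <= D -> injective t ->
  (forall n, cmod (u n) <= D * w n) -> (forall m, (forall n, m <> t n) -> u m = 0) ->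
  (forall e, 0 < e -> exists n0, forall n, (n0 <= n)%N -> cmod (\sum_(i < n) u (t i) - l) < e) ->
  forall e, 0 < e -> exists n0, forall n, (n0 <= n)%N -> cmod (\sum_(i < n) u i - l) < e.
Proof.
move=> D0 tinj hu u0 hl e e0.
have e20 : 0 < e / 3 by rewrite divr_gt0.
have D1 : 0 < D + 1 by rewrite ltr_wpDl.
have [M hM] := w_cvg (divr_gt0 e20 D1); have [n1 hn1] := hl _ e20.
have small m : (M <= m)%N -> D * (W - \sum_(i < m) w i) <= e / 3.
  move=> Mm; have := hM m Mm; have := w_le m; move: (\sum_(i < m) _) => s sW.
  rewrite ltr_pdivlMr// => /ltW; apply: le_trans.
  by rewrite mulrC ler_wpM2l ?subr_ge0// lerDl.
(* The indices below [M] that are values of [t] are finitely many, so they are all reached before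
   some rank [n2]. *)
have [n2 hn2] : exists n2, forall m, (m < M)%N -> (exists n, m = t n) -> exists2 n, (n < n2)%N & m = t n.
  elim: M {hM small} => [|M [n2 IH]]; first by exists 0%N.
  have [[n Mn]|nM] := pselect (exists n, M = t n).
    exists (maxn n2 n.+1) => m; rewrite ltnS leq_eqVlt => /predU1P[->|mM] ex.
      by exists n => //; rewrite leq_max leqnn orbT.
    by have [k kn ->] := IH m mM ex; exists k => //; rewrite leq_max kn.
  exists n2 => m; rewrite ltnS leq_eqVlt => /predU1P[->//|mM]; exact: IH.
exists M => n Mn.
(* [v] keeps the first [k] terms along [t] and is 0 elsewhere. Since [n2 <= k], it agrees with [u]
   below [M]; beyond [M] both have small tails. *)
pose k := maxn n1 n2; pose L := (maxn n (\max_(i < k) t i)).+1.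
pose v m := if m \in [seq t i | i <- iota 0 k] then u m else 0.
have vE : \sum_(i < k) u (t i) = \sum_(i < L) v i.
  rewrite -(big_mkord xpredT (fun i => u (t i))) -(big_mkord xpredT v) -big_mkcond /=.
  rewrite /index_iota !subn0 -(big_map t xpredT u) -[RHS]big_filter.
  apply: perm_big; apply: uniq_perm; first by rewrite map_inj_uniq ?iota_uniq.
    by rewrite filter_uniq ?iota_uniq.
  move=> i; rewrite mem_filter; case: (boolP (i \in map _ _)) => // /mapP[j].
  rewrite !mem_iota !add0n => /andP[_ jk] ->; rewrite ltnS leq_max; apply/esym/orP; right.
  exact: (leq_bigmax (Ordinal jk)).
have vu m : (m < M)%N -> v m = u m.
  move=> mM; rewrite /v; case: ifPn => // mt; rewrite u0// => j mj.
  have [i in2 mi] := hn2 m mM (ex_intro _ j mj); move/negP: mt; apply.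
  by apply/mapP; exists i => //; rewrite mem_iota add0n /= leq_max in2 orbT.
have hv i : cmod (v i) <= D * w i.
  by rewrite /v; case: ifP => // _; rewrite cmod0 mulr_ge0.
have ML : (M <= L)%N by rewrite leqW// leq_max Mn.
have h1 := le_trans (tail_bound hv ML D0) (small M (leqnn M)).
have h2 := le_trans (tail_bound hu Mn D0) (small M (leqnn M)).
have h3 := hn1 k (leq_maxl _ _); rewrite vE in h3.
have E : \sum_(i < M) v i = \sum_(i < M) u i by apply: eq_bigr => i _; exact: vu.
rewrite E in h1; move: h1 h2 h3.
move: (\sum_(i < L) v i) (\sum_(i < M) u i) (\sum_(i < n) u i) => p q s h1 h2 h3.
have -> : s - l = (s - q) + ((q - p) + (p - l)) by rewrite addrA !subrKA.
apply: le_lt_trans (cmodD _ _) _; have := cmodD (q - p) (p - l); rewrite [X in _ <= X + _]cmodB.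
by move: h1 h2 h3; move: (cmod _) (cmod _) (cmod _) (cmod _) => *; lra.
Qed.

End weighted_series.

(** * Enumeration of pairs of indices and summable weights *)

Lemma exists_pairing : exists (e : nat -> nat * nat) (e' : nat * nat -> nat),
  cancel e e' /\ cancel e' e.
Proof.
have /card_set_bijP [f] := card_nat2; rewrite setTT_bijective => -[g fg gf].
by exists g, f.
Qed.

Definition box J : seq (nat * nat) := [seq (j, k) | j <- iota 0 J, k <- iota 0 J].

Lemma mem_box J q : (q \in box J) = (q.1 < J)%N && (q.2 < J)%N.
Proof.
case: q => j k; rewrite /box; apply/allpairsP/idP => [[[j' k'] /= []]|/andP[jJ kJ]].
  by rewrite !mem_iota !add0n /= => j'J k'J [-> ->]; rewrite j'J.
by exists (j, k); rewrite !mem_iota !add0n.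
Qed.

Lemma uniq_box J : uniq (box J).
Proof. by apply: allpairs_uniq; rewrite ?iota_uniq// => -[a b] [c d]. Qed.

(** Finite families indexed by arbitrary pairs are thereby padded to squares, where sums and
    products become iterated ones. *)
Lemma box_perm (s : seq (nat * nat)) : uniq s ->
  exists J, perm_eq s [seq q <- box J | q \in s].
Proof.
move=> us; exists (\max_(q <- s) (maxn q.1 q.2)).+1.
apply: uniq_perm => //; first by rewrite filter_uniq ?uniq_box.
move=> q; rewrite mem_filter mem_box; case: (boolP (q \in s)) => //= qs.
have := leq_bigmax_seq (F := fun q : nat * nat => maxn q.1 q.2) (P := xpredT) q qs isT.
by rewrite geq_max !ltnS => /andP[-> ->].
Qed.

Section sums.
Variable R : realType.

Lemma sum_sup (w : nat -> R) (B : R) : (forall n, 0 <= w n) ->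
  (forall m, \sum_(i < m) w i <= B) -> exists W,
  (forall m, \sum_(i < m) w i <= W) /\
  forall e, 0 < e -> exists m0, forall m, (m0 <= m)%N -> W - \sum_(i < m) w i < e.
Proof.
move=> w0 wB; pose E := range (fun m => \sum_(i < m) w i).
have hE : has_sup E.
  by split; [exists (\sum_(i < 0) w i), 0%N|exists B => _ [m _ <-]].
exists (sup E); split=> [m|e e0]; first by apply: ub_le_sup; [case: hE|exists m].
have [_ [m0 _ <-] h] := sup_adherent e0 hE; exists m0 => m mm.
have : \sum_(i < m0) w i <= \sum_(i < m) w i.
  rewrite -!(big_mkord xpredT w) [leRHS](big_cat_nat (n := m0))//= lerDl.
  by apply: sumr_ge0.
by move: h; move: (\sum_(i < m0) _) (\sum_(i < m) _) (sup E) => x y z; lra.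
Qed.

Lemma geometric_sum_le2 J (y : R) : 0 <= y <= 2^-1 -> \sum_(j <- iota 0 J) y ^+ j <= 2.
Proof.
move=> /andP[y0 y1]; suff : \sum_(j <- iota 0 J) y ^+ j <= 2 - 2 * y ^+ J.
  by move=> /le_trans; apply; rewrite gerBl mulr_ge0// exprn_ge0.
elim: J => [|J IH]; first by rewrite big_nil expr0 mulr1 subrr.
rewrite -addn1 iotaD big_cat big_seq1 /= add0n addn1 exprS.
have : 0 <= y ^+ J by exact: exprn_ge0.
by move: IH; move: (\sum_(_ <- _) _) (y ^+ J) => s t; nra.
Qed.

Variables (e : nat -> nat * nat) (e' : nat * nat -> nat).
Hypothesis (eK : cancel e e').
(** The ratio 1/4 is the product of the decay 1/8 of the functions and the growth 2 allowed to the
    coefficients, and also the inverse square of the latter. *)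
Definition weight n : R := 4^-1 ^+ ((e n).1 + (e n).2).

Lemma weight_sum m : \sum_(i < m) weight i <= 4.
Proof.
have [J hJ] : exists J, perm_eq [seq e i | i <- iota 0 m] [seq q <- box J | q \in [seq e i | i <- iota 0 m]].
  by apply: box_perm; rewrite map_inj_uniq ?iota_uniq//; exact: can_inj eK.
rewrite -(big_mkord xpredT weight) /index_iota subn0.
rewrite -(big_map e xpredT (fun q => 4^-1 ^+ (q.1 + q.2))) (perm_big _ hJ) /=.
have q0 n : 0 <= 4^-1 ^+ n :> R by rewrite exprn_ge0// invr_ge0.
rewrite big_filter big_mkcond /=.
apply: (@le_trans _ _ (\sum_(q <- box J) 4^-1 ^+ (q.1 + q.2))).
  by apply: ler_sum => q _; case: ifP.
rewrite /box big_allpairs /=.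
under eq_bigr => j _.
  under eq_bigr => k _ do rewrite exprD.
  rewrite -mulr_sumr; over.
rewrite -mulr_suml [leRHS](_ : 4 = 2 * 2); last by lra.
have h : \sum_(j <- iota 0 J) (4^-1 : R) ^+ j <= 2.
  by apply: geometric_sum_le2; apply/andP; split; lra.
have h0 : 0 <= \sum_(j <- iota 0 J) (4^-1 : R) ^+ j by rewrite sumr_ge0.
exact: ler_pM.
Qed.

End sums.

Section chain_system.
Variables (R : realType) (N : nat).
Local Notation C := R[i].
Local Notation V := 'cV[C]_N.
Variables (A : 'M[C]_N) (v b p : V) (M : {vspace V}).
Hypothesis (A_invertible : A \in unitmx) (v_neq0 : v != 0).
Hypothesis (p_fixed : affine A b p = p) (v_in_M : v \in M) (M_reduces : reduces M A).
Hypothesis (M_norm : (operator_norm ((restriction A M)^-1)%VF < 1)%E).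
Variables (e : nat -> nat * nat) (e' : nat * nat -> nat).
Hypothesis (eK : cancel e e') (e'K : cancel e' e).

(* The j-th chain is scaled by its bound on the ball of radius j, so that on the
   ball of radius r only the finitely many chains with j < r are not yet under
   control. *)
Lemma scaled_chains : exists xi : nat -> nat -> entireType R N,
  [/\ forall j, opT A b v (xi j 0%N) = 0,
      forall j k, opT A b v (xi j k.+1) = xi j k,
      forall r, exists2 D, 0 <= D & forall j k z, vnorm z <= r ->
        cmod (xi j k z) <= D * 8^-1 ^+ (j + k)
    & forall f r d, entire f -> 0 <= r -> 0 < d -> exists m (c : nat -> C),
        (forall i, (m <= i)%N -> c i = 0) /\
        forall z, vnorm z <= r -> cmod (f z - \sum_(i < m) c i * xi (e i).1 (e i).2 z) < d].
Proof.
pose ch := chain A_invertible v_neq0 p_fixed.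
have bnd := chain_bound A_invertible v_neq0 p_fixed v_in_M M_reduces M_norm.
have hK0 j : exists K, 0 <= K /\ forall k z, vnorm z <= j%:R -> cmod (ch j k z) <= K * 8^-1 ^+ k.
  by have [K K0 hK] := bnd j j%:R; exists K.
have [K hK] := choice hK0.
pose s j : R := 8^-1 ^+ j / (1 + K j).
have K1 j : 0 < 1 + K j by rewrite ltr_pwDl//; case: (hK j).
have s0 j : 0 < s j by rewrite divr_gt0// exprn_gt0// invr_gt0.
exists (fun j k => ofR (s j) *: ch j k); split.
- by move=> j; rewrite linearZ /= opT_chain0 scaler0.
- by move=> j k; rewrite linearZ /= opT_chainS.
- move=> r.
  have hL0 j : exists L, 0 <= L /\ forall k z, vnorm z <= r -> cmod (ch j k z) <= L * 8^-1 ^+ k.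
    by have [L L0 hL] := bnd j r; exists L.
  have [L hL] := choice hL0.
  pose n := (Num.trunc r).+1.
  exists (1 + \sum_(j < n) L j / (1 + K j)).
    rewrite addr_ge0// sumr_ge0// => j _; rewrite divr_ge0//; [by case: (hL j)|exact: ltW].
  move=> j k z zr; rewrite -[(_ *: _ : entireType R N) z]/(ofR (s j) * ch j k z) cmodM cmod_ofR.
  rewrite gtr0_norm//.
  have e0 i : 0 <= 8^-1 ^+ i :> R by rewrite exprn_ge0// invr_ge0.
  have [Bj hB1 hB2] : exists2 B, cmod (ch j k z) <= B * 8^-1 ^+ k &
      B / (1 + K j) <= 1 + \sum_(j < n) L j / (1 + K j).
    have S0 : 0 <= \sum_(j < n) L j / (1 + K j).
      by rewrite sumr_ge0// => i _; rewrite divr_ge0//; [case: (hL i)|exact: ltW].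
    have [jn|nj] := ltnP j n.
      exists (L j); first by case: (hL j) => _; exact.
      rewrite (bigD1 (Ordinal jn))//= addrCA lerDl addr_ge0// sumr_ge0// => i _.
      by rewrite divr_ge0//; [case: (hL i)|exact: ltW].
    exists (K j).
      case: (hK j) => _; apply; apply: (le_trans zr); apply: (@le_trans _ _ n%:R).
        exact: ltW (truncnS_gt r).
      by rewrite ler_nat.
    by rewrite ler_wpDr// ler_pdivrMr// mul1r lerDr.
  apply: (@le_trans _ _ (s j * (Bj * 8^-1 ^+ k))); first by rewrite ler_wpM2l// ltW.
  rewrite (_ : s j * _ = Bj / (1 + K j) * 8^-1 ^+ (j + k)).
    by rewrite ler_wpM2r.
  by rewrite exprD /s; move: (8^-1 ^+ j) (8^-1 ^+ k) (1 + K j)^-1 => *; ring.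
move=> f r d hf r0 d0.
pose xi n : entireType R N := ofR (s (e n).1) *: ch (e n).1 (e n).2.
(* The coefficients are sequences that vanish from some rank on, so that two combinations can be
   padded to a common length and added. *)
pose W (f : V -> C) := exists m (c : nat -> C), (forall i, (m <= i)%N -> c i = 0) /\
  forall z, f z = \sum_(i < m) c i * xi i z.
have ext m n (c : nat -> C) z : (forall i, (m <= i)%N -> c i = 0) -> (m <= n)%N ->
    \sum_(i < n) c i * xi i z = \sum_(i < m) c i * xi i z.
  move=> c0 mn; rewrite -!(big_mkord xpredT (fun i => c i * xi i z)).
  rewrite (big_cat_nat (n := m))//= -[RHS]addr0; congr (_ + _); rewrite big_nat_cond; apply: big1 => i.
  by rewrite andbT => /andP[mi _]; rewrite c0// mul0r.
have WD : closedD W.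
  move=> g h [m [c [c0 hg]]] [n [c' [c'0 hh]]]; exists (maxn m n), (fun i => c i + c' i).
  split=> [i|z]; first by rewrite geq_max => /andP[mi ni]; rewrite c0// c'0// addr0.
  rewrite hg hh -(ext m (maxn m n) c z c0 (leq_maxl _ _)) -(ext n (maxn m n) c' z c'0 (leq_maxr _ _)).
  by rewrite -big_split; apply: eq_bigr => i _; rewrite mulrDl.
have WZ : closedZ W.
  move=> a g [m [c [c0 hg]]]; exists m, (fun i => a * c i); split=> [i mi|z].
    by rewrite c0// mulr0.
  by rewrite hg mulr_sumr; apply: eq_bigr => i _; rewrite mulrA.
have Wch j k : W (ch j k).
  pose n := e' (j, k); exists n.+1, (fun i => if i == n then (ofR (s j))^-1 else 0).
  split=> [i ni|z]; first by rewrite gtn_eqF.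
  rewrite big_ord_recr /= big1; last first.
    by move=> i _; rewrite ltn_eqF ?mul0r.
  have sn0 : ofR (s j) != 0 by rewrite -cmod_eq0 cmod_ofR gtr0_norm// gt_eqF.
  rewrite eqxx add0r; transitivity ((ofR (s j))^-1 * (ofR (s j) * ch j k z)); first by rewrite mulKf.
  by rewrite /xi /n e'K.
have [deg [q [hq fq]]] := poly_dense p hf (addr_ge0 r0 (vnorm_ge0 p)) d0.
have [m [c [c0 hc]]] := span_chain WD WZ Wch hq.
exists m, c; split=> // z zr; rewrite -[X in _ - X]hc; apply: fq.
by apply: le_trans (vnormD _ _) _; rewrite vnormN lerD2r.
Qed.

End chain_system.

(** * Independent fields *)

Section iid_field.
Variable R : realType.
Local Notation coin := (coin R).
Local Notation pr := (pr coin).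
Implicit Types (o : bits) (A B : set cantorT).

Lemma pr_split A B : measurable A -> measurable B ->
  pr (evens @^-1` A `&` odds @^-1` B) = pr A * pr B.
Proof.
move=> mA mB; apply: EFin_inj; rewrite EFinM -!prE//; first exact: coin_split.
apply: measurableI; first exact: measurable_preimage measurable_evens mA.
exact: measurable_preimage measurable_odds mB.
Qed.

Definition digits k o : bits := evens (iter k odds o).

Lemma measurable_digits k : measurable_fun setT (digits k : cantorT -> cantorT).
Proof. exact: measurableT_comp measurable_evens (measurable_iter_odds k). Qed.

Let all_digits (A : nat -> set cantorT) K : set cantorT :=
  [set o | forall k, (k < K)%N -> A k (digits k o)].

Let measurable_all (A : nat -> set cantorT) K : (forall k, measurable (A k)) ->
  measurable (all_digits A K).
Proof.
move=> mA; rewrite (_ : all_digits A K = \bigcap_(k in `I_K) (digits k @^-1` A k)).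
  by apply: bigcap_measurableType => k _; exact: measurable_preimage (measurable_digits k) (mA k).
by apply/seteqP; split=> o h k; exact: h.
Qed.

Let pr_all (A : nat -> set cantorT) K : (forall k, measurable (A k)) ->
  pr (all_digits A K) = \prod_(k < K) pr (A k).
Proof.
elim: K A => [|K IH] A mA.
  rewrite big_ord0 -(prT coin); congr (pr _); apply/seteqP; split=> // o _ [].
have E : \prod_(i < K) pr (A (lift ord0 i)) = pr (all_digits (fun k => A k.+1) K) by rewrite IH.
rewrite big_ord_recl E -pr_split//; last exact: measurable_all.
congr (pr _); apply/seteqP; split=> o /=.
  move=> h; split; first exact: (h 0%N).
  by move=> k kK; have := h k.+1 kK; rewrite /digits iterSr.
move=> [h0 h] [|k] kK; first exact: h0.
by have := h k kK; rewrite /digits iterSr.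
Qed.

(** The rank [k] in the chain is split off first and the chain [j] within it: [odds] then raises [k]
    in all the chains at once. *)
Definition field j k o : bits := digits j (digits k o).

Lemma field_odds j k o : field j k (odds o) = field j k.+1 o.
Proof. by rewrite /field /digits -iterSr. Qed.

Variables (e : nat -> nat * nat) (e' : nat * nat -> nat).
Hypothesis (eK : cancel e e') (e'K : cancel e' e).

Definition iid n o : bits := field (e n).1 (e n).2 o.

Lemma measurable_iid n : measurable_fun setT (iid n : cantorT -> cantorT).
Proof. exact: measurableT_comp (measurable_digits _) (measurable_digits _). Qed.

Lemma pr_iid (s : seq nat) (B : nat -> set cantorT) : uniq s ->
  (forall n, measurable (B n)) ->
  pr [set o | forall n, n \in s -> B n (iid n o)] = \prod_(n <- s) pr (B n).
Proof.
move=> us mB; have [J hJ] : exists J, perm_eq (map e s) [seq q <- box J | q \in map e s].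
  by apply: box_perm; rewrite map_inj_uniq//; exact: can_inj eK.
(* Trivial constraints on the other pairs extend the family to a full square, so that [pr_all]
   applies to the ranks [k] and then to the chains [j] within each of them. *)
pose A q := if q \in map e s then B (e' q) else setT.
have mA q : measurable (A q) by rewrite /A; case: ifP => // _; exact: measurableT.
have -> : \prod_(n <- s) pr (B n) = \prod_(q <- box J) pr (A q).
  under eq_bigr => n _ do rewrite -[n in B n]eK.
  rewrite -(big_map e xpredT (fun q => pr (B (e' q)))) (perm_big _ hJ) /= big_filter big_mkcond /=.
  by apply: eq_bigr => q _; rewrite /A; case: ifP => // _; rewrite prT.
pose A' k := all_digits (fun j => A (j, k)) J.
have -> : \prod_(q <- box J) pr (A q) = \prod_(k < J) pr (A' k).
  rewrite /box big_allpairs /= exchange_big /=.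
  rewrite -[RHS](big_mkord xpredT (fun k => pr (A' k))) /index_iota subn0.
  apply: eq_bigr => k _; rewrite /A' pr_all//.
  by rewrite -[RHS](big_mkord xpredT (fun j => pr (A (j, k)))) /index_iota subn0.
rewrite -pr_all; last by move=> k; exact: measurable_all.
congr (pr _); apply/seteqP; split=> o /=.
  move=> h k kJ j jJ; rewrite /A; case: ifPn => // /mapP[n ns jk].
  by rewrite jk eK; have := h n ns; rewrite /iid -jk.
move=> h n ns; have : e n \in map e s by exact: map_f.
rewrite (perm_mem hJ) mem_filter mem_box => /and3P[_ h1 h2].
by have := h _ h2 _ h1; rewrite -surjective_pairing /A map_f// eK.
Qed.

Lemma pr_iid1 n B : measurable B -> pr (iid n @^-1` B) = pr B.
Proof.
move=> mB; have := @pr_iid [:: n] (fun=> B) isT (fun=> mB); rewrite big_seq1 => <-.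
congr (pr _); apply/seteqP; split=> o /= h; last by apply: h; rewrite inE.
by move=> k; rewrite inE => /eqP ->.
Qed.

Lemma measurable_iid_all (D : nat -> set cantorT) : (forall n, measurable (D n)) ->
  measurable [set o : cantorT | forall n, D n (iid n o)].
Proof.
move=> mD; rewrite (_ : [set _ | _] = \bigcap_n (iid n @^-1` D n)).
  by apply: bigcapT_measurable => n; exact: measurable_preimage (measurable_iid n) (mD n).
by apply/seteqP; split=> o h n; [move=> _|]; exact: h.
Qed.

(** An infinite product of positive numbers may vanish. The inequality between a product and 1 minus
    the sum of the [1 - pr (D n)] keeps the product from rank [m] on above 1/2, and the finitely
    many other factors are positive. *)
Lemma pr_iid_gt0 (D : nat -> set cantorT) m : (forall n, measurable (D n)) ->
  (forall n, 0 < pr (D n)) ->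
  (forall l, \sum_(m <= n < l) (1 - pr (D n)) <= 2^-1) ->
  0 < pr [set o | forall n, D n (iid n o)].
Proof.
move=> mD D0 hm; pose F l : set cantorT := [set o | forall n, n \in iota 0 l -> D n (iid n o)].
have mF l : measurable (F l).
  rewrite (_ : F l = \bigcap_(n in [set` iota 0 l]) (iid n @^-1` D n)) //.
  by apply: bigcap_measurableType => n _; exact: measurable_preimage (measurable_iid n) (mD n).
have dF l : F l.+1 `<=` F l.
  by move=> o h n; rewrite mem_iota add0n => /andP[_ nl]; apply: h; rewrite mem_iota add0n (leqW nl).
have := pr_nonincreasing (P := coin) mF dF.
have -> : \bigcap_n F n = [set o | forall n, D n (iid n o)].
  apply/seteqP; split=> o /= h; last by move=> n _ k _; exact: h.
  by move=> n; apply: (h n.+1 I); rewrite mem_iota add0n ltnSn.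
pose c := \prod_(0 <= n < m) pr (D n).
have c0 : 0 < c by apply: prodr_gt0.
have lo l : (m <= l)%N -> c / 2 <= pr (F l).
  move=> ml; rewrite /F pr_iid ?iota_uniq//.
  have -> : \prod_(n <- iota 0 l) pr (D n) = c * \prod_(m <= n < l) pr (D n).
    by rewrite /c -(big_cat_nat (n := m))// /index_iota subn0.
  rewrite ler_pM2l//; apply: (@le_trans _ _ (1 - \sum_(m <= n < l) (1 - pr (D n)))).
    by have := hm l; lra.
  elim: l ml => [|l IH] ml; first by rewrite !big_geq// subr0.
  move: ml; rewrite leq_eqVlt => /predU1P[<-|]; first by rewrite !big_geq// subr0.
  rewrite ltnS => ml; rewrite !big_nat_recr//=.
  have D1 : pr (D l) <= 1 by exact: pr_le1.
  have P1 : \prod_(m <= i < l) pr (D i) <= 1.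
    elim: l {ml IH D1} => [|l IH]; first by rewrite big_geq.
    have [ml|lm] := leqP m l; last by rewrite big_geq.
    by rewrite big_nat_recr//= mulr_ile1// ?pr_le1 ?pr_ge0// prodr_ge0// => i _; exact: pr_ge0.
  have := IH ml; have := pr_ge0 coin (D l).
  by move: D1 P1; move: (pr (D l)) (\prod_(m <= i < l) _) (\sum_(m <= i < l) _) => x y z; nra.
move=> h; rewrite (lt_le_trans (divr_gt0 c0 (ltr0n R 2)))// -(cvg_lim _ h)//.
apply: limr_ge; first exact: cvgP h.
by near=> l; apply: lo; near: l; exact: nbhs_infty_ge.
Unshelve. all: by end_near. Qed.

End iid_field.

Section borel_measurability.
Variables (K : numDomainType) (X : tvsType K).

(* Separability of the target is not needed: the countable family lives on the
   source. *)
Lemma measurable_to_borel d (T : measurableType d) (f : T -> borel X) (I : countType)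
  (B : I -> set T) : (forall i, measurable (B i)) ->
  (forall U t, @open X U -> U (f t) -> exists2 i, B i t & B i `<=` f @^-1` U) ->
  measurable_fun setT f.
Proof.
move=> mB hB; apply: (@measurability _ _ T (borel X) setT f (@open X)) => // _ [U oU <-].
rewrite setTI.
rewrite (_ : f @^-1` U = \bigcup_i (if `[< B i `<=` f @^-1` U >] then B i else set0)).
  apply: countable_bigcupT_measurable => [|i]; first exact: countableP.
  by case: ifP => // _; exact: measurable0.
apply/seteqP; split=> t /=.
  by move=> Ut; have [i Bt BU] := hB U t oU Ut; exists i => //; rewrite asboolT.
by move=> [i _]; case: ifP => // /asboolP BU /BU.
Qed.

Lemma measurable_continuous_borel (f : X -> X) : continuous f ->
  measurable_fun setT (f : borel X -> borel X).
Proof.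
move=> cf; apply: (@measurability _ _ (borel X) (borel X) setT f (@open X)) => // _ [U oU <-].
rewrite setTI; apply: sub_sigma_algebra.
by apply: open_comp => // x _; exact: cf.
Qed.

End borel_measurability.

(** * Complex Gaussian variables built from coin tossing *)

Section gaussian_variables.
Variable R : realType.
Local Notation C := R[i].
Local Notation coin := (coin R).
Local Notation pr := (pr coin).
Implicit Types (o : bits) (c z : C) (a r : R).

Let sigma : R := Num.sqrt 2^-1.

Let sigma0 : sigma != 0.
Proof. by rewrite gt_eqF// sqrtr_gt0 invr_gt0. Qed.

Let nu : probability (measurableTypeR R) R := normal_prob 0 sigma.

Definition gauss o : R := quantile nu o.

Lemma measurable_gauss : measurable_fun setT (gauss : cantorT -> measurableTypeR R).
Proof. exact: measurable_quantile. Qed.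

Definition cgauss o : C := Complex (gauss (evens o)) (gauss (odds o)).

Lemma measurable_Re_cgauss : measurable_fun setT (fun o : cantorT => gauss (evens o) : measurableTypeR R).
Proof. exact: measurableT_comp measurable_gauss measurable_evens. Qed.

Lemma measurable_Im_cgauss : measurable_fun setT (fun o : cantorT => gauss (odds o) : measurableTypeR R).
Proof. exact: measurableT_comp measurable_gauss measurable_odds. Qed.

Lemma coin_cgauss (U V : set (measurableTypeR R)) : measurable U -> measurable V ->
  coin ((fun o => complex.Re (cgauss o)) @^-1` U `&` (fun o => complex.Im (cgauss o)) @^-1` V) =
  (normal_prob 0 sigma U * normal_prob 0 sigma V)%E.
Proof.
move=> mU mV.
transitivity (coin (evens @^-1` (gauss @^-1` U) `&` odds @^-1` (gauss @^-1` V))) => //.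
rewrite coin_split; [|exact: measurable_preimage measurable_gauss mU|exact: measurable_preimage measurable_gauss mV].
by rewrite !coin_quantile.
Qed.

Lemma rational_near a r : 0 < r -> exists q : rat, `|a - ratr q| < r.
Proof.
move=> r0; have /rat_in_itvoo [q] : a - r < a + r by lra.
by rewrite in_itv /= => qx; exists q; rewrite distrC ltr_distl.
Qed.

Lemma inv_natS_lt r : 0 < r -> exists k, k.+1%:R^-1 < r.
Proof.
move=> r0; exists (Num.trunc r^-1); rewrite invf_plt ?posrE//.
exact: truncnS_gt.
Qed.

Definition near_rect c r : set cantorT :=
  [set o | `|gauss (evens o) - complex.Re c| < r /\ `|gauss (odds o) - complex.Im c| < r].

Let near_rectE c r : near_rect c r =
  (fun o => complex.Re (cgauss o)) @^-1` `]complex.Re c - r, complex.Re c + r[ `&`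
  (fun o => complex.Im (cgauss o)) @^-1` `]complex.Im c - r, complex.Im c + r[.
Proof.
by apply/seteqP; split=> o; rewrite /near_rect /= !in_itv /= !ltr_distl.
Qed.

Lemma measurable_near_rect c r : measurable (near_rect c r).
Proof.
rewrite near_rectE; apply: measurableI.
  exact: measurable_preimage measurable_Re_cgauss (measurable_itv _).
exact: measurable_preimage measurable_Im_cgauss (measurable_itv _).
Qed.

Lemma pr_near_rect c r : 0 < r -> 0 < pr (near_rect c r).
Proof.
move=> r0; rewrite -lte_fin -prE; last exact: measurable_near_rect.
rewrite near_rectE.
have E := coin_cgauss (measurable_itv `]complex.Re c - r, complex.Re c + r[)
  (measurable_itv `]complex.Im c - r, complex.Im c + r[).
apply: (eq_ind_r (fun t => (0 < t)%E) _ E).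
by apply: mule_gt0; apply: normal_prob_itv_gt0 => //; lra.
Qed.

Definition small_square a : set cantorT :=
  [set o | `|gauss (evens o)| <= a /\ `|gauss (odds o)| <= a].

Lemma measurable_small_square a : measurable (small_square a).
Proof.
rewrite (_ : small_square a = (fun o => complex.Re (cgauss o)) @^-1` `[- a, a] `&`
  (fun o => complex.Im (cgauss o)) @^-1` `[- a, a]).
  apply: measurableI.
    exact: measurable_preimage measurable_Re_cgauss (measurable_itv _).
  exact: measurable_preimage measurable_Im_cgauss (measurable_itv _).
by apply/seteqP; split=> o; rewrite /small_square /= !in_itv /= !ler_norml.
Qed.

Lemma pr_small_square : exists2 T : R, 0 < T &
  forall a, 0 < a -> 1 - pr (small_square a) <= T / a ^+ 2.
Proof.
have [T T0 hT] := normal_prob_tail sigma0; exists (2 * T); first by rewrite mulr_gt0.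
move=> a a0; rewrite -pr_setC; last exact: measurable_small_square.
pose I : set (measurableTypeR R) := ~` `[- a, a]%classic.
have mI : measurable I by apply: measurableC; exact: measurable_itv.
have mE : measurable ((fun o => gauss (evens o)) @^-1` I : set cantorT) :=
  measurable_preimage measurable_Re_cgauss mI.
have mO : measurable ((fun o => gauss (odds o)) @^-1` I : set cantorT) :=
  measurable_preimage measurable_Im_cgauss mI.
have mG : measurable (gauss @^-1` I : set cantorT) := measurable_preimage measurable_gauss mI.
have hI : coin (gauss @^-1` I) = nu I by exact: coin_quantile.
have le (P : set cantorT) : measurable P -> coin P = nu I -> pr P <= T / a ^+ 2.
  by move=> mP e; rewrite -lee_fin -prE//; apply: (eq_ind_r (fun t => (t <= _)%E) _ e); exact: hT.
have h1 := le _ mE (etrans (coin_evens R mG) hI).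
have h2 := le _ mO (etrans (coin_odds R mG) hI).
rewrite -mulrA mulr_natl mulr2n; apply: le_trans (lerD h1 h2); apply: le_trans (le_prU _ mE mO).
apply: le_pr; [by apply: measurableC; exact: measurable_small_square|exact: measurableU|].
have IE x : I x = ~ (`|x| <= a) by rewrite /I /setC /= in_itv /= ler_norml.
by move=> o; rewrite /small_square /= => /not_andP[h|h]; [left|right]; rewrite /preimage /= IE.
Qed.

Lemma cgauss_near c r : near_rect c r `<=` [set o | cmod (cgauss o - c) < 2 * r].
Proof.
move=> o [h1 h2] /=; apply: le_lt_trans (cmod_le_ReIm _) _.
by rewrite ReB ImB mulr_natl mulr2n ltrD.
Qed.

Lemma measurable_cgauss : measurable_fun setT (cgauss : cantorT -> borel C).
Proof.
pose B (i : rat * rat * nat) : set cantorT := near_rect (Complex (ratr i.1.1) (ratr i.1.2)) i.2.+1%:R^-1.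
apply: (@measurable_to_borel _ _ _ _ _ _ B) => [i|U o oU Uo]; first exact: measurable_near_rect.
have /nbhs_cmodP [d d0 hd] : nbhs (cgauss o) U by exact: open_nbhs_nbhs.
(* [o] and [o'] are compared through the rational center of the rectangle, each at distance less
   than [2 / (k + 1)]. *)
have [k hk] := inv_natS_lt (divr_gt0 d0 (ltr0n R 4)).
have k0 : 0 < k.+1%:R^-1 :> R by rewrite invr_gt0.
have [p hp] := rational_near (gauss (evens o)) k0.
have [q hq] := rational_near (gauss (odds o)) k0.
exists (p, q, k); first by split.
move=> o' ho'; apply: hd; move: ho'; rewrite /B /=.
have : near_rect (Complex (ratr p) (ratr q)) k.+1%:R^-1 o by split.
move: (Complex _ _) => c /cgauss_near h /cgauss_near h'.
have h1 : cmod (c - cgauss o) < 2 * k.+1%:R^-1 by rewrite cmodB; exact: h.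
have h2 : cmod (cgauss o' - c) < 2 * k.+1%:R^-1 by exact: h'.
have := cmodD (cgauss o' - c) (c - cgauss o); rewrite subrKA => h3; apply: le_lt_trans h3 _.
by move: h1 h2 hk; move: (cmod _) (cmod _) (k.+1%:R^-1) => x y t; lra.
Qed.

End gaussian_variables.

(** * The Gaussian measure *)

Section gaussian_series.
Variables (R : realType) (N : nat).
Local Notation C := R[i].
Local Notation V := 'cV[C]_N.
Local Notation H := (entireType R N).
Local Notation coin := (coin R).
Local Notation pr := (pr coin).
Variables (e : nat -> nat * nat) (e' : nat * nat -> nat).
Hypothesis (eK : cancel e e') (e'K : cancel e' e).
Variables (xi : nat -> nat -> H) (T : {linear H -> H}) (W : R).
Hypotheses (T_continuous : continuous T) (T0 : forall j, T (xi j 0%N) = 0)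
  (TS : forall j k, T (xi j k.+1) = xi j k)
  (xi_bound : forall r, exists2 D, 0 <= D & forall j k z, vnorm z <= r ->
    cmod (xi j k z) <= D * 8^-1 ^+ (j + k))
  (xi_dense : forall f r d, entire f -> 0 <= r -> 0 < d -> exists m (c : nat -> C),
    (forall i, (m <= i)%N -> c i = 0) /\
    forall z, vnorm z <= r -> cmod (f z - \sum_(i < m) c i * xi (e i).1 (e i).2 z) < d).
Local Notation w := (weight R e).
Hypotheses (w_le : forall m, \sum_(i < m) w i <= W)
  (w_cvg : forall d, 0 < d -> exists m0, forall m, (m0 <= m)%N -> W - \sum_(i < m) w i < d).
Implicit Types (o : bits) (z : V) (r d : R).

Let x n : H := xi (e n).1 (e n).2.
Let a n : R := 2 ^+ ((e n).1 + (e n).2).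

Let a_gt0 n : 0 < a n.
Proof. by rewrite exprn_gt0. Qed.

Let a_ge1 n : 1 <= a n.
Proof. by rewrite exprn_ege1// ler1n. Qed.

Let w_ge0 n : 0 <= w n.
Proof. by rewrite exprn_ge0// invr_ge0. Qed.

Let w_a n : (a n ^+ 2)^-1 = w n.
Proof. by rewrite /a /weight -exprM mulnC exprM -exprVn; congr ((_)^-1 ^+ _); rewrite expr2 -natrM. Qed.

Let x_bound r : exists2 D, 0 <= D & forall n z, vnorm z <= r -> cmod (x n z) * a n <= D * w n.
Proof.
have [D D0 hD] := xi_bound r; exists D => // n z zr.
apply: (@le_trans _ _ (D * 8^-1 ^+ ((e n).1 + (e n).2) * a n)).
  by rewrite ler_pM2r ?a_gt0// hD.
rewrite -mulrA ler_wpM2l// /a /weight -exprMn (_ : 8^-1 * 2 = 4^-1 :> R)//.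
by field.
Qed.

Let g n o : C := cgauss R (iid e n o).
Let ssum (c : nat -> C) : H := series_sum x a w W c.
Let inD (K : nat) : set cantorT := [set o | forall n, small_square (K%:R * a n) (iid e n o)].
(** On this event of full probability the coefficients are controlled by some constant; all
    identities about the random sum are proved there pointwise. *)
Let E : set cantorT := \bigcup_K inD K.

Let measurable_inD K : measurable (inD K).
Proof.
have h n : measurable (small_square (K%:R * a n)) := measurable_small_square _.
exact: (measurable_iid_all e h).
Qed.

Let measurable_E : measurable E.
Proof. by apply: bigcupT_measurable => K; exact: measurable_inD. Qed.

Let controlled_g K o : inD K o -> controlled a (2 * K%:R) (g ^~ o).
Proof.
move=> ho n; apply: le_trans (cmod_le_ReIm _) _.
by have [h1 h2] := ho n; rewrite -mulrA mulr_natl mulr2n lerD.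
Qed.

Let sum_w (L : nat) t m : 0 <= t -> \sum_(m <= n < L) t * w n <= t * (W - \sum_(i < m) w i).
Proof.
move=> t0; rewrite -mulr_sumr ler_wpM2l//.
have [mL|Lm] := leqP m L; last by rewrite big_geq ?subr_ge0// ltnW.
rewrite lerBrDl; apply: le_trans (w_le L).
by rewrite -!(big_mkord xpredT w) [leRHS](big_cat_nat (n := m)).
Qed.

(** By the tail bound, the [n]-th coefficient leaves the square of size [K%:R * a n] with
    probability at most [t * w n / K ^ 2], as [w n] is the inverse square of [a n]. These sum to at
    most [t * W / K ^ 2], which [K >= 1] lets bound by [d]. *)
Let pr_E : pr (~` E) = 0.
Proof.
have [t t0 ht] := pr_small_square R.
have W0 : 0 <= W by apply: le_trans (w_le 0); rewrite big_ord0.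
apply/eqP; rewrite eq_le pr_ge0 andbT; apply/ler_addgt0Pr => d d0; rewrite add0r.
pose K := (Num.trunc (t * W / d)).+1; have K0 : 0 < K%:R :> R by rewrite ltr0n.
have hK : t * W / d <= K%:R by rewrite ltW// truncnS_gt.
pose F n : set cantorT := ~` (iid e n @^-1` small_square (K%:R * a n)).
have mS n : measurable (small_square (K%:R * a n)) by exact: measurable_small_square.
have mF n : measurable (F n).
  by apply: measurableC; exact: measurable_preimage (measurable_iid e n) (mS n).
apply: (@le_trans _ _ (pr (\bigcup_n F n))).
  apply: le_pr; [exact: measurableC|exact: bigcupT_measurable|].
  by move=> o nE; apply: contrapT => nF; apply: nE; exists K => // n; apply: contrapT => nS; apply: nF; exists n.
apply: pr_bigcup_le => // L.
apply: (@le_trans _ _ (\sum_(0 <= n < L) (t / K%:R ^+ 2) * w n)).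
  rewrite big_mkord; apply: ler_sum => n _; rewrite /F pr_setC; last first.
    exact: measurable_preimage (measurable_iid e n) (mS n).
  rewrite (pr_iid1 R eK)//; apply: le_trans (ht _ _) _; first by rewrite mulr_gt0.
  by rewrite exprMn invfM mulrA w_a.
apply: le_trans (sum_w _ _ _) _; first by rewrite divr_ge0 ?exprn_ge0// ltW.
rewrite big_ord0 subr0 mulrAC ler_pdivrMr ?exprn_gt0//.
rewrite ler_pdivrMr// in hK; apply: le_trans hK _.
have K1 : 1 <= K%:R :> R by rewrite ler1n.
by rewrite mulrC ler_pM2l// expr2 ler_peMr// ltW.
Qed.

Let S o : H := if `[< E o >] then ssum (g ^~ o) else 0.

Let SE o : E o -> S o = ssum (g ^~ o).
Proof. by move=> Eo; rewrite /S asboolT. Qed.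

(* The preimage of an open set is a countable union of sets of sequences that are
   controlled by some K and whose first coefficients are close to given rational
   points. *)
Let measurable_S : measurable_fun setT (S : cantorT -> borel H).
Proof.
pose B (i : option (seq (rat * rat) * nat * nat)) : set cantorT :=
  if i is Some (s, k, K) then
    inD K `&` [set o | forall n, (if (n < size s)%N then
      near_rect (Complex (ratr (nth (0, 0) s n).1) (ratr (nth (0, 0) s n).2) : C) k.+1%:R^-1 else setT) (iid e n o)]
  else ~` E.
apply: (@measurable_to_borel _ H _ cantorT S _ B) => [[[[s k] K]|]|U o oU Uo].
- apply: measurableI; first exact: measurable_inD.
  pose D n : set cantorT := if (n < size s)%N then
    near_rect (Complex (ratr (nth (0, 0) s n).1) (ratr (nth (0, 0) s n).2) : C) k.+1%:R^-1 else setT.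
  have mD n : measurable (D n).
    by rewrite /D; case: ifP => _; [exact: measurable_near_rect|exact: measurableT].
  exact: (measurable_iid_all e mD).
- exact: measurableC.
have [[K _ ho]|nE] := pselect (E o); last first.
  exists None => //= o' nE'; rewrite /preimage /=; move: Uo.
  by rewrite /S !asboolF.
have Eo : E o by exists K.
have : nbhs (S o) U by exact: open_nbhs_nbhs.
move=> /entire_nbhs_ballP [r [d [r0 d0 hU]]].
have [m [t [t0 hm]]] := series_sum_near a_gt0 w_ge0 w_le w_cvg x_bound (controlled_g ho) r0 d0.
have [k hk] := inv_natS_lt (divr_gt0 t0 (ltr0n R 4)).
have k0 : 0 < k.+1%:R^-1 :> R by rewrite invr_gt0.
have /choice [p hp] n : exists p, `|complex.Re (g n o) - ratr p| < k.+1%:R^-1 := rational_near _ k0.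
have /choice [q hq] n : exists p, `|complex.Im (g n o) - ratr p| < k.+1%:R^-1 := rational_near _ k0.
pose s := mkseq (fun n => (p n, q n)) m.
exists (Some (s, k, K)).
  split=> // n; rewrite size_mkseq; case: ifPn => // nm; rewrite nth_mkseq//.
  by split; [exact: hp|exact: hq].
move=> o' [ho' h']; rewrite /preimage /=; apply: hU => z zr.
rewrite !SE//; last by exists K.
apply: hm => //; first exact: controlled_g.
move=> i im; have := h' i; rewrite size_mkseq im nth_mkseq//= => h1.
have h3 : near_rect (Complex (ratr (p i)) (ratr (q i)) : C) k.+1%:R^-1 (iid e i o).
  by split; [exact: hp|exact: hq].
move: (Complex _ _) h1 h3 => c /cgauss_near h1 /cgauss_near h3.
have h2 : cmod (g i o' - c) < 2 * k.+1%:R^-1 by exact: h1.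
have {}h3 : cmod (c - g i o) < 2 * k.+1%:R^-1 by rewrite cmodB; exact: h3.
have := cmodD (g i o' - c) (c - g i o); rewrite subrKA => h4; apply: le_lt_trans h4 _.
by move: h2 h3 hk; move: (cmod _) (cmod _) (k.+1%:R^-1) => ? ? ?; lra.
Qed.

Let shift n := e' ((e n).1, (e n).2.+1).

Let shift_inj : injective shift.
Proof.
move=> m n /(can_inj e'K) [h1 h2]; apply: (can_inj eK).
by rewrite [e m]surjective_pairing [e n]surjective_pairing h1 h2.
Qed.

Let e_shift n : e (shift n) = ((e n).1, (e n).2.+1).
Proof. exact: e'K. Qed.

Let iid_odds n o : iid e n (odds o) = iid e (shift n) o.
Proof. by rewrite /iid e_shift field_odds. Qed.

(** One step along a chain doubles the allowed growth [a], hence the factor 2; the union [E] over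
    all [K] is stable under the shift. *)
Let inD_odds K o : inD K o -> inD (2 * K) (odds o).
Proof.
move=> ho n; rewrite iid_odds; have := ho (shift n).
by rewrite /a e_shift /= addnS exprS natrM mulrCA mulrA.
Qed.

Let E_odds o : E o -> E (odds o).
Proof. by move=> [K _ ho]; exists (2 * K)%N => //; exact: inD_odds. Qed.

Let T_psum (c : nat -> C) n z :
  T (\sum_(0 <= k < n) c k *: x k) z = \sum_(k < n) c k * T (x k) z.
Proof.
rewrite big_mkord linear_sum; elim: n => [|n IH]; first by rewrite !big_ord0.
by rewrite !big_ord_recr /= -IH linearZ.
Qed.

(** By continuity T acts termwise on the series: it kills the terms of rank 0 and sends the term at
    [shift n] to [x n] with the coefficient of the shifted outcome. [series_reindex] matches the two
    enumerations. *)
Let T_S o : E o -> T (S o) = S (odds o).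
Proof.
move=> Eo; have [K _ ho] := Eo; rewrite !SE//; last exact: E_odds.
have cg := controlled_g ho; have cg' := controlled_g (inD_odds ho).
apply: entire_ext => z.
have [D D0 hD] := x_bound (vnorm z).
pose u n := g n o * T (x n) z.
have us n : u (shift n) = g n (odds o) * x n z.
  by rewrite /u /x e_shift TS /g iid_odds.
have u0 m : (forall n, m <> shift n) -> u m = 0.
  move=> hm; rewrite /u /x; case em : (e m) => [j [|k]] /=; first by rewrite T0 mulr0.
  by case: (hm (e' (j, k))); rewrite /shift e'K -em eK.
pose B := 2 * (2 * K)%:R * D.
have B0 : 0 <= B by rewrite !mulr_ge0.
(* The term at [shift n] is bounded by means of [w n], which is four times [w (shift n)]. *)
have ub n : cmod (u n) <= 4 * B * w n.
  have [[k ->]|/forallNP h] := pselect (exists k, n = shift k); last first.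
    by rewrite u0// cmod0 !mulr_ge0.
  rewrite us; apply: le_trans (term_bound a_gt0 k cg' hD (lexx _)) _.
  rewrite -/B /weight e_shift /= addnS exprS.
  by move: (B) (4^-1 ^+ _) => B1 y; rewrite le_eqVlt; apply/orP; left; apply/eqP; field.
have lim : forall d, 0 < d -> exists n0, forall n, (n0 <= n)%N ->
    cmod (\sum_(i < n) u (shift i) - ssum (g ^~ (odds o)) z) < d.
  move=> d d0; have [n0 hn0] := series_sum_lim a_gt0 w_le w_cvg x_bound z cg' d0.
  exists n0 => n /hn0; congr (cmod (_ - _) < _).
  by apply: eq_bigr => i _; rewrite us.
have lim1 := series_reindex w_ge0 w_le w_cvg (mulr_ge0 (ler0n R 4) B0) shift_inj ub u0 lim.
have FF : Filter ((\sum_(0 <= k < n) g k o *: x k)%R @[n --> \oo]) by exact: fmap_filter.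
have lim2 : T (\sum_(0 <= k < n) g k o *: x k) @[n --> \oo] --> T (ssum (g ^~ o)).
  exact: (cvg_comp _ _ (series_sum_cvg a_gt0 w_le w_cvg x_bound cg) (@T_continuous _)).
have FT : Filter (T (\sum_(0 <= k < n) g k o *: x k) @[n --> \oo]) by exact: fmap_filter.
apply/eqP; rewrite -subr_eq0; apply/eqP/eq0_small => d d0.
have d20 : 0 < d / 2 by rewrite divr_gt0.
have [n1 hn1] := lim1 _ d20.
have [n2 _ hn2] := (entire_cvg_ballP _ FT).1 lim2 _ _ (vnorm_ge0 z) d20.
pose n := maxn n1 n2.
have h1 := hn1 n (leq_maxl _ _).
have h2 := hn2 n (leq_maxr _ _) z (lexx _); rewrite T_psum in h2.
rewrite -(subrKA (\sum_(k < n) g k o * T (x k) z)); apply: le_trans (cmodD _ _) _.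
by rewrite [d]splitr ltW// ltrD.
Qed.

(* The event that finitely many coefficients are close to prescribed ones and the
   others are controlled has positive probability, by independence. *)
Let pr_S_gt0 (U : set H) : open U -> U !=set0 -> 0 < pr (S @^-1` U).
Proof.
move=> oU [f Uf]; have : nbhs f U by exact: open_nbhs_nbhs.
move=> /entire_nbhs_ballP [r [d [r0 d0 hU]]].
have d20 : 0 < d / 2 by rewrite divr_gt0.
have [m0 [c [c0 hc]]] := xi_dense (entireP f) r0 d20.
pose K := (Num.trunc (1 + \sum_(i < m0) cmod (c i))).+1.
have cK n : cmod (c n) + 1 <= K%:R * a n.
  have h : cmod (c n) + 1 <= 1 + \sum_(i < m0) cmod (c i).
    rewrite addrC lerD2l; have [nm|mn] := ltnP n m0; last first.
      by rewrite c0// cmod0 sumr_ge0// => i _; exact: cmod_ge0.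
    by rewrite (bigD1 (Ordinal nm))//= lerDl sumr_ge0// => i _; exact: cmod_ge0.
  apply: le_trans h _; apply: le_trans (ltW (truncnS_gt _)) _.
  by rewrite -/K ler_peMr.
have K1 : 1 <= K%:R :> R by rewrite ler1n.
have cc : controlled a (2 * K%:R) c.
  move=> n; apply: (@le_trans _ _ (K%:R * a n)); first by apply: le_trans (cK n); rewrite lerDl.
  by rewrite -mulrA ler_peMl ?ler1n// mulr_ge0// ltW.
have [m [t [t0 hm]]] := series_sum_near a_gt0 w_ge0 w_le w_cvg x_bound cc r0 d20.
(* The bound 1 keeps the rectangles inside the squares, by the margin left in [cK]; the bound
   [t / 2] matches the factor 2 of [cgauss_near]. *)
pose q : R := Num.min 1 (t / 2).
have q0 : 0 < q by rewrite lt_min ltr01 divr_gt0.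
have q1 : q <= 1 by rewrite ge_min lexx.
have qt : q <= t / 2 by rewrite ge_min lexx orbT.
have sub n : near_rect (c n) q `<=` small_square (K%:R * a n).
  have B (y y0 : R) : `|y0| <= cmod (c n) -> `|y - y0| < q -> `|y| <= K%:R * a n.
    move=> h1 h2; apply: le_trans (cK n); rewrite -[y](subrK y0) addrC.
    apply: le_trans (ler_normD _ _) _; apply: lerD => //; apply: le_trans q1; exact: ltW.
  by move=> o [h1 h2]; split; [apply: B h1; exact: Re_le_cmod|apply: B h2; exact: Im_le_cmod].
have [s s0 hs] := pr_small_square R.
have s20 : 0 < 2^-1 / s by rewrite divr_gt0.
(* From [m1] on, the coefficients violate their control with total probability at most 1/2, as
   [pr_iid_gt0] asks. *)
have [m1 hm1] := w_cvg s20.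
pose m2 := maxn m m1.
pose D n : set cantorT := if (n < m2)%N then near_rect (c n) q else small_square (K%:R * a n).
have mD n : measurable (D n).
  by rewrite /D; case: ifP => _; [exact: measurable_near_rect|exact: measurable_small_square].
have D0 n : 0 < pr (D n).
  apply: lt_le_trans (pr_near_rect (c n) q0) _; apply: le_pr => //; first exact: measurable_near_rect.
  by rewrite /D; case: ifP => _ o ho; [exact: ho|exact: (sub n o ho)].
have tail l : \sum_(m2 <= n < l) (1 - pr (D n)) <= 2^-1.
  apply: (@le_trans _ _ (\sum_(m2 <= n < l) s * w n)).
    apply: ler_sum_nat => n /andP[mn _]; rewrite /D ltnNge mn /=.
    apply: le_trans (hs _ _) _; first by rewrite mulr_gt0// (lt_le_trans ltr01).
    rewrite exprMn invfM mulrA w_a ler_wpM2r// ler_pdivrMr ?exprn_gt0 ?(lt_le_trans ltr01)//.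
    by rewrite ler_peMr ?exprn_ege1// ltW.
  apply: le_trans (sum_w _ _ (ltW s0)) _.
  have := hm1 m2 (leq_maxr _ _); rewrite ltr_pdivlMr// mulrC => /ltW; exact.
apply: lt_le_trans (pr_iid_gt0 eK mD D0 tail) _.
have mU : measurable (U : set (borel H)) by exact: sub_sigma_algebra.
apply: le_pr; [exact: measurable_iid_all|exact: measurable_preimage measurable_S mU|].
move=> o ho; have inK : inD K o.
  by move=> n; have := ho n; rewrite /D; case: ifP => _ h; [exact: (sub n _ h)|exact: h].
rewrite /preimage /= SE; last by exists K.
apply: hU => z zr.
have cz : ssum c z = \sum_(i < m0) c i * x i z.
  apply: (series_sum_unique a_gt0 w_le w_cvg x_bound cc) => b b0; exists m0 => n mn.
  rewrite -!(big_mkord xpredT (fun i => c i * x i z)) (big_cat_nat (n := m0))//=.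
  rewrite addrAC subrr add0r big_nat_cond big1 ?cmod0// => i.
  by rewrite andbT => /andP[mi _]; rewrite c0// mul0r.
have h1 := hc z zr; rewrite -/(x _) -cz in h1.
have h2 : cmod (ssum c z - ssum (g ^~ o) z) < d / 2.
  apply: hm => //; first exact: controlled_g.
  move=> i im; have := ho i; rewrite /D (leq_trans im (leq_maxl _ _)) => /cgauss_near h.
  by apply: lt_le_trans h _; rewrite mulrC -ler_pdivlMr.
rewrite -(subrKA (ssum c z)); apply: le_lt_trans (cmodD _ _) _.
by rewrite [d]splitr ltrD.
Qed.

(** T and the shift are intertwined by [S] on [E] only; events that agree on [E] have the same
    probability, which transfers invariance and mixing to the law of [S]. *)
Let pr_ae (P Q : set cantorT) : measurable P -> measurable Q ->
  (forall o, E o -> P o <-> Q o) -> pr P = pr Q.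
Proof.
move=> mP mQ h; have mEc : measurable (~` E) by exact: measurableC.
have le (P1 Q1 : set cantorT) : measurable P1 -> measurable Q1 ->
    (forall o, E o -> P1 o -> Q1 o) -> pr P1 <= pr Q1.
  move=> mP1 mQ1 h1; rewrite -[leRHS]addr0 -pr_E; apply: le_trans (le_prU coin mQ1 mEc).
  apply: le_pr => //; first exact: measurableU.
  by move=> o Po; have [Eo|] := pselect (E o); [left; exact: h1|right].
by apply/eqP; rewrite eq_le; apply/andP; split; apply: le => // o /h [].
Qed.

Let E_iter n o : E o -> E (iter n odds o).
Proof. by elim: n => //= n IH Eo; apply/E_odds/IH. Qed.

Let T_iter n o : E o -> iter n T (S o) = S (iter n odds o).
Proof. by elim: n => // n IH Eo; rewrite !iterS IH// T_S//; exact: E_iter. Qed.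

Let measurable_T n : measurable_fun setT (iter n T : borel H -> borel H).
Proof.
elim: n => [|n IH]; first exact: measurable_id.
exact: (measurableT_comp (measurable_continuous_borel T_continuous) IH).
Qed.

Let measurable_g n : measurable_fun setT (g n : cantorT -> borel C).
Proof. exact: (measurableT_comp (@measurable_cgauss R) (measurable_iid e n)). Qed.

Let mu : probability (borel H) R := distribution coin (mfun_of measurable_S).

Let mS (B : set (borel H)) : measurable B -> measurable (S @^-1` B : set cantorT).
Proof. exact: measurable_preimage measurable_S. Qed.

Let coin_iid n (A : set cantorT) : measurable A -> coin (iid e n @^-1` A) = coin A.
Proof.
move=> mA; have mI := measurable_preimage (measurable_iid e n) mA.
by rewrite (prE coin mI) (prE coin mA) (pr_iid1 R eK).
Qed.

Let pr_odds (A : set cantorT) : measurable A -> pr (odds @^-1` A) = pr A.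
Proof.
move=> mA; have mo := measurable_preimage measurable_odds mA.
apply: EFin_inj; rewrite -(prE coin mo) -(prE coin mA); exact: coin_odds.
Qed.

Let mu_gaussian : gaussian_measure (X := H) mu.
Proof.
exists _, cantorT, coin, (fun n => mfun_of (measurable_g n)), x, (mfun_of measurable_S).
split=> //.
- move=> n U V mU mV; rewrite -coin_cgauss// -(coin_iid n)//.
  apply: measurableI.
    exact: measurable_preimage (@measurable_Re_cgauss R) mU.
  exact: measurable_preimage (@measurable_Im_cgauss R) mV.
- move=> s B us mB.
  have mc n : measurable (cgauss R @^-1` B n : set cantorT).
    exact: measurable_preimage (@measurable_cgauss R) (mB n).
  have -> : (\prod_(n <- s) coin (g n @^-1` B n))%E = (\prod_(n <- s) pr (cgauss R @^-1` B n))%:E.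
    elim: s {us} => [|n s IH]; first by rewrite !big_nil.
    rewrite !big_cons IH EFinM; congr (_ * _)%E.
    exact: etrans (coin_iid n (mc n)) (prE coin (mc n)).
  rewrite -(pr_iid R eK us mc) -prE.
    by congr coin; apply/seteqP; split=> o h n; exact: h.
  rewrite (_ : [set _ | _] = \bigcap_(n in [set` s]) (iid e n @^-1` (cgauss R @^-1` B n))).
    by apply: bigcap_measurableType => n _; exact: measurable_preimage (measurable_iid e n) (mc n).
  by apply/seteqP; split=> o h n; exact: h.
exists (~` E); split; first exact: measurableC.
  by apply: etrans (prE coin (measurableC measurable_E)) _; rewrite pr_E.
move=> o /= h Eo; apply: h; have [K _ ho] := Eo; rewrite SE//.
exact: (series_sum_cvg a_gt0 w_le w_cvg x_bound (controlled_g ho)).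
Qed.

Theorem gaussian_series_mixing : strongly_mixing_gaussian T.
Proof.
exists mu; split.
- exact: mu_gaussian.
- move=> B mB; have mTB : measurable (T @^-1` B : set (borel H)).
    exact: measurable_preimage (measurable_T 1) mB.
  transitivity (coin (S @^-1` (T @^-1` B))) => //.
  transitivity (coin (S @^-1` B)) => //.
  rewrite (prE coin (mS mTB)) (prE coin (mS mB)); congr EFin.
  have mo : measurable (odds @^-1` (S @^-1` B) : set cantorT).
    exact: measurable_preimage measurable_odds (mS mB).
  rewrite -(pr_odds (mS mB)).
  by apply: pr_ae => //; [exact: mS|move=> o Eo; rewrite /preimage /= T_S].
- move=> U oU U0; have := pr_S_gt0 oU U0; rewrite -lte_fin -prE//.
  by apply: mS; exact: sub_sigma_algebra.
- move=> A B mA mB.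
  have mT n : measurable (iter n T @^-1` B : set (borel H)) by exact: measurable_preimage (measurable_T n) mB.
  have muE (Q : set (borel H)) : measurable Q -> mu Q = (pr (S @^-1` Q))%:E.
    by move=> mQ; exact: (prE coin (mS mQ)).
  rewrite !muE// -EFinM; apply: cvg_EFin.
    by apply: nearW => n; apply: fin_num_measure; exact: measurableI.
  have lim := coin_mixing (mS mA) (mS mB).
  rewrite (_ : fine \o _ = fun n => pr (S @^-1` A `&` iter n odds @^-1` (S @^-1` B))); first exact: lim.
  apply/funext => n; transitivity (pr (S @^-1` (A `&` iter n T @^-1` B))); first by [].
  apply: pr_ae.
  + by apply: mS; exact: measurableI.
  + apply: measurableI; first exact: mS.
    exact: measurable_preimage (measurable_iter_odds n) (mS mB).
  by move=> o Eo; rewrite /preimage /setI /= T_iter.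
Qed.

End gaussian_series.

Theorem proposition4p4 (R : realType) (N : nat) (A : 'M[R[i]]_N)
    (v b : 'cV[R[i]]_N) (M : {vspace 'cV[R[i]]_N})
    (A_invertible : A \in unitmx) (v_neq0 : v != 0)
    (phi_fixpoint : exists z, affine A b z = z)
    (v_in_M : v \in M) (M_reduces : reduces M A)
    (M_norm : (operator_norm ((restriction A M)^-1)%VF < 1)%E) :
  exists T : {linear entireType R N -> entireType R N},
    [/\ continuous T,
        forall f : entireType R N, (T f : _ -> _) = 'D_v f \o affine A b
      & strongly_mixing_gaussian T ].
Proof.
have [p p_fixed] := phi_fixpoint.
exists (opT A b v); split; [exact: opT_continuous|exact: opTE|].
have [e [e' [eK e'K]]] := exists_pairing.
have [xi [T0 TS xi_bound xi_dense]] := scaled_chains A_invertible v_neq0 p_fixed v_in_M M_reduces M_norm e'K.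
have w_ge0 n : 0 <= weight R e n by rewrite exprn_ge0// invr_ge0.
have [W [w_le w_cvg]] := sum_sup w_ge0 (weight_sum R eK).
exact: (gaussian_series_mixing eK e'K (@opT_continuous _ _ A b v) T0 TS xi_bound xi_dense w_le w_cvg).
Qed.
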